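(* Let $T>0$, $\alpha\in(0,1)$, let $P$ be a probability distribution on $\mathcal{L}_T$, let $\lambda_1,\lambda_2,\ldots$ be i.i.d. with law $P$, and suppose that there is a constant $c$ such that $\sigma(t)>c>0$ for all $t$ in an interval $[t_*,t^*]\subset[0,T]$. Let $\ell_n(t)=\overline{\lambda}_n(t)-\tilde Z(\alpha)/\sqrt n$ and $u_n(t)=\overline{\lambda}_n(t)+\tilde Z(\alpha)/\sqrt n$, $t\in[0,T]$, be the multiplier bootstrap confidence band. Then, as $n\to\infty$, $$\mathbb{P}\Bigl(\ell_n(t)\le\mu(t)\le u_n(t)\ \text{for all } t\in[t_*,t^*]\Bigr)\ge 1-\alpha-O\left(\frac{(\log n)^{7/8}}{n^{1/8}}\right).$$ Also, $\sup_t\left(u_n(t)-\ell_n(t)\right)=O_P\left(\sqrt{1/n}\right)$.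
   Context: Landscapes: a (finite, $T$-bounded) persistence diagram $D$ is a finite multiset of pairs $(b,d)$ with $0\le b\le d\le T$. For such a pair let $\Lambda_{(b,d)}(t)=\max\{0,\min(t-b,d-t)\}$. The (first) persistence landscape of $D$ is $\lambda_D(t)=\max_{(b,d)\in D}\Lambda_{(b,d)}(t)$, $t\in[0,T]$ (and $\lambda_D\equiv 0$ if $D$ is empty). $\mathcal{L}_T$ is the set of all such functions $\lambda_D$; each is one-Lipschitz with values in $[0,T/2]$. It carries a $\sigma$-algebra for which all evaluation maps $f_t:\mathcal{L}_T\to\mathbb{R}$, $f_t(\lambda)=\lambda(t)$, are measurable. Notation: $\mu(t)=\mathbb{E}[\lambda_1(t)]$; $\overline{\lambda}_n(t)=\frac1n\sum_{i=1}^n\lambda_i(t)$; $\sigma(t)=\sqrt{\mathrm{Var}(\lambda_1(t))}$. Multiplier bootstrap: let $\xi_1,\xi_2,\ldots$ be i.i.d. $N(0,1)$, independent of the $\lambda_i$, and set $\tilde{\mathbb{G}}_n(f_t)=\frac{1}{\sqrt n}\sum_{i=1}^n\xi_i\left(\lambda_i(t)-\overline{\lambda}_n(t)\right)$, $t\in[0,T]$. $\tilde Z(\alpha)$ is the value with $\mathbb{P}\left(\sup_{t\in[0,T]}|\tilde{\mathbb{G}}_n(f_t)|>\tilde Z(\alpha)\,\middle|\,\lambda_1,\ldots,\lambda_n\right)=\alpha$; precisely, $\tilde Z(\alpha)=\inf\{z:\mathbb{P}(\sup_{t\in[0,T]}|\tilde{\mathbb{G}}_n(f_t)|>z\mid\lambda_1,\ldots,\lambda_n)\le\alpha\}$.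 (Monte Carlo error in approximating $\tilde Z(\alpha)$ is ignored.) *)

(* Defs.v *)
From HB Require Import structures.
From mathcomp Require Import all_boot all_order all_algebra finmap.
From mathcomp Require Import all_classical all_reals all_analysis.

Set Implicit Arguments.
Unset Strict Implicit.
Unset Printing Implicit Defensive.

Import Order.TTheory GRing.Theory Num.Theory.
Import numFieldNormedType.Exports.

Local Open Scope classical_set_scope.
Local Open Scope ring_scope.

(* A finite multiset of (birth, death) pairs is listed as a sequence; the
   landscape below does not depend on the order. *)
Definition persistence_diagram (R : realType) (T : R) (D : seq (R * R)) : Prop :=
  forall p, p \in D -> 0 <= p.1 /\ p.1 <= p.2 /\ p.2 <= T.

Definition tent (R : realType) (p : R * R) (t : R) : R :=
  Num.max 0 (Num.min (t - p.1) (p.2 - t)).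

(* Tents are nonnegative, so the initial value 0 of the maximum only matters
   for the empty diagram. *)
Definition landscape_of (R : realType) (D : seq (R * R)) (t : R) : R :=
  \big[Num.max/0]_(p <- D) tent p t.

(* The landscapes of T-bounded diagrams are carried as functions on the whole
   line; they vanish outside [0, T], so they are determined by their
   restriction to [0, T]. *)
Record landscape (R : realType) (T : R) := Landscape {
  landscape_fun :> R -> R;
  landscapeP : exists2 D, persistence_diagram T D & landscape_fun = landscape_of D
}.

Lemma landscape0_subproof (R : realType) (T : R) :
  exists2 D, persistence_diagram T D & cst 0 = landscape_of D.
Proof.
by exists [::] => //; apply/funext => t; rewrite /landscape_of big_nil.
Qed.

Section landscape_pointed.
Variables (R : realType) (T : R).
HB.instance Definition _ := gen_eqMixin (landscape T).
HB.instance Definition _ := gen_choiceMixin (landscape T).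
HB.instance Definition _ :=
  isPointed.Build (landscape T) (Landscape (landscape0_subproof T)).
End landscape_pointed.

Section independence.
Context d (Omega : measurableType d) (R : realType) (Pr : probability Omega R).
Local Open Scope ereal_scope.

Definition independent_seq d' (E : measurableType d')
    (X : nat -> {mfun Omega >-> E}) : Prop :=
  forall (J : {fset nat}) (A : nat -> set E),
    (forall i, i \in J -> measurable (A i)) ->
    Pr (\bigcap_(i in [set` J]) (X i @^-1` A i)) =
    \prod_(i <- J) Pr (X i @^-1` A i).

(* A generating family of the sigma-algebra generated by the X i, i in J. *)
Definition preimage_family d' (E : measurableType d')
    (X : nat -> {mfun Omega >-> E}) (J : set nat) : set (set Omega) :=
  \bigcup_(i in J) preimage_set_system setT (X i) measurable.

(* Independence of the whole sequence X from the whole sequence Y. *)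
Definition independent_of d1 d2 (E1 : measurableType d1) (E2 : measurableType d2)
    (X : nat -> {mfun Omega >-> E1}) (Y : nat -> {mfun Omega >-> E2}) : Prop :=
  forall A B, <<s preimage_family X setT >> A -> <<s preimage_family Y setT >> B ->
    Pr (A `&` B) = Pr A * Pr B.

(* kappa is a regular conditional distribution of the real random variable S
   given the sigma-algebra <<s F >>; measurability of w |-> kappa w B with
   respect to <<s F >> is part of the kernel structure. *)
Definition cond_distribution (F : set (set Omega)) (S : Omega -> R)
    (kappa : R.-pker (g_sigma_algebraType F) ~> (measurableTypeR R)) : Prop :=
  forall (A : set Omega) (B : set (measurableTypeR R)),
    <<s F >> A -> measurable B ->
    \int[Pr]_(w in A) kappa w B = Pr (A `&` S @^-1` B).

(* X n = O_P(r n) as n -> oo *)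
Definition bigO_P (X : nat -> Omega -> R) (r : nat -> R) : Prop :=
  forall eps : R, (0 < eps)%R ->
    exists M : R, \forall n \near \oo,
      Pr [set w | `|X n w| > M * `|r n|]%R <= eps%:E.

Definition mean_fun (T : R) (X : Omega -> landscape T) (t : R) : R :=
  fine 'E_Pr[fun w => X w t].

Definition std_fun (T : R) (X : Omega -> landscape T) (t : R) : R :=
  Num.sqrt (fine 'V_Pr[fun w => X w t]).

End independence.

Section bootstrap.
Variables (R : realType) (T : R).
Implicit Types (l : nat -> landscape T) (x : nat -> R).

(* Samples are indexed from 0: the first n observations are l 0, ..., l n.-1. *)
Definition emp_mean l (n : nat) (t : R) : R := n%:R^-1 * \sum_(i < n) l i t.

Definition bootstrap_process l x (n : nat) (t : R) : R :=
  (Num.sqrt n%:R)^-1 * \sum_(i < n) x i * (l i t - emp_mean l n t).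

(* The supremum is genuine when 0 <= T: landscapes are bounded. *)
Definition bootstrap_sup l x (n : nat) : R :=
  sup [set `|bootstrap_process l x n t| | t in `[0, T]].

(* For a probability m and 0 < alpha < 1 the set is nonempty and bounded below,
   so the real-valued inf is the genuine infimum. *)
Definition upper_quantile (alpha : R) (m : set R -> \bar R) : R :=
  inf [set z | (m [set y | (z < y)%R] <= alpha%:E)%E].

Definition band_lower l (n : nat) (z : R) (t : R) : R :=
  emp_mean l n t - z / Num.sqrt n%:R.

Definition band_upper l (n : nat) (z : R) (t : R) : R :=
  emp_mean l n t + z / Num.sqrt n%:R.

End bootstrap.

(* Main.v *)
Require Import Defs.
From HB Require Import structures.
From mathcomp Require Import all_boot all_order all_algebra finmap.
From mathcomp Require Import all_classical all_reals all_analysis.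
From mathcomp Require Import measurable_realfun.
From mathcomp Require Import ring lra.

(** Write X_i(t) = lambda_i(t) - mu(t).  Up to the factor n^(-1/2), the centred
    empirical process is S(t) = sum_i X_i(t), the multiplier process with the
    true centring is V(t) = sum_i xi_i X_i(t), and the bootstrap process W is V
    recentred at the empirical mean.  The proof compares S, V and W directly,
    through smooth functions of their suprema, without passing through a Gaussian
    process.  What enters about the multipliers is that they have mean 0, variance
    1 and a finite third absolute moment.

    Smoothing.  The supremum over the interval is replaced by the maximum over a
    grid of n + 1 points with both signs: the paths are Lipschitz, so the grid
    is harmless.  With A(w) = sum_r exp(w_r), the function
    soft_step zeta w = A(w) / (exp zeta + A(w)) is a smooth version of the
    indicator of max_r w_r > zeta; it is evaluated at w = beta S (or beta V,
    beta W) after scaling by n^(-1/2).  Its transition has width of order ln n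
    (soft_step_small, soft_step_large), hence ln n / beta on the scale of the
    supremum.  The weights exp(w_r) / (exp zeta + A(w)) sum to less than 1, so
    its Taylor expansions have errors that do not depend on the number of grid
    points (soft_step_taylor3).

    Comparison.  Replacing X_i by xi_i X_i one index at a time changes neither
    the mean nor the second moments, which gives
    |E soft_step(S) - E soft_step(V)| = O(beta^3 / sqrt n) (lindeberg).  The
    centring costs O(beta / sqrt n) (centering_rate).

    Anticoncentration.  Expanding E sum_i soft_mean(S; X_i) to second order in
    each X_i shows that beta^2 c^2 E[soft_step (1 - soft_step)](S) is at most of
    the order of beta E sup |S|, which is O(beta) (anticoncentration,
    deviation_energy).  Since soft_step (1 - soft_step) controls the variation
    of soft_step in zeta, the function zeta |-> E soft_step zeta (S) varies by
    O(1 / beta) on intervals of length 1 (mean_step_shift).  This is where the lower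
    bound on the variance enters.

    Conditioning.  Given the landscapes, the conditional expectation of
    soft_step(V) moves by O(beta^2 / n) when one landscape is changed, so it
    deviates from its mean by O(beta^2 / sqrt n) in L^1
    (bounded_difference_variance, conditional_step_deviation).

    Conclusion.  Take zeta such that E soft_step zeta (S) is slightly more than
    alpha + O(beta^3 / sqrt n) + 1 / beta (mean_step_level), and z slightly less than
    zeta / beta.  If the conditional probability that the bootstrap supremum
    exceeds z is at most alpha, then the conditional expectation of
    soft_step(W) is at most about alpha, that is 1 / beta below its mean; by
    Markov this has probability O(beta^3 / sqrt n) (small_tail_probability).
    Otherwise the quantile is at least z, and a failure of the band pushes the
    grid maximum of S above a level close to z, an event of probability at most
    alpha + O(ln n / beta + beta^3 / sqrt n) (miss_probability).  The choice
    beta = (n ln n)^(1/8) turns ln n / beta into the announced rate and makes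
    beta^3 / sqrt n no larger than it (smoothing_scale).

    Width.  The second moment of the bootstrap supremum is bounded uniformly in
    n, by orthogonality of the increments of W along the grid
    (bootstrap_sup_tail), and a conditional quantile of level alpha inherits
    this tightness at the price of a factor 1 / alpha (quantile_tail). *)

Set Implicit Arguments.
Unset Strict Implicit.
Unset Printing Implicit Defensive.

Import Order.TTheory GRing.Theory Num.Theory.
Import numFieldNormedType.Exports.

Local Open Scope classical_set_scope.
Local Open Scope ring_scope.

(** * Taylor bounds for the soft step *)
Section exp_taylor.
Context {R : realType}.
Implicit Types (f df : R -> R) (x y K eta : R).

(** With f 0 = 0, a bound on f' near 0 gains one order on f; iterating it on the
    remainders of exp yields the three expansions below. *)
Lemma MVT_bound f df K eta y : f 0 = 0 ->
  (forall x, is_derive x 1 f (df x)) ->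
  (forall x, `|x| <= eta -> `|df x| <= K) -> `|y| <= eta -> `|f y| <= K * eta.
Proof.
move=> f0 fdf dfK yeta.
have eta0 : 0 <= eta := le_trans (normr_ge0 y) yeta.
have cf : continuous f.
  by move=> x; apply/differentiable_continuous/derivable1_diffP; have [] := fdf x.
have K0 : 0 <= K by apply: le_trans (dfK 0 _); rewrite ?normr0.
have ceta c : `|c| <= `|y| -> `|df c| <= K by move=> cy; apply/dfK/(le_trans cy).
have key c u : c = u * y -> 0 <= u <= 1 -> `|f y| = `|df c| * `|y| -> `|f y| <= K * eta.
  move=> cE /andP[u0 u1] ->; apply: ler_pM => //; apply: ceta.
  by rewrite cE normrM ger0_norm// ler_piMl.
have [y0|y0|->] := ltgtP y 0; last by rewrite f0 normr0 mulr_ge0.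
- have [c] := MVT_segment (ltW y0) (fun x _ => fdf x) (continuous_subspaceT cf).
  rewrite in_itv/= f0 !sub0r => /andP[yc c0] E.
  apply: (key c (c / y)); first by rewrite divfK ?lt_eqF.
  + by rewrite ler_ndivlMr// ler_ndivrMr// mul0r mul1r c0.
  + by rewrite -(normrN (f y)) E normrM normrN.
- have [c] := MVT_segment (ltW y0) (fun x _ => fdf x) (continuous_subspaceT cf).
  rewrite in_itv/= f0 !subr0 => /andP[c0 cy] E.
  apply: (key c (c / y)); first by rewrite divfK ?gt_eqF.
  + by rewrite divr_ge0 ?(ltW y0)// ler_pdivrMr// mul1r.
  + by rewrite E normrM.
Qed.

Lemma expR_le4 x : `|x| <= 1 -> expR x <= 4.
Proof.
move=> x1.
have -> : expR x = expR (x / 2) ^+ 2 by rewrite -expRM_natl; congr expR; field.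
have h : expR (- (x / 2)) >= 1 / 2.
  apply: le_trans (expR_ge1Dx _); move: x1; rewrite ler_norml => /andP[]; lra.
have e : expR (x / 2) * expR (- (x / 2)) = 1 by rewrite expRN mulfV// gt_eqF ?expR_gt0.
have := expR_gt0 (x / 2); nra.
Qed.

Lemma expR_taylor1 eta y : eta <= 1 -> `|y| <= eta -> `|expR y - 1| <= 4 * eta.
Proof.
move=> eta1; apply: (MVT_bound (f := fun x => expR x - 1) (df := expR)).
- by rewrite expR0 subrr.
- by move=> x; apply: is_derive_eq; rewrite subr0.
- by move=> x xe; rewrite ger0_norm ?expR_ge0// expR_le4// (le_trans xe).
Qed.

Lemma expR_taylor2 eta y : eta <= 1 -> `|y| <= eta ->
  `|expR y - 1 - y| <= 4 * eta ^+ 2.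
Proof.
move=> eta1; rewrite expr2 mulrA.
apply: (MVT_bound (f := fun x => expR x - 1 - x) (df := fun x => expR x - 1)).
- by rewrite expR0 !subrr.
- by move=> x; apply: is_derive_eq; rewrite subr0.
- by move=> x xe; exact: expR_taylor1.
Qed.

Lemma expR_taylor3 eta y : eta <= 1 -> `|y| <= eta ->
  `|expR y - 1 - y - y ^+ 2 / 2| <= 4 * eta ^+ 3.
Proof.
move=> eta1; rewrite (exprSr _ 2) mulrA.
apply: (MVT_bound (f := fun x => expR x - 1 - x - x ^+ 2 / 2)
                  (df := fun x => expR x - 1 - x)).
- by rewrite expR0 !subrr expr0n /= mul0r subr0.
- move=> x; apply: is_derive_eq.
  rewrite !scaler0 add0r /GRing.scale/= subr0 mulr1; by field.
- by move=> x xe; exact: expR_taylor2.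
Qed.
End exp_taylor.

Section smooth_step.
Context {R : realType} {I : finType}.
Implicit Types (w x y : I -> R) (z eta b : R).

(** Gibbs weights over the indices together with one extra state of energy z:
    they sum to less than 1, the missing mass being carried by that state. *)
Definition soft_weight z w r : R := expR (w r) / (expR z + \sum_s expR (w s)).

(** Smooth version of the indicator of max w > z: the mass that is not carried by
    the extra state. *)
Definition soft_step z w : R := \sum_r soft_weight z w r.

Definition soft_mean z w x : R := \sum_r soft_weight z w r * x r.

Lemma soft_den_gt0 z w : 0 < expR z + \sum_s expR (w s).
Proof. by rewrite ltr_wpDr ?expR_gt0// sumr_ge0// => *; exact: expR_ge0. Qed.

Lemma soft_weight_ge0 z w r : 0 <= soft_weight z w r.
Proof. by rewrite divr_ge0 ?expR_ge0// ltW ?soft_den_gt0. Qed.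

Lemma soft_stepE z w : soft_step z w =
  (\sum_s expR (w s)) / (expR z + \sum_s expR (w s)).
Proof. by rewrite /soft_step -mulr_suml. Qed.

Lemma soft_stepC z w : 1 - soft_step z w = expR z / (expR z + \sum_s expR (w s)).
Proof.
rewrite soft_stepE; have := soft_den_gt0 z w.
by move: (\sum_s _) (expR z) => S e D0; field; rewrite gt_eqF.
Qed.

Lemma soft_step_ge0 z w : 0 <= soft_step z w.
Proof. by rewrite sumr_ge0// => r _; exact: soft_weight_ge0. Qed.

Lemma soft_step_lt1 z w : soft_step z w < 1.
Proof. by rewrite -subr_gt0 soft_stepC divr_gt0 ?expR_gt0 ?soft_den_gt0. Qed.

Lemma soft_step_le1 z w : soft_step z w <= 1.
Proof. exact/ltW/soft_step_lt1. Qed.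

Lemma soft_mean_le z w x y : (forall r, x r <= y r) ->
  soft_mean z w x <= soft_mean z w y.
Proof. by move=> xy; apply: ler_sum => r _; rewrite ler_wpM2l// soft_weight_ge0. Qed.

Lemma soft_mean_cst z w b : soft_mean z w (fun=> b) = soft_step z w * b.
Proof. by rewrite /soft_mean -mulr_suml. Qed.

Lemma soft_meanD z w x y :
  soft_mean z w (fun r => x r + y r) = soft_mean z w x + soft_mean z w y.
Proof. by rewrite -big_split; apply: eq_bigr => r _; rewrite mulrDr. Qed.

Lemma soft_meanZ z w b x :
  soft_mean z w (fun r => b * x r) = b * soft_mean z w x.
Proof. by rewrite mulr_sumr; apply: eq_bigr => r _; rewrite mulrCA. Qed.

Lemma soft_meanB z w x y :
  soft_mean z w (fun r => x r - y r) = soft_mean z w x - soft_mean z w y.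
Proof. by rewrite -sumrB; apply: eq_bigr => r _; rewrite mulrBr. Qed.

Lemma soft_mean_norm z w x b : (forall r, `|x r| <= b) -> 0 <= b ->
  `|soft_mean z w x| <= b.
Proof.
move=> xb b0; apply: le_trans (ler_norm_sum _ _ _) _.
apply: (@le_trans _ _ (soft_mean z w (fun=> b))).
  by apply: ler_sum => r _; rewrite normrM ger0_norm ?soft_weight_ge0// ler_wpM2l ?soft_weight_ge0.
by rewrite soft_mean_cst ler_piMl// soft_step_le1.
Qed.

(** Cauchy-Schwarz for a measure of total mass soft_step z w: it follows from the
    nonnegativity of the weighted mean of (x - t)^2 at t = m / g. *)
Lemma soft_mean_sqr z w x :
  soft_mean z w x ^+ 2 <= soft_step z w * soft_mean z w (fun r => x r ^+ 2).
Proof.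
set m := soft_mean z w x; set g := soft_step z w.
have key t : 0 <= soft_mean z w (fun r => x r ^+ 2) - 2 * t * m + t ^+ 2 * g.
  have : 0 <= soft_mean z w (fun r => (x r - t) ^+ 2).
    by rewrite sumr_ge0// => r _; rewrite mulr_ge0 ?soft_weight_ge0 ?sqr_ge0.
  have -> : soft_mean z w (fun r => (x r - t) ^+ 2) =
      soft_mean z w (fun r => x r ^+ 2 - 2 * t * x r + t ^+ 2).
    by apply: eq_bigr => r _; congr (_ * _); ring.
  by rewrite soft_meanD soft_meanB soft_meanZ soft_mean_cst (mulrC g).
have := soft_step_ge0 z w; rewrite le_eqVlt -/g => /predU1P[g0|g0].
  have wr0 r : soft_weight z w r = 0.
    move: g0 => /esym/eqP; rewrite /g psumr_eq0 => [/allP/(_ r)|? _]; last exact: soft_weight_ge0.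
    by rewrite mem_index_enum => /(_ isT)/eqP.
  by rewrite /m /soft_mean big1 ?expr0n -?g0 ?mul0r// => r _; rewrite wr0 mul0r.
have := key (m / g).
have -> : 2 * (m / g) * m = 2 * (m ^+ 2 / g) by ring.
have -> : (m / g) ^+ 2 * g = m ^+ 2 / g by field; rewrite gt_eqF.
move=> h; rewrite -ler_pdivrMl// mulrC; lra.
Qed.

(** A shift of the energies multiplies the partition function by
    1 + soft_mean (exp y - 1); all expansions are expansions of this ratio. *)
Let soft_den_shift z w y : 1 + soft_mean z w (fun s => expR (y s) - 1) =
  (expR z + \sum_s expR (w s + y s)) / (expR z + \sum_s expR (w s)).
Proof.
rewrite soft_meanB soft_mean_cst mulr1 addrCA soft_stepC addrC mulrDl; congr (_ + _).
by rewrite mulr_suml; apply: eq_bigr => s _; rewrite expRD /soft_weight mulrAC.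
Qed.

Lemma soft_weight_shift z w y r : soft_weight z (fun s => w s + y s) r =
  soft_weight z w r * expR (y r) / (1 + soft_mean z w (fun s => expR (y s) - 1)).
Proof.
have D0 := soft_den_gt0 z w; have D0' := soft_den_gt0 z (fun s => w s + y s).
rewrite soft_den_shift /soft_weight expRD; field.
by rewrite !gt_eqF.
Qed.

Lemma soft_step_shift z w y : 1 - soft_step z (fun s => w s + y s) =
  (1 - soft_step z w) / (1 + soft_mean z w (fun s => expR (y s) - 1)).
Proof.
have D0 := soft_den_gt0 z w; have D0' := soft_den_gt0 z (fun s => w s + y s).
rewrite soft_den_shift !soft_stepC; field.
by rewrite !gt_eqF.
Qed.

(** Keeps the denominator of the expansions away from 0. *)
Lemma soft_ratio_ge z w y eta : eta <= 1 -> (forall r, `|y r| <= eta) ->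
  1 / 4 <= 1 + soft_mean z w (fun s => expR (y s) - 1).
Proof.
move=> eta1 yeta.
have : soft_mean z w (fun=> - (3 / 4)) <= soft_mean z w (fun s => expR (y s) - 1).
  apply: soft_mean_le => r; have : expR (- y r) <= 4.
    by rewrite expR_le4// normrN (le_trans (yeta r)).
  have : expR (y r) * expR (- y r) = 1 by rewrite expRN mulfV// gt_eqF ?expR_gt0.
  have := expR_gt0 (y r); nra.
rewrite soft_mean_cst; have := soft_step_ge0 z w; have := soft_step_le1 z w; lra.
Qed.

(** Derivatives of the soft step are polynomials in Gibbs means, so they are
    bounded by powers of sup |y| whatever the number of indices; the logarithm
    of the grid size therefore never enters the comparison errors.  For eta > 1
    the bound is trivial. *)
Lemma soft_step_taylor3 z w y eta : 0 <= eta -> (forall r, `|y r| <= eta) ->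
  `|soft_step z (fun s => w s + y s) - soft_step z w - (1 - soft_step z w) *
     (soft_mean z w y + soft_mean z w (fun r => y r ^+ 2) / 2 - soft_mean z w y ^+ 2)|
  <= 280 * eta ^+ 3.
Proof.
move=> eta0 yeta.
have y2eta r : `|y r ^+ 2| <= eta ^+ 2.
  by rewrite normrX ler_sqr ?nnegrE// ?yeta.
have m1b : `|soft_mean z w y| <= eta by exact: soft_mean_norm.
have m2b : `|soft_mean z w (fun r => y r ^+ 2)| <= eta ^+ 2.
  by apply: soft_mean_norm => //; exact: sqr_ge0.
have e2 : 0 <= eta ^+ 2 by exact: sqr_ge0.
have g0 := soft_step_ge0 z w; have g1 := soft_step_le1 z w.
have [eta1|eta1] := leP eta 1; last first.
  have h0 := soft_step_ge0 z (fun s => w s + y s).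
  have h1 := soft_step_le1 z (fun s => w s + y s).
  move: m1b m2b g0 g1 h0 h1.
  move: (soft_mean z w y) (soft_mean z w (fun r => y r ^+ 2)) (soft_step z w)
    (soft_step z (fun s => w s + y s)).
  move=> m1 m2 g h m1b m2b g0 g1 h0 h1.
  have m1s : m1 ^+ 2 <= eta ^+ 2.
    by rewrite -real_normK ?num_real// lerXn2r ?nnegrE.
  have ms0 : 0 <= m1 ^+ 2 by exact: sqr_ge0.
  have q : `|m1 + m2 / 2 - m1 ^+ 2| <= 3 * eta ^+ 2.
    move: m1b m2b; rewrite !ler_norml => /andP[? ?] /andP[? ?].
    have : eta <= eta ^+ 2 by rewrite expr2 ler_peMl// ltW.
    by move=> ?; apply/andP; split; lra.
  have q' : `|(1 - g) * (m1 + m2 / 2 - m1 ^+ 2)| <= 3 * eta ^+ 2.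
    rewrite normrM; apply: le_trans q; rewrite ler_piMl// ger0_norm ?subr_ge0//.
    by rewrite lerBlDr lerDl.
  have e3 : eta ^+ 2 <= eta ^+ 3 by rewrite [leRHS]exprSr ler_peMr// ltW.
  have e4 : 1 <= eta ^+ 2 by rewrite exprn_ege1// ltW.
  move: q'; rewrite !ler_norml => /andP[? ?]; apply/andP; split; lra.
have -> : soft_step z (fun s => w s + y s) =
    1 - (1 - soft_step z w) / (1 + soft_mean z w (fun s => expR (y s) - 1)).
  by rewrite -soft_step_shift subKr.
have d := soft_ratio_ge z w eta1 yeta.
have u1 : `|soft_mean z w (fun s => expR (y s) - 1)| <= 4 * eta.
  by apply: soft_mean_norm => [r|]; [exact: expR_taylor1|rewrite mulr_ge0].
have u2 : `|soft_mean z w (fun s => expR (y s) - 1) - soft_mean z w y| <= 4 * eta ^+ 2.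
  rewrite -soft_meanB.
  by apply: soft_mean_norm => [r|]; [exact: expR_taylor2|rewrite mulr_ge0].
have u3 : `|soft_mean z w (fun s => expR (y s) - 1) - soft_mean z w y
     - soft_mean z w (fun r => y r ^+ 2) / 2| <= 4 * eta ^+ 3.
  rewrite (mulrC _ 2^-1) -soft_meanZ -!soft_meanB.
  apply: soft_mean_norm => [r|]; last by rewrite mulr_ge0// exprn_ge0.
  by rewrite (mulrC 2^-1); exact: expR_taylor3.
move: d u1 u2 u3 m1b m2b g0 g1.
move: (soft_mean z w y) (soft_mean z w (fun r => y r ^+ 2))
  (soft_mean z w (fun s => expR (y s) - 1)) (soft_step z w).
move=> m1 m2 u g d u1 u2 u3 m1b m2b g0 g1.
have d0 : 0 < 1 + u by lra.
have -> : 1 - (1 - g) / (1 + u) - g - (1 - g) * (m1 + m2 / 2 - m1 ^+ 2) =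
  (1 - g) * ((u - m1 - m2 / 2) - (u - m1) * (u + m1) + u ^+ 3 / (1 + u)).
  by field; rewrite gt_eqF.
rewrite normrM -[leRHS]mul1r ler_pM//.
  by rewrite ger0_norm ?subr_ge0// lerBlDr lerDl.
have t3 : `|u ^+ 3 / (1 + u)| <= 256 * eta ^+ 3.
  have -> : `|u ^+ 3 / (1 + u)| = `|u| ^+ 3 / (1 + u).
    by rewrite normrM normrX; congr (_ * _); rewrite ger0_norm// invr_ge0 ltW.
  rewrite ler_pdivrMr//.
  have : `|u| ^+ 3 <= (4 * eta) ^+ 3 by rewrite lerXn2r ?nnegrE// mulr_ge0.
  have e3 : 0 <= eta ^+ 3 by exact: exprn_ge0.
  have : 256 * eta ^+ 3 * (1 / 4) <= 256 * eta ^+ 3 * (1 + u).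
    by apply: ler_wpM2l; [exact: mulr_ge0 (ler0n _ _) e3|exact: d].
  have -> : (4 * eta) ^+ 3 = 64 * eta ^+ 3 by ring.
  lra.
have t2 : `|(u - m1) * (u + m1)| <= 20 * eta ^+ 3.
  have -> : 20 * eta ^+ 3 = 4 * eta ^+ 2 * (5 * eta) by ring.
  rewrite normrM ler_pM//; apply: le_trans (ler_normD _ _) _; lra.
rewrite -addrA; apply: le_trans (ler_normD _ _) _.
have := ler_normD (- ((u - m1) * (u + m1))) (u ^+ 3 / (1 + u)).
rewrite normrN; lra.
Qed.

Lemma soft_step_taylor2 z w y eta : 0 <= eta -> (forall r, `|y r| <= eta) ->
  `|soft_step z (fun s => w s + y s) - soft_step z w
     - (1 - soft_step z w) * soft_mean z w y| <= 282 * eta ^+ 2.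
Proof.
move=> eta0 yeta; have := soft_step_taylor3 z w eta0 yeta.
have y2eta r : `|y r ^+ 2| <= eta ^+ 2.
  by rewrite normrX ler_sqr ?nnegrE// ?yeta.
have m1b : `|soft_mean z w y| <= eta by exact: soft_mean_norm.
have m2b : `|soft_mean z w (fun r => y r ^+ 2)| <= eta ^+ 2.
  by apply: soft_mean_norm => //; exact: sqr_ge0.
have e2 : 0 <= eta ^+ 2 by exact: sqr_ge0.
have g0 := soft_step_ge0 z w; have g1 := soft_step_le1 z w.
have h0 := soft_step_ge0 z (fun s => w s + y s).
have h1 := soft_step_le1 z (fun s => w s + y s).
move: m1b m2b g0 g1 h0 h1.
move: (soft_mean z w y) (soft_mean z w (fun r => y r ^+ 2)) (soft_step z w)
    (soft_step z (fun s => w s + y s)).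
move=> m1 m2 g h m1b m2b g0 g1 h0 h1 H.
have [eta1|eta1] := leP eta 1; last first.
  have q : `|(1 - g) * m1| <= eta.
    rewrite normrM; apply: le_trans m1b; rewrite ler_piMl// ger0_norm ?subr_ge0//.
    by rewrite lerBlDr lerDl.
  have : eta <= eta ^+ 2 by rewrite expr2 ler_peMl// ltW.
  move: q; rewrite !ler_norml => /andP[? ?] ?; apply/andP; split; lra.
have m1s : m1 ^+ 2 <= eta ^+ 2.
  by rewrite -real_normK ?num_real// lerXn2r ?nnegrE.
have ms0 : 0 <= m1 ^+ 2 by exact: sqr_ge0.
have q : `|(1 - g) * (m2 / 2 - m1 ^+ 2)| <= 2 * eta ^+ 2.
  rewrite normrM; have q : `|m2 / 2 - m1 ^+ 2| <= 2 * eta ^+ 2.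
    by move: m2b; rewrite !ler_norml => /andP[? ?]; apply/andP; split; lra.
  apply: le_trans q; rewrite ler_piMl// ger0_norm ?subr_ge0//.
  by rewrite lerBlDr lerDl.
have e3 : eta ^+ 3 <= eta ^+ 2 by rewrite exprSr ler_piMr.
have -> : h - g - (1 - g) * m1 =
  (h - g - (1 - g) * (m1 + m2 / 2 - m1 ^+ 2)) + (1 - g) * (m2 / 2 - m1 ^+ 2) by ring.
apply: le_trans (ler_normD _ _) _; lra.
Qed.

Lemma soft_step_lipschitz z w y eta : 0 <= eta -> (forall r, `|y r| <= eta) ->
  `|soft_step z (fun s => w s + y s) - soft_step z w| <= 283 * eta.
Proof.
move=> eta0 yeta; have := soft_step_taylor2 z w eta0 yeta.
have m1b : `|soft_mean z w y| <= eta by exact: soft_mean_norm.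
have g0 := soft_step_ge0 z w; have g1 := soft_step_le1 z w.
have h0 := soft_step_ge0 z (fun s => w s + y s).
have h1 := soft_step_le1 z (fun s => w s + y s).
move: m1b g0 g1 h0 h1.
move: (soft_mean z w y) (soft_step z w) (soft_step z (fun s => w s + y s)) => m1 g h m1b g0 g1 h0 h1 H.
have [eta1|eta1] := leP eta 1; last by rewrite ler_norml; apply/andP; split; lra.
have q : `|(1 - g) * m1| <= eta.
  rewrite normrM; apply: le_trans m1b; rewrite ler_piMl// ger0_norm ?subr_ge0//.
  by rewrite lerBlDr lerDl.
have : eta ^+ 2 <= eta by rewrite expr2 ler_piMl.
rewrite -[h - g](subrK ((1 - g) * m1)) => ?.
apply: le_trans (ler_normD _ _) _; lra.
Qed.

(** First order expansion of a Gibbs mean: its derivative is a covariance. *)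
Lemma soft_mean_taylor2 z w x y b eta : 0 <= eta -> (forall r, `|y r| <= eta) ->
  0 <= b -> (forall r, `|x r| <= b) ->
  `|soft_mean z (fun s => w s + y s) x - soft_mean z w x -
    (soft_mean z w (fun r => x r * y r) - soft_mean z w x * soft_mean z w y)|
  <= 153 * (b * eta ^+ 2).
Proof.
move=> eta0 yeta b0 xb.
have be0 : 0 <= b * eta by exact: mulr_ge0.
have m1b : `|soft_mean z w y| <= eta by exact: soft_mean_norm.
have mxb : `|soft_mean z w x| <= b by exact: soft_mean_norm.
have mxyb : `|soft_mean z w (fun r => x r * y r)| <= b * eta.
  by apply: soft_mean_norm => // r; rewrite normrM ler_pM.
have [eta1|eta1] := leP eta 1; last first.
  have mxb' : `|soft_mean z (fun s => w s + y s) x| <= b by exact: soft_mean_norm.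
  have q : `|soft_mean z w x * soft_mean z w y| <= b * eta by rewrite normrM ler_pM.
  have e1 : b <= b * eta by rewrite ler_peMr// ltW.
  have e2 : b * eta <= b * eta ^+ 2 by rewrite expr2 mulrA ler_peMr// ltW.
  move: mxb mxyb mxb' q; rewrite !ler_norml.
  by move=> /andP[? ?] /andP[? ?] /andP[? ?] /andP[? ?]; apply/andP; split; lra.
have -> : soft_mean z (fun s => w s + y s) x = soft_mean z w (fun r => expR (y r) * x r) /
    (1 + soft_mean z w (fun s => expR (y s) - 1)).
  rewrite /soft_mean mulr_suml; apply: eq_bigr => r _.
  by rewrite soft_weight_shift mulrAC !mulrA.
have d := soft_ratio_ge z w eta1 yeta.
have u1 : `|soft_mean z w (fun s => expR (y s) - 1)| <= 4 * eta.
  by apply: soft_mean_norm => [r|]; [exact: expR_taylor1|rewrite mulr_ge0].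
have u2 : `|soft_mean z w (fun s => expR (y s) - 1) - soft_mean z w y| <= 4 * eta ^+ 2.
  rewrite -soft_meanB.
  by apply: soft_mean_norm => [r|]; [exact: expR_taylor2|rewrite mulr_ge0 ?sqr_ge0].
have v2 : `|soft_mean z w (fun r => expR (y r) * x r) - soft_mean z w x -
    soft_mean z w (fun r => x r * y r)| <= 4 * (b * eta ^+ 2).
  rewrite -!soft_meanB; apply: soft_mean_norm => [r|]; last by rewrite !mulr_ge0 ?sqr_ge0.
  have -> : expR (y r) * x r - x r - x r * y r = x r * (expR (y r) - 1 - y r) by ring.
  by rewrite normrM mulrCA ler_pM// expR_taylor2.
move: d u1 u2 v2 m1b mxb mxyb.
move: (soft_mean z w y) (soft_mean z w x) (soft_mean z w (fun r => x r * y r)).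
move: (soft_mean z w (fun r => expR (y r) * x r))
  (soft_mean z w (fun s => expR (y s) - 1)) => v u m1 mx mxy d u1 u2 v2 m1b mxb mxyb.
have d0 : 0 < 1 + u by lra.
have e2 : 0 <= eta ^+ 2 by exact: sqr_ge0.
have di : `|(1 + u)^-1| <= 4.
  rewrite ger0_norm ?invr_ge0; last exact: ltW.
  by rewrite -[leLHS]mul1r ler_pdivrMr//; lra.
pose rho := m1 - u + u ^+ 2 / (1 + u).
have rhob : `|rho| <= 68 * eta ^+ 2.
  have : `|u ^+ 2 / (1 + u)| <= 64 * eta ^+ 2.
    have -> : 64 * eta ^+ 2 = (4 * eta) ^+ 2 * 4 by ring.
    by rewrite normrM normrX ler_pM ?exprn_ge0// lerXn2r ?nnegrE ?mulr_ge0.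
  have := ler_normD (m1 - u) (u ^+ 2 / (1 + u)); rewrite distrC /rho; lra.
have -> : v / (1 + u) - mx - (mxy - mx * m1) =
    mx * rho + mxy * (rho - m1) + (v - mx - mxy) * (1 + u)^-1.
  by rewrite /rho; field; rewrite gt_eqF.
have s1 : `|mx * rho| <= 68 * (b * eta ^+ 2).
  by rewrite normrM mulrCA ler_pM.
have s2 : `|mxy * (rho - m1)| <= 69 * (b * eta ^+ 2).
  have : `|rho - m1| <= 69 * eta.
    have := ler_normB rho m1; have : eta ^+ 2 <= eta by rewrite expr2 ler_piMl.
    lra.
  have -> : 69 * (b * eta ^+ 2) = b * eta * (69 * eta) by ring.
  by rewrite normrM => ?; rewrite ler_pM.
have s3 : `|(v - mx - mxy) * (1 + u)^-1| <= 16 * (b * eta ^+ 2).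
  have -> : 16 * (b * eta ^+ 2) = 4 * (b * eta ^+ 2) * 4 by ring.
  by rewrite normrM ler_pM.
have := ler_normD (mx * rho + mxy * (rho - m1)) ((v - mx - mxy) * (1 + u)^-1).
have := ler_normD (mx * rho) (mxy * (rho - m1)); lra.
Qed.
End smooth_step.

(** * Independence and expectations *)
Section independence.
Context d (Omega : measurableType d) (R : realType) (Pr : probability Omega R).
Local Open Scope ereal_scope.

Lemma sub_g_sigma_measurable (C : set (set Omega)) (A : set Omega) :
  C `<=` measurable -> <<s C >> A -> measurable A.
Proof. by move=> Cm; apply: smallest_sub => //; exact: sigma_algebra_measurable. Qed.

Lemma id_g_sigma_measurable (C : set (set Omega)) : C `<=` measurable ->
  measurable_fun setT (idfun : Omega -> g_sigma_algebraType C).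
Proof.
by move=> Cm _ A CA; rewrite setTI; exact: sub_g_sigma_measurable CA.
Qed.

(** Two finite measures that agree on a pi-system agree on the sigma-algebra it
    generates; here they are the restriction of Pr to B and the multiple
    Pr B * Pr. *)
Lemma independent_g_sigma (C : set (set Omega)) (B : set Omega) :
  C `<=` measurable -> setI_closed C -> C setT -> measurable B ->
  (forall A, C A -> Pr (A `&` B) = Pr A * Pr B) ->
  forall A, <<s C >> A -> Pr (A `&` B) = Pr A * Pr B.
Proof.
move=> Cm CI CT mB CB A CA.
have mid := id_g_sigma_measurable Cm.
have PB0 : (0 <= fine (Pr B))%R by rewrite fine_ge0.
have PBE : (fine (Pr B))%:E = Pr B by rewrite fineK// fin_num_measure.
pose idC : {mfun Omega >-> g_sigma_algebraType C} :=
  HB.pack (idfun : Omega -> g_sigma_algebraType C)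
    (isMeasurableFun.Build _ _ _ _ (idfun : Omega -> g_sigma_algebraType C) mid).
pose m0 : {measure set (g_sigma_algebraType C) -> \bar R} :=
  pushforward (mrestr Pr mB) idC.
pose m1 := m0 mid.
pose m2 : {measure set (g_sigma_algebraType C) -> \bar R} :=
  mscale (NngNum PB0) (distribution Pr idC).
have : m1 A = m2 A.
  apply: (@measure_unique _ R (g_sigma_algebraType C) C (fun=> setT)) => //.
  - by rewrite bigcup_const.
  - move=> S CS; rewrite /m1 /m0 /m2 /= /mscale /= /pushforward/= /mrestr PBE muleC.
    exact: CB.
  - move=> _; rewrite /m1 /m0 /= /pushforward/= /mrestr.
    rewrite preimage_setT setTI; apply: le_lt_trans (ltry 1).
    exact: probability_le1.
by rewrite /m1 /m0 /m2 /= /mscale /= /pushforward/= /mrestr PBE muleC.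
Qed.

(** The joint law of independent variables is a product, so an expectation can be
    computed with an independent copy of the second variable, by Tonelli.  The
    copy lives on the same probability space, which avoids product spaces. *)
Lemma decoupling d1 d2 (T1 : measurableType d1) (T2 : measurableType d2)
    (X1 : {mfun Omega >-> T1}) (X2 : {mfun Omega >-> T2}) (f : (T1 * T2)%type -> \bar R) :
  (forall A B, measurable A -> measurable B ->
    Pr (X1 @^-1` A `&` X2 @^-1` B) = Pr (X1 @^-1` A) * Pr (X2 @^-1` B)) ->
  measurable_fun [set: (T1 * T2)%type] f -> (forall z, 0 <= f z) ->
  \int[Pr]_w f (X1 w, X2 w) = \int[Pr]_w \int[Pr]_w' f (X1 w, X2 w').
Proof.
move=> ind mf f0.
have mX : measurable_fun setT (fun w => (X1 w, X2 w)).
  by apply/measurable_fun_pair.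
pose X : {mfun Omega >-> (T1 * T2)%type} :=
  HB.pack (fun w => (X1 w, X2 w))
    (isMeasurableFun.Build _ _ _ _ (fun w => (X1 w, X2 w)) mX).
transitivity (\int[distribution Pr X]_z f z).
  by rewrite ge0_integral_distribution.
transitivity (\int[distribution Pr X1 \x distribution Pr X2]_z f z).
  apply: eq_measure_integral => A mA _; apply/esym.
  apply: (product_measure_unique (m1 := distribution Pr X1)
    (m2 := distribution Pr X2) (m' := distribution Pr X)) => //.
rewrite fubini_tonelli1// ge0_integral_distribution//; last first.
- by move=> x; exact: integral_ge0.
- exact: measurable_fun_fubini_tonelli_F.
apply: eq_integral => w _ /=; rewrite /fubini_F ge0_integral_distribution//.
by apply: measurableT_comp => //; exact: measurable_fun_pair2.
Qed.
End independence.

Section bounded_expectation.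
Context d (Omega : measurableType d) (R : realType) (Pr : probability Omega R).
Implicit Types (f g : Omega -> R) (M : R).

Lemma bounded_integrable f M : measurable_fun setT f -> (forall w, `|f w| <= M) ->
  Pr.-integrable setT (EFin \o f).
Proof.
move=> mf fM; apply: measurable_bounded_integrable => //.
  by rewrite (le_lt_trans (probability_le1 _ _)) ?ltry.
exists M; split; first exact: num_real.
by move=> x Mx y _; exact: le_trans (fM y) (ltW Mx).
Qed.

Lemma integrable_constant M : Pr.-integrable setT (EFin \o (fun _ : Omega => M)).
Proof. by apply: (@bounded_integrable _ `|M|) => //; exact: measurable_cst. Qed.

Lemma Rintegral_probability_cst M : \int[Pr]_w M = M.
Proof. by rewrite Rintegral_cst//= probability_setT mulr1. Qed.

(** Transfers statements on nonnegative extended-real integrals to bounded real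
    integrands: adding the bound M makes the integrand nonnegative. *)
Lemma integral_bounded_shift f M : measurable_fun setT f -> (forall w, `|f w| <= M) ->
  (\int[Pr]_w (f w + M)%:E = (\int[Pr]_w f w + M)%:E)%E.
Proof.
move=> mf fM.
have fi := bounded_integrable mf fM.
have ci : Pr.-integrable setT (EFin \o (fun=> M)).
  exact: integrable_constant.
have fMi := integrableD measurableT fi ci.
rewrite -[LHS]fineK; last exact: integrable_fin_num fMi.
by congr EFin; rewrite -[in RHS](Rintegral_probability_cst M) -RintegralD.
Qed.

Lemma Rintegral_bounded_le f g M N : measurable_fun setT f -> (forall w, `|f w| <= M) ->
  measurable_fun setT g -> (forall w, `|g w| <= N) ->
  (forall w, f w <= g w) -> \int[Pr]_w f w <= \int[Pr]_w g w.
Proof.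
move=> mf fM mg gN fg; apply: le_Rintegral => //.
  exact: bounded_integrable mf fM.
exact: bounded_integrable mg gN.
Qed.

Lemma Rintegral_le_cst f M m : measurable_fun setT f -> (forall w, `|f w| <= M) ->
  (forall w, f w <= m) -> \int[Pr]_w f w <= m.
Proof.
move=> mf fM fm; rewrite -[leRHS]Rintegral_probability_cst.
by apply: (Rintegral_bounded_le mf fM) => //; exact: measurable_cst.
Qed.

Lemma Rintegral_ge_cst f M m : measurable_fun setT f -> (forall w, `|f w| <= M) ->
  (forall w, m <= f w) -> m <= \int[Pr]_w f w.
Proof.
move=> mf fM fm; rewrite -[leLHS]Rintegral_probability_cst.
by apply: (Rintegral_bounded_le _ _ mf fM) => //; exact: measurable_cst.
Qed.

Lemma Rintegral_norm_le f m : measurable_fun setT f ->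
  (forall w, `|f w| <= m) -> `|\int[Pr]_w f w| <= m.
Proof.
move=> mf fm; rewrite ler_norml; apply/andP; split.
  by apply: (Rintegral_ge_cst mf fm) => w; have := fm w; rewrite ler_norml => /andP[].
by apply: (Rintegral_le_cst mf fm) => w; have := fm w; rewrite ler_norml => /andP[].
Qed.

Lemma Rintegral_sub_cst f m : Pr.-integrable setT (EFin \o f) ->
  \int[Pr]_w f w - m = \int[Pr]_w (f w - m).
Proof.
move=> fi; rewrite RintegralB//; last first.
  exact: integrable_constant.
by rewrite Rintegral_probability_cst.
Qed.

Lemma measurable_Rintegral_param d1 (T : measurableType d1) (f : (T * Omega)%type -> R) M :
  measurable_fun setT f -> (forall z, `|f z| <= M) ->
  measurable_fun setT (fun t => \int[Pr]_w f (t, w)).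
Proof.
move=> mf fM.
have mft t : measurable_fun setT (fun w => f (t, w)).
  by apply: measurableT_comp => //; exact: measurable_fun_pair2.
have -> : (fun t => \int[Pr]_w f (t, w)) =
    (fun t => \int[Pr]_w f (t, w) + M - M) by apply/funext => t; rewrite addrK.
apply: measurable_funB; last exact: measurable_cst.
apply/measurable_EFinP.
rewrite [X in measurable_fun _ X](_ : _ =
    fubini_F Pr (fun z => (f z + M)%:E)).
  apply: measurable_fun_fubini_tonelli_F.
    by apply/measurable_EFinP/measurable_funD => //; exact: measurable_cst.
  by move=> z; rewrite lee_fin -lerBlDr sub0r; have := fM z; rewrite ler_norml => /andP[].
apply/funext => t; rewrite /fubini_F integral_bounded_shift//.
Qed.

Lemma bounded_decoupling d1 d2 (T1 : measurableType d1) (T2 : measurableType d2)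
    (X1 : {mfun Omega >-> T1}) (X2 : {mfun Omega >-> T2}) (f : (T1 * T2)%type -> R) M :
  (forall A B, measurable A -> measurable B ->
    Pr (X1 @^-1` A `&` X2 @^-1` B) = Pr (X1 @^-1` A) * Pr (X2 @^-1` B))%E ->
  measurable_fun setT f -> (forall z, `|f z| <= M) ->
  \int[Pr]_w f (X1 w, X2 w) = \int[Pr]_w \int[Pr]_w' f (X1 w, X2 w').
Proof.
move=> ind mf fM.
have mf2 t : measurable_fun setT (fun w => f (t, X2 w)).
  apply: (measurableT_comp (f := fun x => f (t, x))) => //.
  by apply: measurableT_comp => //; exact: measurable_fun_pair2.
have mf12 : measurable_fun setT (fun w => f (X1 w, X2 w)).
  by apply: measurableT_comp => //; exact: measurable_fun_pair.
have mff : measurable_fun setT (fun w => \int[Pr]_w' f (X1 w, X2 w')).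
  apply: (measurableT_comp (f := fun t => \int[Pr]_w' f (t, X2 w'))) => //.
  apply: (@measurable_Rintegral_param _ _ (fun z => f (z.1, X2 z.2)) M) => //.
  apply: measurableT_comp => //; apply: measurable_fun_pair => //.
  by apply: measurableT_comp.
have f0 z : (0 <= (f z + M)%:E)%E.
  by rewrite lee_fin -lerBlDr sub0r; have := fM z; rewrite ler_norml => /andP[].
have mfM : measurable_fun setT (fun z => (f z + M)%:E).
  by apply/measurable_EFinP/measurable_funD => //; exact: measurable_cst.
have := decoupling ind mfM f0.
rewrite (@integral_bounded_shift (fun w => f (X1 w, X2 w)) M)//.
under [in RHS]eq_integral do rewrite (@integral_bounded_shift (fun w' => f (X1 _, X2 w')) M)//.
rewrite (@integral_bounded_shift (fun w => \int[Pr]_w' f (X1 w, X2 w')) M)//.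
  by move=> [] /addIr.
by move=> w; exact: Rintegral_norm_le.
Qed.
End bounded_expectation.

(** * Resampling one coordinate of an independent family *)
Section path_space.
Context dE (E : measurableType dE) (I : choiceType).

Definition coordinate_sets : set (set (I -> E)) :=
  \bigcup_i preimage_set_system setT (fun y => y i) measurable.

(** Families indexed by I with the product sigma-algebra; a functional of the
    whole sample is a measurable function on this space. *)
Definition path := g_sigma_algebraType coordinate_sets.

Definition update (k : I) (y : path) (e : E) : path :=
  fun i => if i == k then e else y i.

Lemma update_eq k y e : update k y e k = e.
Proof. by rewrite /update eqxx. Qed.

Lemma update_neq k y e i : i != k -> update k y e i = y i.
Proof. by rewrite /update => /negbTE->. Qed.

Lemma measurable_coordinate i : measurable_fun setT (fun y : path => y i).
Proof.
move=> _ A mA; apply: sub_sigma_algebra; exists i => //.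
by exists A.
Qed.

Lemma measurable_path d (T : measurableType d) (f : T -> path) :
  (forall i, measurable_fun setT (fun t => f t i)) -> measurable_fun setT f.
Proof.
move=> mf; apply: (@measurability _ _ _ (g_sigma_algebraType coordinate_sets) _ _ coordinate_sets) => //.
move=> _ [_ [i _ [A mA <-] <-]].
by have := mf i measurableT A mA; rewrite !setTI.
Qed.

Lemma measurable_update d (T : measurableType d) k (f : T -> path) (g : T -> E) :
  measurable_fun setT f -> measurable_fun setT g ->
  measurable_fun setT (fun t => update k (f t) (g t)).
Proof.
move=> mf mg; apply: measurable_path => i; rewrite /update; case: eqP => [_|_]; first exact: mg.
exact: (measurableT_comp (measurable_coordinate i) mf).
Qed.
End path_space.

Section resampling.
Context d (Omega : measurableType d) (R : realType) (Pr : probability Omega R).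
Context dE (E : measurableType dE) (I : choiceType) (Y : I -> {mfun Omega >-> E}).

Definition mutually_independent : Prop :=
  forall (J : {fset I}) (A : I -> set E),
    (forall i, i \in J -> measurable (A i)) ->
    (Pr (\bigcap_(i in [set` J]) (Y i @^-1` A i)) =
     \prod_(i <- J) Pr (Y i @^-1` A i))%E.

Definition sample_path (w : Omega) : path E I := fun i => Y i w.

Lemma measurable_sample_path : measurable_fun setT sample_path.
Proof. by apply: measurable_path => i; rewrite /sample_path. Qed.

(** Finite-dimensional cylinders that leave the coordinate k free: a pi-system
    generating the events that depend on the other coordinates. *)
Let cyl (k : I) : set (set Omega) :=
  [set S | exists (J : {fset I}) (A : I -> set E), [/\ k \notin J,
    forall i, measurable (A i), forall i, i \notin J -> A i = setT &
    S = \bigcap_(i in [set` J]) (Y i @^-1` A i)]].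

Let cylT (J : {fset I}) (A : I -> set E) : (forall i, i \notin J -> A i = setT) ->
  \bigcap_(i in [set` J]) (Y i @^-1` A i) = \bigcap_i (Y i @^-1` A i).
Proof.
move=> AT; apply/seteqP; split => w h i _; last exact: h.
by have [iJ|iJ] := boolP (i \in J); [exact: h|rewrite AT].
Qed.

Let cyl_measurable k : cyl k `<=` measurable.
Proof.
move=> _ [J [A [kJ mA AT ->]]]; apply: fin_bigcap_measurable => // i _.
by rewrite -[X in measurable X]setTI; exact: measurable_funP.
Qed.

Let cyl_setI k : setI_closed (cyl k).
Proof.
move=> _ _ [J [A [kJ mA AT ->]]] [J' [A' [kJ' mA' AT' ->]]].
exists (J `|` J')%fset, (fun i => A i `&` A' i); split.
- by rewrite in_fsetU negb_or kJ.
- by move=> i; exact: measurableI.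
- by move=> i; rewrite in_fsetU negb_or => /andP[? ?]; rewrite AT// AT'// setTI.
- rewrite !cylT//; last first.
    by move=> i; rewrite in_fsetU negb_or => /andP[? ?]; rewrite AT// AT'// setTI.
  by rewrite -bigcapI.
Qed.

Let cyl_setT k : cyl k setT.
Proof.
exists fset0, (fun=> setT); split => //.
by apply/seteqP; split => // w _ i /=; rewrite in_fset0.
Qed.

Let cyl_coordinate k i B : i != k -> measurable B -> cyl k (Y i @^-1` B).
Proof.
move=> ik mB; exists [fset i]%fset, (fun j => if j == i then B else setT); split.
- by rewrite inE eq_sym.
- by move=> j; case: ifP.
- by move=> j; rewrite inE => /negbTE->.
- apply/seteqP; split=> [w h j /=|w /(_ i)/=].
    by rewrite inE => /eqP ->; rewrite eqxx.
  by rewrite inE eqxx => /(_ erefl).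
Qed.

Hypothesis indep : mutually_independent.

Let cyl_indep k B S : measurable B -> <<s cyl k >> S ->
  (Pr (S `&` Y k @^-1` B) = Pr S * Pr (Y k @^-1` B))%E.
Proof.
move=> mB; apply: independent_g_sigma => //.
  by rewrite -[X in measurable X]setTI; exact: measurable_funP.
move=> _ [J [A [kJ mA AT ->]]].
have := @indep (k |` J)%fset (fun i => if i == k then B else A i).
have JE : forall F : I -> \bar R, (\prod_(i <- (k |` J)%fset) F i = F k * \prod_(i <- J) F i)%E.
  by move=> F; rewrite big_fsetU1.
rewrite JE eqxx => H.
have E1 : \bigcap_(i in [set` (k |` J)%fset]) (Y i @^-1` (if i == k then B else A i)) =
    \bigcap_(i in [set` J]) (Y i @^-1` A i) `&` Y k @^-1` B.
  apply/seteqP; split=> [w h|w [h hk] i /=].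
    split=> [i /= iJ|].
      have := h i; rewrite /= in_fset1U iJ orbT => /(_ erefl).
      by case: eqP kJ iJ => // ->; case: (k \in J).
    by have := h k; rewrite /= in_fset1U eqxx => /(_ erefl).
  by rewrite in_fset1U; case: eqP => [-> _|_ /= iJ] //=; exact: h.
rewrite -E1 H => [|i _]; last by case: ifP.
rewrite muleC; congr (_ * _)%E; rewrite indep//.
by apply: eq_big_seq => i iJ; case: eqP kJ iJ => // ->; case: (k \in J).
Qed.

(** The k-th variable is independent of the sigma-algebra generated by the other
    coordinates, so replacing it by an independent copy keeps the expectation. *)
Lemma ge0_resample k (h : path E I -> \bar R) :
  measurable_fun setT h -> (forall y, 0 <= h y)%E ->
  (\int[Pr]_w h (sample_path w) =
   \int[Pr]_w \int[Pr]_w' h (update k (sample_path w) (Y k w')))%E.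
Proof.
move=> mh h0.
have mid := @id_g_sigma_measurable _ Omega (cyl k) (@cyl_measurable k).
pose X1 : {mfun Omega >-> g_sigma_algebraType (cyl k)} :=
  HB.pack (idfun : Omega -> g_sigma_algebraType (cyl k))
    (isMeasurableFun.Build _ _ _ _ (idfun : Omega -> g_sigma_algebraType (cyl k)) mid).
pose f (z : (g_sigma_algebraType (cyl k) * E)%type) :=
  h (update k (sample_path z.1) z.2).
have mf : measurable_fun setT f.
  apply: (measurableT_comp mh).
  apply: measurable_path => i; rewrite /update; case: eqP => [_|/eqP ik].
    exact: measurable_snd.
  rewrite /sample_path.
  have mY : measurable_fun setT (Y i : g_sigma_algebraType (cyl k) -> E).
    move=> _ B mB; apply: sub_sigma_algebra; rewrite setTI.
    exact: cyl_coordinate.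
  exact: (measurableT_comp mY measurable_fst).
rewrite -(@decoupling _ _ _ Pr _ _ _ _ X1 (Y k) f)//.
- apply: eq_integral => w _; rewrite /f /=; congr h.
  by apply/funext => i; rewrite /update; case: eqP => // ->.
- by move=> A B mA mB; exact: cyl_indep.
- by move=> z; exact: h0.
Qed.
End resampling.

Section bounded_resampling.
Context d (Omega : measurableType d) (R : realType) (Pr : probability Omega R).
Context dE (E : measurableType dE) (I : choiceType) (Y : I -> {mfun Omega >-> E}).
Hypothesis indep : mutually_independent Pr Y.
Implicit Types (h : path E I -> R) (M m c : R) (k : I) (y : path E I).

Lemma measurable_update_sample k y :
  measurable_fun setT (fun w => update k y (Y k w)).
Proof. by apply: measurable_update. Qed.

Lemma measurable_resampled h M k : measurable_fun setT h -> (forall y, `|h y| <= M) ->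
  measurable_fun setT (fun y => \int[Pr]_w h (update k y (Y k w))).
Proof.
move=> mh hM.
apply: (@measurable_Rintegral_param _ _ _ Pr _ _ (fun z => h (update k z.1 (Y k z.2))) M) => //.
apply: (measurableT_comp mh); apply: measurable_update => //.
exact: measurableT_comp.
Qed.

Lemma resample h M k : measurable_fun setT h -> (forall y, `|h y| <= M) ->
  \int[Pr]_w h (sample_path Y w) =
  \int[Pr]_w \int[Pr]_w' h (update k (sample_path Y w) (Y k w')).
Proof.
move=> mh hM.
have ms := measurable_sample_path Y.
have mhs : measurable_fun setT (fun w => h (sample_path Y w)).
  exact: (measurableT_comp mh ms).
have mhu y : measurable_fun setT (fun w => h (update k y (Y k w))).
  exact: (measurableT_comp mh (measurable_update_sample k y)).
have mhh : measurable_fun setT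
    (fun w => \int[Pr]_w' h (update k (sample_path Y w) (Y k w'))).
  exact: (measurableT_comp (measurable_resampled k mh hM) ms).
have mhM : measurable_fun setT (fun y => (h y + M)%:E).
  by apply/measurable_EFinP/measurable_funD => //; exact: measurable_cst.
have h0 y : (0 <= (h y + M)%:E)%E.
  by rewrite lee_fin -lerBlDr sub0r; have := hM y; rewrite ler_norml => /andP[].
have := ge0_resample indep k mhM h0.
rewrite (@integral_bounded_shift _ _ _ _ (fun w => h (sample_path Y w)) M)//.
under [in RHS]eq_integral do
  rewrite (@integral_bounded_shift _ _ _ _ (fun w' => h (update k _ (Y k w'))) M)//.
rewrite (@integral_bounded_shift _ _ _ _
  (fun w => \int[Pr]_w' h (update k (sample_path Y w) (Y k w'))) M)//.
  by move=> [] /addIr.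
by move=> w; exact: Rintegral_norm_le.
Qed.

(** Bounding an expectation reduces to bounding, for every fixed value of the
    other coordinates, the expectation over coordinate k alone. *)
Lemma resample_le h M k m : measurable_fun setT h -> (forall y, `|h y| <= M) ->
  (forall y, \int[Pr]_w h (update k y (Y k w)) <= m) ->
  \int[Pr]_w h (sample_path Y w) <= m.
Proof.
move=> mh hM hm; rewrite (resample k mh hM).
have ms := measurable_sample_path Y.
have mhu y : measurable_fun setT (fun w => h (update k y (Y k w))).
  exact: (measurableT_comp mh (measurable_update_sample k y)).
apply: (@Rintegral_le_cst _ _ _ _ _ M) => [|w|w//].
  exact: (measurableT_comp (measurable_resampled k mh hM) ms).
exact: Rintegral_norm_le.
Qed.

Lemma resample_norm h M k m : measurable_fun setT h -> (forall y, `|h y| <= M) ->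
  (forall y, `|\int[Pr]_w h (update k y (Y k w))| <= m) ->
  `|\int[Pr]_w h (sample_path Y w)| <= m.
Proof.
move=> mh hM hm; rewrite (resample k mh hM); apply: Rintegral_norm_le => //.
exact: (measurableT_comp (measurable_resampled k mh hM) (measurable_sample_path Y)).
Qed.

(** Variance bound in the manner of Efron and Stein: integrating out the
    coordinates one at a time, each step loses at most the squared oscillation
    of the functional in that coordinate.  Only finitely many coordinates ks may
    matter, which is the induction variable. *)
Lemma bounded_difference_variance (ks : seq I) h M c :
  measurable_fun setT h -> (forall y, `|h y| <= M) ->
  (forall y y', (forall i, i \in ks -> y i = y' i) -> h y = h y') ->
  (forall k y y', k \in ks -> (forall i, i != k -> y i = y' i) -> `|h y - h y'| <= c) ->
  \int[Pr]_w (h (sample_path Y w) ^+ 2) <=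
  (\int[Pr]_w h (sample_path Y w)) ^+ 2 + (size ks)%:R * c ^+ 2.
Proof.
have ms := measurable_sample_path Y.
elim: ks h => [|k ks IH] h mh hM hdep hdiff.
  have hE y : h y = h point by exact: hdep.
  under eq_Rintegral do rewrite hE.
  under [in leRHS]eq_Rintegral do rewrite hE.
  by rewrite !Rintegral_probability_cst mul0r addr0.
pose h' y := \int[Pr]_w h (update k y (Y k w)).
have mhu y : measurable_fun setT (fun w => h (update k y (Y k w))).
  exact: (measurableT_comp mh (measurable_update_sample k y)).
have hi y : Pr.-integrable setT (EFin \o (fun w => h (update k y (Y k w)))).
  by apply: (@bounded_integrable _ _ _ _ _ M).
have mh' : measurable_fun setT h' by exact: measurable_resampled.
have h'M y : `|h' y| <= M by exact: Rintegral_norm_le.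
have hM2 y : `|h y ^+ 2| <= M ^+ 2.
  by rewrite normrX lerXn2r// nnegrE//; exact: le_trans (hM y).
have h'M2 y : `|h' y ^+ 2| <= M ^+ 2.
  by rewrite normrX lerXn2r// nnegrE//; exact: le_trans (h'M y).
have mh2 : measurable_fun setT (fun y => h y ^+ 2) by exact: measurable_funX.
have mh'2 : measurable_fun setT (fun y => h' y ^+ 2) by exact: measurable_funX.
have Eh' : \int[Pr]_w h (sample_path Y w) = \int[Pr]_w h' (sample_path Y w).
  exact: resample mh hM.
have diffE y y' : (forall w, `|h (update k y (Y k w)) - h (update k y' (Y k w))| <= c) ->
    `|h' y - h' y'| <= c.
  move=> H; rewrite /h' -RintegralB//; apply: Rintegral_norm_le => //.
  exact: measurable_funB.
apply: (@le_trans _ _ (\int[Pr]_w (h' (sample_path Y w) ^+ 2) + c ^+ 2)); last first.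
  rewrite Eh' -natr1 mulrDl mul1r addrA lerD2r; apply: IH => //.
  - move=> y y' yy'; apply: eq_Rintegral => w _; apply: hdep => i.
    by rewrite inE /update; case: eqP => //= _ /yy'.
  - move=> j y y' jks yy'; apply: diffE => w; apply: (hdiff j).
      by rewrite inE jks orbT.
    by move=> i ij; rewrite /update; case: eqP => // _; exact: yy'.
rewrite (resample k mh2 hM2) -[X in _ + X](Rintegral_probability_cst Pr) -RintegralD//; last first.
- exact: integrable_constant.
- apply: (@bounded_integrable _ _ _ _ _ (M ^+ 2)) => [|w]; last exact: h'M2.
  exact: (measurableT_comp mh'2 ms).
apply: (@Rintegral_bounded_le _ _ _ _ _ _ (M ^+ 2) (M ^+ 2 + c ^+ 2)).
- exact: (measurableT_comp (measurable_resampled k mh2 hM2) ms).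
- move=> w; apply: Rintegral_norm_le => //.
  exact: (measurableT_comp mh2 (measurable_update_sample k _)).
- by apply: measurable_funD; [exact: (measurableT_comp mh'2 ms)|exact: measurable_cst].
- move=> w; apply: le_trans (ler_normD _ _) _; rewrite lerD ?h'M2//.
  by rewrite ger0_norm ?sqr_ge0.
move=> w; set y := sample_path Y w.
(* the variance of one coordinate is at most the squared oscillation *)
have cen w' : `|h (update k y (Y k w')) - h' y| <= c.
  rewrite -[X in `|X - _|](Rintegral_probability_cst Pr) /h' -RintegralB//; last first.
    by apply: (@bounded_integrable _ _ _ _ _ M) => //; exact: measurable_cst.
  apply: Rintegral_norm_le => [|w''].
    by apply: measurable_funB => //; exact: measurable_cst.
  apply: (hdiff k); first by rewrite inE eqxx.
  by move=> i ik; rewrite !update_neq.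
have sqE : \int[Pr]_w' (h (update k y (Y k w')) ^+ 2) =
    \int[Pr]_w' ((h (update k y (Y k w')) - h' y) ^+ 2) + h' y ^+ 2.
  have -> : (fun w' => (h (update k y (Y k w')) - h' y) ^+ 2) =
     (fun w' => h (update k y (Y k w')) ^+ 2 - 2 * h' y * h (update k y (Y k w'))
        + h' y ^+ 2) by apply/funext => w'; ring.
  have i2 : Pr.-integrable setT (EFin \o (fun w' => h (update k y (Y k w')) ^+ 2)).
    by apply: (@bounded_integrable _ _ _ _ _ (M ^+ 2)) => //; exact: measurable_funX.
  have ic t : Pr.-integrable setT (EFin \o (fun w' : Omega => t)).
    exact: integrable_constant.
  have i1 : Pr.-integrable setT (EFin \o (fun w' => 2 * h' y * h (update k y (Y k w')))).
    apply: (@bounded_integrable _ _ _ _ _ (`|2 * h' y| * M)) => [|w'].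
      by apply: measurable_funM => //; exact: measurable_cst.
    by rewrite normrM ler_wpM2l.
  have i21 : Pr.-integrable setT (EFin \o (fun w' => h (update k y (Y k w')) ^+ 2 -
      2 * h' y * h (update k y (Y k w')))).
    exact: (integrableB measurableT i2 i1).
  rewrite RintegralD// RintegralB// RintegralZl// Rintegral_probability_cst -/(h' y).
  ring.
rewrite sqE addrC lerD2l.
apply: (@Rintegral_le_cst _ _ _ _ _ (c ^+ 2)) => [|w'|w'].
- apply: measurable_funX; apply: measurable_funB => //; exact: measurable_cst.
- rewrite normrX lerXn2r// nnegrE//; exact: le_trans (cen w').
- by rewrite -[leLHS]real_normK ?num_real// lerXn2r// nnegrE//; exact: le_trans (cen w').
Qed.
End bounded_resampling.

(** * Orthogonal sums *)
Section orthogonality.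
Context d (Omega : measurableType d) (R : realType) (Pr : probability Omega R).
Context dE (E : measurableType dE) (I : choiceType) (Y : I -> {mfun Omega >-> E}).
Hypothesis indep : mutually_independent Pr Y.

(** Martingale-type orthogonality: the i-th term is centred as a function of the
    coordinate k i, on which the previous terms do not depend, so cross products
    vanish.  The terms may depend on other coordinates as well, which covers
    both sums of centred landscapes and multiplier sums. *)
Lemma orthogonal_sum n (f : nat -> path E I -> R) (k : nat -> I) (B : nat -> R) :
  (forall i, (i < n)%N -> measurable_fun setT (f i)) ->
  (forall i j y e, (j < i < n)%N -> f j (update (k i) y e) = f j y) ->
  (forall i y, (i < n)%N -> let g w := f i (update (k i) y (Y (k i) w)) in
    [/\ Pr.-integrable setT (EFin \o g), Pr.-integrable setT (EFin \o (fun w => g w ^+ 2)),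
        \int[Pr]_w g w = 0 & \int[Pr]_w (g w ^+ 2) <= B i ^+ 2]) ->
  (\int[Pr]_w ((\sum_(i < n) f i (sample_path Y w)) ^+ 2)%:E <=
   (\sum_(i < n) B i ^+ 2)%:E)%E.
Proof.
elim: n => [|n IH] mf fdep fk.
  under eq_integral do rewrite big_ord0 expr0n.
  by rewrite integral0 big_ord0.
pose s y := \sum_(i < n) f i y.
have ms : measurable_fun setT s.
  by apply: measurable_sum => i; apply: mf; rewrite ltnS ltnW.
have mh : measurable_fun setT (fun y => ((s y + f n y) ^+ 2)%:E).
  by apply/measurable_EFinP/measurable_funX/measurable_funD => //; exact: mf.
have mse : measurable_fun setT (fun w => s (sample_path Y w)).
  exact: (measurableT_comp ms (measurable_sample_path Y)).
rewrite big_ord_recr/= EFinD.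
under eq_integral do rewrite big_ord_recr/= -/(s _).
rewrite (@ge0_resample _ _ _ _ _ _ _ _ indep (k n) (fun y => ((s y + f n y) ^+ 2)%:E)) //; last first.
  by move=> y; rewrite lee_fin sqr_ge0.
apply: (@le_trans _ _ (\int[Pr]_w ((s (sample_path Y w)) ^+ 2 + B n ^+ 2)%:E)%E).
  apply: ge0_le_integral => //.
  - by move=> w _; apply: integral_ge0 => w' _; rewrite lee_fin sqr_ge0.
  - apply: (measurableT_comp (f := fun y => (\int[Pr]_w'
        ((s (update (k n) y (Y (k n) w')) + f n (update (k n) y (Y (k n) w'))) ^+ 2)%:E)%E)).
      apply: (@measurable_fun_fubini_tonelli_F _ _ _ _ _ Pr (fun z =>
        ((s (update (k n) z.1 (Y (k n) z.2)) + f n (update (k n) z.1 (Y (k n) z.2))) ^+ 2)%:E)).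
        apply: (measurableT_comp mh); apply: measurable_update => //.
        exact: measurableT_comp.
      by move=> z; rewrite lee_fin sqr_ge0.
    exact: measurable_sample_path.
  - apply/measurable_EFinP/measurable_funD; last exact: measurable_cst.
    exact: measurable_funX.
  move=> w _; set y := sample_path Y w.
  have sE e : s (update (k n) y e) = s y.
    by apply: eq_bigr => i _; rewrite fdep// ltn_ord ltnSn.
  under eq_integral do rewrite sE.
  have [i1 i2 e1 e2] := fk n y (ltnSn n).
  have ic : Pr.-integrable setT (EFin \o (fun _ : Omega => s y ^+ 2)).
    exact: integrable_constant.
  pose g w := f n (update (k n) y (Y (k n) w)).
  have i1' : Pr.-integrable setT (EFin \o (fun w => 2 * s y * g w)).
    exact: (integrableZl _ _ i1).
  have i12 : Pr.-integrable setT (EFin \o (fun w => 2 * s y * g w + g w ^+ 2)).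
    exact: (integrableD _ i1' i2).
  pose G w := s y ^+ 2 + (2 * s y * g w + g w ^+ 2).
  have i3 : Pr.-integrable setT (EFin \o G) by exact: (integrableD _ ic i12).
  have -> : (fun w' => ((s y + f n (update (k n) y (Y (k n) w'))) ^+ 2)%:E) = EFin \o G.
    by apply/funext => w'; rewrite /G /g /=; congr EFin; ring.
  rewrite -[leLHS]fineK; last exact: integrable_fin_num i3.
  have -> : fine (\int[Pr]_x (EFin \o G) x)%E = \int[Pr]_x G x by [].
  rewrite lee_fin /G.
  rewrite RintegralD// RintegralD// RintegralZl// e1 mulr0 add0r.
  by rewrite Rintegral_probability_cst lerD2l.
under eq_integral do rewrite EFinD.
have mse2 : measurable_fun setT (fun w => (s (sample_path Y w) ^+ 2)%:E).
  exact/measurable_EFinP/measurable_funX.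
rewrite ge0_integralD//.
rewrite integral_cst//= probability_setT mule1 leeD2r//.
apply: IH => [i ni|i j y e /andP[ji ni]|i y ni].
- by apply: mf; rewrite ltnS ltnW.
- by apply: fdep; rewrite ji ltnS ltnW.
- by apply: fk; rewrite ltnS ltnW.
all: by move=> w _; rewrite lee_fin sqr_ge0.
Qed.
End orthogonality.

(** * Moments of the standard normal law *)
Section normal_moments.
Context {R : realType}.
Notation mu := (@lebesgue_measure R).
Notation gamma := (normal_prob (0 : R) 1).
Notation pdf := (normal_pdf (0 : R) 1).
Implicit Types (f : R -> \bar R) (x : R).

(** The normal law has the normal density: its Radon-Nikodym derivative agrees
    with the density almost everywhere, as both have the same integrals. *)
Lemma ge0_integral_normal f : measurable_fun setT f -> (forall x, 0 <= f x)%E ->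
  (\int[gamma]_x f x = \int[mu]_x (f x * (pdf x)%:E))%E.
Proof.
move=> mf f0.
have dom : gamma `<< mu := normal_prob_dominates 0 1.
have mpdf : measurable_fun setT (fun x => (pdf x)%:E).
  by apply/measurable_EFinP; exact: measurable_normal_pdf.
have RNi := Radon_Nikodym_SigmaFinite.f_integrable dom.
rewrite -(Radon_Nikodym_SigmaFinite.change_of_variables dom)//.
apply: ge0_ae_eq_integral => //.
- by apply: emeasurable_funM => //; exact: measurable_int RNi.
- exact: emeasurable_funM.
- by move=> x _; rewrite mule_ge0// Radon_Nikodym_SigmaFinite.f_ge0.
- by move=> x _; rewrite mule_ge0// lee_fin normal_pdf_ge0.
have [N [mN N0 sN]] : ae_eq mu setT (Radon_Nikodym_SigmaFinite.f gamma mu)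
    (fun x => (pdf x)%:E).
  apply: integral_ae_eq => // E _ mE.
  by rewrite -Radon_Nikodym_SigmaFinite.f_integral.
exists N; split => // x /= h; apply: sN => /= h'; apply: h => _.
by rewrite h'.
Qed.

Lemma ge0_integral_lebesgue_opp f : measurable_fun setT f -> (forall x, 0 <= f x)%E ->
  (\int[mu]_x f (- x)%R = \int[mu]_x f x)%E.
Proof.
move=> mf f0.
transitivity (\int[pushforward mu (-%R : R -> measurableTypeR R)]_x f x)%E.
  by rewrite ge0_integral_pushforward//= preimage_setT.
by apply: eq_measure_integral => //= A mA _; exact: lebesgue_measureN.
Qed.

Lemma normal_pdfN x : pdf (- x) = pdf x.
Proof. by rewrite !normal_pdfE ?oner_eq0// /normal_fun !subr0 sqrrN. Qed.

Lemma ge0_integral_normal_opp f : measurable_fun setT f -> (forall x, 0 <= f x)%E ->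
  (\int[gamma]_x f (- x)%R = \int[gamma]_x f x)%E.
Proof.
move=> mf f0.
have mfN : measurable_fun setT (fun x => f (- x)).
  exact: measurableT_comp.
have mpdf : measurable_fun setT (fun x => (pdf x)%:E).
  by apply/measurable_EFinP; exact: measurable_normal_pdf.
rewrite !ge0_integral_normal//.
rewrite -(ge0_integral_lebesgue_opp (f := fun x => (f x * (pdf x)%:E)%E)).
- by apply: eq_integral => x _; rewrite normal_pdfN.
- exact: emeasurable_funM.
- by move=> x; rewrite mule_ge0// lee_fin normal_pdf_ge0.
Qed.

(** |x|^3 times the density is dominated by a multiple of the density of the
    normal law with standard deviation 2, whose integral is 1. *)
Lemma normal_third_moment : (\int[gamma]_x (`|x| ^+ 3)%:E < +oo)%E.
Proof.
rewrite ge0_integral_normal; last 2 first.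
- by apply/measurable_EFinP/measurable_funX; exact: normr_measurable.
- by move=> x; rewrite lee_fin exprn_ge0.
pose C : R := 15 * normal_peak 1 / normal_peak 2.
have p1 : 0 < normal_peak (1 : R) by exact: normal_peak_gt0.
have p2 : 0 < normal_peak (2 : R) by exact: normal_peak_gt0.
have C0 : 0 <= C by rewrite /C divr_ge0 ?mulr_ge0// ltW.
apply: (@le_lt_trans _ _ (\int[mu]_x (C%:E * (normal_pdf 0 2 x)%:E))%E).
  apply: ge0_le_integral => //.
  - by move=> x _; rewrite mule_ge0// lee_fin ?exprn_ge0 ?normal_pdf_ge0.
  - apply: emeasurable_funM; apply/measurable_EFinP.
      by apply: measurable_funX; exact: normr_measurable.
    exact: measurable_normal_pdf.
  - by apply: measurable_funeM; apply/measurable_EFinP; exact: measurable_normal_pdf.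
  move=> x _; rewrite -!EFinM lee_fin !normal_pdfE ?oner_eq0// ?pnatr_eq0// /normal_fun !subr0.
  have CE t : C * (normal_peak 2 * t) = normal_peak 1 * (15 * t).
    by rewrite /C; field; rewrite gt_eqF.
  rewrite CE mulrCA ler_pM2l//.
  set u : R := 3 * x ^+ 2 / 8.
  have -> : - x ^+ 2 / (2 ^+ 2 *+ 2) = - x ^+ 2 / (1 ^+ 2 *+ 2) + u by rewrite /u; field.
  rewrite expRD mulrCA [leLHS]mulrC ler_pM2l ?expR_gt0//.
  have u0 : 0 <= u by have := sqr_ge0 x; rewrite /u; lra.
  (* |x|^3 <= 15 exp(3 x^2 / 8), from the quadratic Taylor lower bound of exp *)
  have := @expR_ge1Dxn _ u 1 u0; set e := expR u.
  have -> : u = 3 * `|x| ^+ 2 / 8 by rewrite real_normK ?num_real.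
  have -> : (2`!)%:R = 2 :> R by [].
  set a := `|x| => h.
  have h1 : 0 <= a ^+ 2 * (a - 1) ^+ 2 by rewrite mulr_ge0 ?sqr_ge0.
  have h2 : 0 <= (a ^+ 2 - 1) ^+ 2 by exact: sqr_ge0.
  nra.
rewrite ge0_integralZl//.
- by rewrite integral_normal_pdf mule1 ltry.
- by apply/measurable_EFinP; exact: measurable_normal_pdf.
- by move=> x _; rewrite lee_fin normal_pdf_ge0.
Qed.
End normal_moments.

Section normal_variance.
Context {R : realType}.
Notation mu := (@lebesgue_measure R).
Notation gamma := (normal_prob (0 : R) 1).
Notation pdf := (normal_pdf (0 : R) 1).
Implicit Types (f : R -> \bar R) (x : R).

Let G x := expR (- (2^-1 *: (x ^+ 2))).

Let GE x : normal_fun 0 1 x = G x.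
Proof. by rewrite /normal_fun /G subr0 /GRing.scale/=; congr expR; field. Qed.

Let continuous_derive (f : R -> R) : (forall x, derivable f x 1) -> continuous f.
Proof. by move=> df x; apply/differentiable_continuous/derivable1_diffP. Qed.

Let integral_of_derivative (f F : R -> R) l : (forall x, 0 <= x -> 0 <= f x) ->
  (forall x, is_derive x 1 F (f x)) -> continuous f -> F x @[x --> +oo] --> l ->
  (\int[mu]_(x in `[0%R, +oo[) (f x)%:E = (l - F 0)%:E)%E.
Proof.
move=> f0 dF cf Fl.
have dF' x : derivable F x 1 by have [] := dF x.
have cF := continuous_derive dF'.
rewrite (@ge0_continuous_FTC2y _ f F 0 l)//.
- exact: continuous_subspaceT.
- by apply: cvg_at_right_filter; exact: cF.
- by move=> x _; rewrite derive1E; have [] := dF x.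
Qed.

(** Makes (x^2 - 1) G(x) + 4 exp(-x) nonnegative on the half line, as required to
    integrate a derivative by monotone convergence. *)
Let density_lower_bound x : 0 <= x -> 1 <= 4 * expR (- x) + x ^+ 2 * G x + (1 - G x).
Proof.
move=> x0; have G0 : 0 < G x by exact: expR_gt0.
have G1 : G x <= 1.
  by rewrite expR_le1 oppr_le0 /GRing.scale/= mulr_ge0 ?invr_ge0 ?sqr_ge0.
have e0 := expR_gt0 (- x).
have [x1|x1] := leP x 1.
  have E : expR x * expR (- x) = 1 by rewrite expRN mulfV// gt_eqF ?expR_gt0.
  have : expR x <= 4 by rewrite expR_le4// ger0_norm.
  have : 0 <= x ^+ 2 * G x by rewrite mulr_ge0 ?sqr_ge0 ?ltW.
  nra.
have : 1 * G x <= x ^+ 2 * G x by rewrite ler_pM2r// exprn_ege1// ltW.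
lra.
Qed.

Let cvg_xG : x * G x @[x --> +oo] --> (0 : R).
Proof.
apply: (@squeeze_cvgr _ _ _ _ (fun=> 0) (fun x => expR 2 * expR (- x))).
- near=> x; apply/andP; split.
    by rewrite mulr_ge0 ?expR_ge0//; near: x; exact: nbhs_pinfty_ge.
  rewrite -expRD; apply: (@le_trans _ _ (expR x * G x)).
    by rewrite ler_pM2r ?expR_gt0// ltW// (lt_le_trans _ (expR_ge1Dx x))// ltrDr.
  rewrite /G -expRD ler_expR /GRing.scale/=.
  have := sqr_ge0 (x - 2); nra.
- exact: cvg_cst.
- rewrite -[X in _ --> X](mulr0 (expR 2)); apply: cvgM; first exact: cvg_cst.
  exact: cvgr_expR.
Unshelve. all: by end_near. Qed.

(** (x^2 - 1) G is the derivative of -x G, which vanishes at 0 and at infinity.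
    This integrand changes sign, so 4 exp(-x), whose integral is known, is added
    to it and subtracted afterwards. *)
Let half_moment : (\int[mu]_(x in `[0%R, +oo[) (x ^+ 2 * G x)%:E =
  \int[mu]_(x in `[0%R, +oo[) (G x)%:E)%E.
Proof.
have cG : continuous G.
  by apply: continuous_derive => x; apply: ex_derive.
have cE : continuous (fun x : R => 4 * expR (- x)).
  by apply: continuous_derive => x; apply: ex_derive.
have mG : measurable_fun setT G by exact: continuous_measurable_fun.
have mE : measurable_fun setT (fun x : R => 4 * expR (- x)) by exact: continuous_measurable_fun.
have cvg4 : 4 * expR (- x) @[x --> +oo] --> (0 : R).
  rewrite -[X in _ --> X](mulr0 4); apply: cvgM; first exact: cvg_cst.
  exact: cvgr_expR.
have I2 : (\int[mu]_(x in `[0%R, +oo[) (4 * expR (- x))%:E = (0 - - (4 * expR (- 0)))%:E)%E.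
  apply: (integral_of_derivative (F := fun x => - (4 * expR (- x)))).
  - by move=> x _; rewrite mulr_ge0 ?expR_ge0.
  - by move=> x; apply: is_derive_eq; rewrite /GRing.scale/=; ring.
  - exact: cE.
  - by rewrite -[X in _ --> X]oppr0; exact: cvgN cvg4.
have I1 : (\int[mu]_(x in `[0%R, +oo[) ((x ^+ 2 - 1) * G x + 4 * expR (- x))%:E =
    (0 - (- (0 * G 0) - (4 * expR (- 0))))%:E)%E.
  apply: (integral_of_derivative (F := fun x => - (x * G x) - (4 * expR (- x)))).
  - by move=> x x0; have := density_lower_bound x0; lra.
  - by move=> x; rewrite /G; apply: is_derive_eq; rewrite /GRing.scale/=; field.
  - move=> x; apply: cvgD; last exact: cE.
    apply: cvgM; last exact: cG.
    by apply: cvgB; [exact: exprn_continuous|exact: cvg_cst].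
  - rewrite -[X in _ --> X](subr0 0) -[X in X - _]oppr0.
    exact: cvgB (cvgN cvg_xG) cvg4.
have ge0 (h : R -> R) : (forall x, 0 <= x -> 0 <= h x) ->
    forall x, `[0%R, +oo[%classic x -> (0 <= (h x)%:E)%E.
  by move=> H x /=; rewrite in_itv/= andbT lee_fin; exact: H.
have ms (h : R -> R) : measurable_fun setT h ->
    measurable_fun (`[0%R, +oo[%classic : set R) (fun x => (h x)%:E).
  by move=> mh; apply/measurable_funTS/measurable_EFinP.
have mx2 : measurable_fun setT (fun x : R => x ^+ 2) by exact: measurable_funX.
have A1 : (\int[mu]_(x in `[0%R, +oo[) ((x ^+ 2 * G x)%:E + (4 * expR (- x))%:E) =
  \int[mu]_(x in `[0%R, +oo[) (((x ^+ 2 - 1) * G x + 4 * expR (- x))%:E + (G x)%:E))%E.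
  by apply: eq_integral => x _; rewrite -!EFinD; congr EFin; ring.
move: A1; rewrite !ge0_integralD//.
all: try by [apply: ge0 => x x0; rewrite ?mulr_ge0 ?sqr_ge0 ?expR_ge0].
all: try by [apply: ge0 => x x0; have := density_lower_bound x0; lra].
all: try by [apply: ms => //; apply: measurable_funM].
all: try by [apply: ms; apply: measurable_funD => //; apply: measurable_funM => //;
  apply: measurable_funB => //; exact: measurable_cst].
rewrite I1 I2 mul0r oppr0 !sub0r !opprK => /(congr1 (fun t => t - (4 * expR 0)%:E)%E).
by rewrite addeK// addeC addeK.
Qed.

Lemma normal_second_moment : (\int[gamma]_x (x ^+ 2)%:E = 1)%E.
Proof.
have p1 : 0 < normal_peak (1 : R) by exact: normal_peak_gt0.
have pdfE x : pdf x = normal_peak 1 * G x by rewrite normal_pdfE ?oner_eq0// GE.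
have cG : continuous G by apply: continuous_derive => x; apply: ex_derive.
have mG : measurable_fun setT G by exact: continuous_measurable_fun.
have mx2 : measurable_fun setT (fun x : R => x ^+ 2) by exact: measurable_funX.
have GN : G =1 G \o -%R by move=> x; rewrite /G/= sqrrN.
have G0 x : 0 <= G x by exact: expR_ge0.
rewrite ge0_integral_normal; last 2 first.
- exact/measurable_EFinP.
- by move=> x; rewrite lee_fin sqr_ge0.
have E2 : (\int[mu]_x (x ^+ 2 * G x)%:E = \int[mu]_x (G x)%:E)%E.
  rewrite !ge0_symfun_integralT//.
  - by congr (_ * _)%E; rewrite -!set_itvcy; exact: half_moment.
  - by move=> x; rewrite mulr_ge0 ?sqr_ge0.
  - by move=> x; apply: cvgM; [exact: exprn_continuous|exact: cG].
  - by move=> x /=; rewrite GN/= sqrrN.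
rewrite -(integral_normal_pdf 0 1).
under eq_integral do rewrite pdfE -EFinM mulrCA EFinM.
under [RHS]eq_integral do rewrite pdfE EFinM.
rewrite !ge0_integralZl//; first by rewrite E2.
- exact/measurable_EFinP.
- by move=> x _; rewrite lee_fin.
- by rewrite lee_fin ltW.
- by apply/measurable_EFinP/measurable_funM.
- by move=> x _; rewrite lee_fin mulr_ge0 ?sqr_ge0.
- by rewrite lee_fin ltW.
Qed.
End normal_variance.

Section standard_normal_variable.
Context d (Omega : measurableType d) (R : realType) (Pr : probability Omega R).
Variable X : {mfun Omega >-> measurableTypeR R}.
Hypothesis X_law : forall A, measurable A ->
  distribution Pr X A = normal_prob (0 : R) 1 A.

Let ge0_integral_law (f : R -> R) : measurable_fun setT f -> (forall x, 0 <= f x) ->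
  (\int[Pr]_w (f (X w))%:E = \int[normal_prob (0 : R) 1]_x (f x)%:E)%E.
Proof.
move=> mf f0.
rewrite -(@ge0_integral_distribution _ _ _ _ _ Pr X (fun x => (f x)%:E)).
- by apply: eq_measure_integral => A mA _; exact: X_law.
- exact/measurable_EFinP.
- by move=> x; rewrite lee_fin.
Qed.

Let mX : measurable_fun setT (X : Omega -> R). Proof. exact: (@measurable_funP _ _ _ _ _ X). Qed.

Lemma normal_integrable3 : Pr.-integrable setT (EFin \o (fun w => `|X w| ^+ 3)).
Proof.
apply/integrableP; split.
  by apply/measurable_EFinP/measurable_funX; exact: measurableT_comp.
under eq_integral => w _ do rewrite /= ger0_norm ?exprn_ge0//.
rewrite (ge0_integral_law (f := fun x => `|x| ^+ 3)).
- exact: normal_third_moment.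
- by apply: measurable_funX; exact: normr_measurable.
- by move=> x; rewrite exprn_ge0.
Qed.

Lemma normal_moment3 :
  \int[Pr]_w (`|X w| ^+ 3) = \int[normal_prob (0 : R) 1]_x (`|x| ^+ 3).
Proof.
rewrite /Rintegral (ge0_integral_law (f := fun x => `|x| ^+ 3))//.
by apply: measurable_funX; exact: normr_measurable.
Qed.

Let integrable_dom (f : R -> R) : measurable_fun setT f ->
  (forall x, `|f x| <= 1 + `|x| ^+ 3) -> Pr.-integrable setT (EFin \o (fun w => f (X w))).
Proof.
move=> mf fle.
have i1 : Pr.-integrable setT (EFin \o (fun _ : Omega => 1)).
  exact: integrable_constant.
apply: le_integrable (integrableD measurableT i1 normal_integrable3) => //.
  by apply/measurable_EFinP; exact: measurableT_comp.
move=> w _ /=; rewrite lee_fin; apply: le_trans (fle (X w)) _.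
by rewrite ler_norm.
Qed.

(** Both |x| and x^2 are dominated by 1 + |x|^3. *)
Let cube_dom (a : R) : 0 <= a -> a ^+ 2 + a <= 1 + a ^+ 3.
Proof.
move=> a0; rewrite -subr_ge0 (_ : _ - _ = (a - 1) ^+ 2 * (a + 1)); last by ring.
by rewrite mulr_ge0 ?sqr_ge0 ?addr_ge0.
Qed.

Lemma normal_integrable1 : Pr.-integrable setT (EFin \o X).
Proof.
apply: (integrable_dom (f := id)) => // x.
by have := cube_dom (normr_ge0 x); have := sqr_ge0 `|x|; lra.
Qed.

Lemma normal_integrable2 : Pr.-integrable setT (EFin \o (fun w => X w ^+ 2)).
Proof.
apply: (integrable_dom (f := fun x => x ^+ 2)) => // x.
rewrite normrX; have := cube_dom (normr_ge0 x); have := normr_ge0 x; lra.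
Qed.

(** X is the difference of its positive part and of the positive part of -X, which
    have the same law by symmetry. *)
Lemma normal_mean0 : \int[Pr]_w X w = 0.
Proof.
pose p (x : R) := Num.max x 0.
have mp : measurable_fun setT p by apply: measurable_maxr => //; exact: measurable_cst.
have p0 x : 0 <= p x by rewrite le_max lexx orbT.
have pb x : `|p x| <= 1 + `|x| ^+ 3.
  have : `|p x| <= `|x| by rewrite /p maxEle; case: ifP => // _; rewrite normr0.
  move=> /le_trans; apply.
  by have := cube_dom (normr_ge0 x); have := sqr_ge0 `|x|; lra.
have mpN : measurable_fun setT (fun x : R => p (- x)) by exact: measurableT_comp.
have -> : (fun w => X w) = (fun w => p (X w) - p (- X w)).
  apply/funext => w; rewrite /p; case: (leP (X w) 0) => h.
    by rewrite max_l ?oppr_ge0// sub0r opprK.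
  by rewrite max_r ?oppr_le0 ?ltW// subr0.
rewrite RintegralB//; last 2 first.
- exact: (integrable_dom (f := p)).
- by apply: (integrable_dom (f := fun x => p (- x))) => // x; rewrite -(normrN x).
rewrite /Rintegral (ge0_integral_law (f := p))// (ge0_integral_law (f := fun x => p (- x)))//.
rewrite (ge0_integral_normal_opp (f := fun x => (p x)%:E)) ?subrr//.
exact/measurable_EFinP.
Qed.

Lemma normal_variance1 : \int[Pr]_w (X w ^+ 2) = 1.
Proof.
rewrite /Rintegral (ge0_integral_law (f := fun x => x ^+ 2)).
- by rewrite normal_second_moment.
- exact: measurable_funX.
- by move=> x; exact: sqr_ge0.
Qed.
End standard_normal_variable.

(** * The soft step along independent multipliers *)
Section measurable_soft.
Context d (T : measurableType d) (R : realType) (J : finType).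
Implicit Types (F G : T -> J -> R) (zeta : R).

Lemma measurable_soft_weight zeta F r : (forall r, measurable_fun setT (F^~ r)) ->
  measurable_fun setT (fun t => soft_weight zeta (F t) r).
Proof.
move=> mF.
have -> : (fun t => soft_weight zeta (F t) r) =
    (fun t => expR (F t r - ln (expR zeta + \sum_s expR (F t s)))).
  apply/funext => t; rewrite expRB lnK// posrE; exact: soft_den_gt0.
apply: measurableT_comp; first exact: measurable_expR.
apply: measurable_funB; first exact: mF.
apply: measurableT_comp; first exact: measurable_ln.
apply: measurable_funD; first exact: measurable_cst.
apply: measurable_sum => s; apply: measurableT_comp; first exact: measurable_expR.
exact: mF.
Qed.

Lemma measurable_soft_step zeta F : (forall r, measurable_fun setT (F^~ r)) ->
  measurable_fun setT (fun t => soft_step zeta (F t)).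
Proof. by move=> mF; apply: measurable_sum => r; exact: measurable_soft_weight. Qed.

Lemma measurable_soft_mean zeta F G : (forall r, measurable_fun setT (F^~ r)) ->
  (forall r, measurable_fun setT (G^~ r)) ->
  measurable_fun setT (fun t => soft_mean zeta (F t) (G t)).
Proof.
move=> mF mG; apply: measurable_sum => r; apply: measurable_funM; last exact: mG.
exact: measurable_soft_weight.
Qed.
End measurable_soft.

Section soft_step_bounds.
Context (R : realType) (J : finType).
Lemma soft_step_norm (zeta : R) (w : J -> R) : `|soft_step zeta w| <= 1.
Proof. by rewrite ger0_norm ?soft_step_ge0// soft_step_le1. Qed.
End soft_step_bounds.

Section multipliers.
Context d (Omega : measurableType d) (R : realType) (Pr : probability Omega R).

Definition standard_multiplier (Z : Omega -> R) (K : R) : Prop :=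
  [/\ Pr.-integrable setT (EFin \o Z),
      Pr.-integrable setT (EFin \o (fun w => Z w ^+ 2)),
      Pr.-integrable setT (EFin \o (fun w => `|Z w| ^+ 3)),
      \int[Pr]_w Z w = 0 /\ \int[Pr]_w (Z w ^+ 2) = 1 &
      \int[Pr]_w (`|Z w| ^+ 3) <= K].

Context (J : finType).
Variables (Z : Omega -> R) (K : R).
Hypothesis Zstd : standard_multiplier Z K.

Lemma measurable_multiplier : measurable_fun setT Z.
Proof. by have [i1 _ _ _ _] := Zstd; exact/measurable_EFinP/(measurable_int Pr). Qed.

Let mstep zeta (u v : J -> R) :
  measurable_fun setT (fun w => soft_step zeta (fun r => u r + Z w * v r)).
Proof.
apply: (@measurable_soft_step _ _ _ _ zeta (fun w r => u r + Z w * v r)) => r.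
apply: measurable_funD; first exact: measurable_cst.
by apply: measurable_funM; [exact: measurable_multiplier|exact: measurable_cst].
Qed.

Let istep zeta (u v : J -> R) :
  Pr.-integrable setT (EFin \o (fun w => soft_step zeta (fun r => u r + Z w * v r))).
Proof. by apply: bounded_integrable (mstep _ _ _) _ => w; exact: soft_step_norm. Qed.

Let icst (m : R) : Pr.-integrable setT (EFin \o (fun _ : Omega => m)).
Proof. exact: integrable_constant. Qed.

(** The first order term integrates to 0. *)
Lemma multiplier_taylor2 zeta (u v : J -> R) eta : (forall r, `|v r| <= eta) -> 0 <= eta ->
  `|\int[Pr]_w soft_step zeta (fun r => u r + Z w * v r) - soft_step zeta u|
  <= 282 * eta ^+ 2.
Proof.
move=> veta eta0; have [i1 i2 i3 [e1 e2] e3] := Zstd.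
set g := soft_step zeta u; set m1 := (1 - g) * soft_mean zeta u v.
have iZ m : Pr.-integrable setT (EFin \o (fun w => m * Z w)).
  exact: (integrableZl measurableT _ i1).
have iZ2 m : Pr.-integrable setT (EFin \o (fun w => m * Z w ^+ 2)).
  exact: (integrableZl measurableT _ i2).
have il : Pr.-integrable setT (EFin \o (fun w => g + m1 * Z w)).
  exact: (integrableD measurableT (icst g) (iZ m1)).
have El : \int[Pr]_w (g + m1 * Z w) = g.
  by rewrite RintegralD// RintegralZl// e1 mulr0 addr0 Rintegral_probability_cst.
have id : Pr.-integrable setT (EFin \o (fun w =>
    soft_step zeta (fun r => u r + Z w * v r) - (g + m1 * Z w))).
  exact: (integrableB measurableT (istep zeta u v) il).
rewrite -[X in _ - X]El -RintegralB//.
apply: le_trans (le_normr_Rintegral _ id) _ => //.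
have <- : \int[Pr]_w (282 * eta ^+ 2 * Z w ^+ 2) = 282 * eta ^+ 2.
  by rewrite RintegralZl// e2 mulr1.
apply: le_Rintegral => //; first exact: integrable_norm.
move=> w _.
have -> : 282 * eta ^+ 2 * Z w ^+ 2 = 282 * (`|Z w| * eta) ^+ 2.
  by rewrite exprMn real_normK ?num_real//; ring.
have := @soft_step_taylor2 _ _ zeta u (fun r => Z w * v r) (`|Z w| * eta).
rewrite soft_meanZ -/g => H; apply: le_trans (H _ _).
- by rewrite le_eqVlt; apply/orP; left; apply/eqP; congr `|_|; rewrite /m1; ring.
- by rewrite mulr_ge0.
- by move=> r; rewrite normrM ler_wpM2l.
Qed.

(** The first order term integrates to 0 and the second order term keeps its
    value, since the multiplier has variance 1. *)
Lemma multiplier_taylor3 zeta (u v : J -> R) eta : (forall r, `|v r| <= eta) -> 0 <= eta ->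
  `|\int[Pr]_w soft_step zeta (fun r => u r + Z w * v r) - soft_step zeta u -
     (1 - soft_step zeta u) *
       (soft_mean zeta u (fun r => v r ^+ 2) / 2 - soft_mean zeta u v ^+ 2)|
  <= 280 * eta ^+ 3 * K.
Proof.
move=> veta eta0; have [i1 i2 i3 [e1 e2] e3] := Zstd.
set g := soft_step zeta u; set m1 := (1 - g) * soft_mean zeta u v.
set q := (1 - g) * _.
have iZ m : Pr.-integrable setT (EFin \o (fun w => m * Z w)).
  exact: (integrableZl measurableT _ i1).
have iZ2 m : Pr.-integrable setT (EFin \o (fun w => m * Z w ^+ 2)).
  exact: (integrableZl measurableT _ i2).
have iZ3 m : Pr.-integrable setT (EFin \o (fun w => m * `|Z w| ^+ 3)).
  exact: (integrableZl measurableT _ i3).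
have il : Pr.-integrable setT (EFin \o (fun w => g + m1 * Z w)).
  exact: (integrableD measurableT (icst g) (iZ m1)).
have ilq : Pr.-integrable setT (EFin \o (fun w => g + m1 * Z w + q * Z w ^+ 2)).
  exact: (integrableD measurableT il (iZ2 q)).
have El : \int[Pr]_w (g + m1 * Z w + q * Z w ^+ 2) = g + q.
  rewrite RintegralD// RintegralD// !RintegralZl// e1 e2 mulr0 addr0 mulr1.
  by rewrite Rintegral_probability_cst.
have id : Pr.-integrable setT (EFin \o (fun w =>
    soft_step zeta (fun r => u r + Z w * v r) - (g + m1 * Z w + q * Z w ^+ 2))).
  exact: (integrableB measurableT (istep zeta u v) ilq).
rewrite -addrA -opprD -El -RintegralB//.
apply: le_trans (le_normr_Rintegral _ id) _ => //.
apply: (@le_trans _ _ (\int[Pr]_w (280 * eta ^+ 3 * `|Z w| ^+ 3))); last first.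
  rewrite RintegralZl//; apply: ler_wpM2l e3.
  by apply: mulr_ge0; [exact: ler0n|exact: exprn_ge0].
apply: le_Rintegral => //; first exact: integrable_norm.
move=> w _.
have -> : 280 * eta ^+ 3 * `|Z w| ^+ 3 = 280 * (`|Z w| * eta) ^+ 3 by ring.
have := @soft_step_taylor3 _ _ zeta u (fun r => Z w * v r) (`|Z w| * eta).
have -> : soft_mean zeta u (fun r => (Z w * v r) ^+ 2) =
    Z w ^+ 2 * soft_mean zeta u (fun r => v r ^+ 2).
  by rewrite -soft_meanZ; apply: eq_bigr => r _; rewrite exprMn.
rewrite soft_meanZ -/g => H; apply: le_trans (H _ _).
- by rewrite le_eqVlt; apply/orP; left; apply/eqP; congr `|_|; rewrite /m1 /q; ring.
- by rewrite mulr_ge0.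
- by move=> r; rewrite normrM ler_wpM2l.
Qed.
End multipliers.

Section Rintegral_sum.
Context d (Omega : measurableType d) (R : realType) (Pr : probability Omega R).

Lemma integrable_sum_EFin (A : Type) (s : seq A) (f : A -> Omega -> R) :
  (forall a, Pr.-integrable setT (EFin \o f a)) ->
  Pr.-integrable setT (EFin \o (fun w => \sum_(a <- s) f a w)).
Proof.
move=> fi; elim: s => [|a s IH].
  rewrite (_ : (fun w => _) = fun=> 0); last by apply/funext => w; rewrite big_nil.
  by apply: (@bounded_integrable _ _ _ _ _ 0) => // w; rewrite normr0.
rewrite (_ : (fun w => _) = fun w => f a w + \sum_(a <- s) f a w).
  exact: (integrableD measurableT (fi a) IH).
by apply/funext => w; rewrite big_cons.
Qed.

Lemma Rintegral_sum (A : Type) (s : seq A) (f : A -> Omega -> R) :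
  (forall a, Pr.-integrable setT (EFin \o f a)) ->
  \int[Pr]_w (\sum_(a <- s) f a w) = \sum_(a <- s) \int[Pr]_w f a w.
Proof.
move=> fi; elim: s => [|a s IH].
  under eq_Rintegral do rewrite big_nil.
  by rewrite Rintegral_probability_cst big_nil.
under eq_Rintegral do rewrite big_cons.
rewrite RintegralD ?IH ?big_cons//; exact: integrable_sum_EFin.
Qed.

Lemma Rintegral_soft_mean (J : finType) zeta (u : J -> R) (f : Omega -> J -> R) :
  (forall r, Pr.-integrable setT (EFin \o f^~ r)) ->
  \int[Pr]_w soft_mean zeta u (f w) = soft_mean zeta u (fun r => \int[Pr]_w f w r).
Proof.
move=> fi; rewrite Rintegral_sum => [|r].
  by apply: eq_bigr => r _; rewrite RintegralZl.
exact: (integrableZl measurableT _ (fi r)).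
Qed.
End Rintegral_sum.

(** * Comparison, anticoncentration and concentration *)
Section multiplier_comparison.
Context d (Omega : measurableType d) (R : realType) (Pr : probability Omega R).
Context dE (E : measurableType dE) (J : finType).
Let I := (nat + nat)%type.
Variables (Y : I -> {mfun Omega >-> E}) (x : E -> J -> R) (z : E -> R) (eta K : R).
Hypothesis indep : mutually_independent Pr Y.
Hypothesis mx : forall r, measurable_fun setT (x^~ r).
Hypothesis mz : measurable_fun setT z.
Hypothesis eta0 : 0 <= eta.
Hypothesis xeta : forall e r, `|x e r| <= eta.
Hypothesis x_mean : forall i r, \int[Pr]_w x (Y (inl i) w) r = 0.
Hypothesis z_std : forall i, standard_multiplier Pr (fun w => z (Y (inr i) w)) K.
Implicit Types (y : path E I) (zeta : R) (n k : nat).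

(** The first k summands carry a multiplier and the others do not, so k = 0 is the
    plain sum and k = n the multiplier sum.  Coordinates inl i of the path hold
    the data, coordinates inr i the multipliers. *)
Definition hybrid k n y (r : J) : R :=
  \sum_(i < n) (if (i < k)%N then z (y (inr (i : nat))) else 1) * x (y (inl (i : nat))) r.

Let rest c k n y (r : J) : R :=
  \sum_(i < n | i != k :> nat)
    (if (i < c)%N then z (y (inr (i : nat))) else 1) * x (y (inl (i : nat))) r.

Lemma measurable_data i r : measurable_fun setT (fun y => x (y (inl i)) r).
Proof. exact: (measurableT_comp (mx r) (measurable_coordinate _)). Qed.

Lemma measurable_weight i : measurable_fun setT (fun y => z (y (inr i))).
Proof. exact: (measurableT_comp mz (measurable_coordinate _)). Qed.

Let measurable_hyb k n (P : pred 'I_n) r : measurable_fun setT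
  (fun y => \sum_(i < n | P i) (if (i < k)%N then z (y (inr (i : nat))) else 1) *
     x (y (inl (i : nat))) r).
Proof.
rewrite [X in measurable_fun _ X](_ : _ = (fun y => \sum_(i < n) if P i then
  (if (i < k)%N then z (y (inr (i : nat))) else 1) * x (y (inl (i : nat))) r else 0)).
  apply: measurable_sum => i; destruct (P i); last exact: measurable_cst.
  apply: measurable_funM; last exact: measurable_data.
  by destruct (i < k)%N; [exact: measurable_weight|exact: measurable_cst].
by apply/funext => y; rewrite big_mkcond.
Qed.

Lemma measurable_hybrid k n r : measurable_fun setT (fun y => hybrid k n y r).
Proof. exact: (@measurable_hyb k n predT r). Qed.

Let hybridS k n y r : (k < n)%N ->
  hybrid k.+1 n y r = rest k k n y r + z (y (inr k)) * x (y (inl k)) r.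
Proof.
move=> kn; rewrite /hybrid (bigD1 (Ordinal kn))//= ltnSn addrC; congr (_ + _).
apply: eq_big => [i|i ik]; first by [].
by rewrite ltnS leq_eqVlt (negbTE (ik : i != k :> nat)).
Qed.

Let hybridE c k n y r : (c <= k < n)%N ->
  hybrid c n y r = rest c k n y r + x (y (inl k)) r.
Proof.
move=> /andP[ck kn].
by rewrite /hybrid (bigD1 (Ordinal kn))//= ltnNge ck mul1r addrC; congr (_ + _).
Qed.

Let rest_inl c k n y e : rest c k n (update (inl k) y e) = rest c k n y.
Proof.
apply/funext => r; apply: eq_bigr => i ik; rewrite !update_neq//.
Qed.

Let rest_inr c k n y e : rest c k n (update (inr k) y e) = rest c k n y.
Proof.
apply/funext => r; apply: eq_bigr => i ik; rewrite !update_neq//.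
Qed.

Let icst (m : R) : Pr.-integrable setT (EFin \o (fun _ : Omega => m)).
Proof. exact: integrable_constant. Qed.

Let ix i r : Pr.-integrable setT (EFin \o (fun w => x (Y (inl i) w) r)).
Proof. by apply: (@bounded_integrable _ _ _ _ _ eta) => //; apply: (measurableT_comp (mx r)). Qed.

(** Conditionally on the other coordinates, the two hybrids differ from the
    common rest u by x_k and by xi_k x_k.  Their expansions have the same second
    order term, and the first order term of x_k has mean 0. *)
Lemma lindeberg_step zeta k n : (k < n)%N ->
  `|\int[Pr]_w soft_step zeta (hybrid k.+1 n (sample_path Y w)) -
    \int[Pr]_w soft_step zeta (hybrid k n (sample_path Y w))|
  <= 280 * eta ^+ 3 * (1 + K).
Proof.
move=> kn.
pose h y := soft_step zeta (hybrid k.+1 n y) - soft_step zeta (hybrid k n y).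
have mg k' : measurable_fun setT (fun y => soft_step zeta (hybrid k' n y)).
  by apply: measurable_soft_step => r; exact: measurable_hybrid.
have mgs k' : measurable_fun setT (fun w => soft_step zeta (hybrid k' n (sample_path Y w))).
  exact: (measurableT_comp (mg k') (measurable_sample_path Y)).
have mh : measurable_fun setT h by apply: measurable_funB; exact: mg.
have hb y : `|h y| <= 2.
  rewrite (le_trans (ler_normB _ _))//.
  by have := lerD (soft_step_norm zeta (hybrid k.+1 n y)) (soft_step_norm zeta (hybrid k n y)).
have ig k' : Pr.-integrable setT
    (EFin \o (fun w => soft_step zeta (hybrid k' n (sample_path Y w)))).
  by apply: bounded_integrable (mgs _) _ => w; exact: soft_step_norm.
rewrite -RintegralB// -/(h _) (resample indep (inr k) mh hb).
pose h1 y := \int[Pr]_w h (update (inr k) y (Y (inr k) w)).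
have mh1 : measurable_fun setT h1 by exact: (measurable_resampled Pr Y (inr k) mh hb).
have h1b y : `|h1 y| <= 2.
  apply: Rintegral_norm_le => //.
  exact: (measurableT_comp mh (measurable_update_sample Y _ _)).
apply: (resample_norm indep (k := inl k) mh1 h1b) => y.
set u := rest k k n y.
(* the first order term that survives integration over the multiplier *)
pose lin w := (1 - soft_step zeta u) * soft_mean zeta u (x (Y (inl k) w)).
have h1E e : h1 (update (inl k) y e) = \int[Pr]_w
    soft_step zeta (fun r => u r + z (Y (inr k) w) * x e r) -
    soft_step zeta (fun r => u r + x e r).
  have mstep : measurable_fun setT (fun w =>
      soft_step zeta (fun r => u r + z (Y (inr k) w) * x e r)).
    apply: (@measurable_soft_step _ _ _ _ zeta (fun w r => u r + z (Y (inr k) w) * x e r)) => r.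
    apply: measurable_funD; first exact: measurable_cst.
    by apply: measurable_funM; [apply: (measurableT_comp mz)|exact: measurable_cst].
  rewrite Rintegral_sub_cst; last first.
    by apply: bounded_integrable mstep _ => w; exact: soft_step_norm.
  apply: eq_Rintegral => w _; rewrite /h.
  have -> : hybrid k.+1 n (update (inr k) (update (inl k) y e) (Y (inr k) w)) =
      (fun r => u r + z (Y (inr k) w) * x e r).
    apply/funext => r; rewrite hybridS// rest_inr rest_inl update_eq.
    by rewrite update_neq// update_eq.
  have -> // : hybrid k n (update (inr k) (update (inl k) y e) (Y (inr k) w)) =
      (fun r => u r + x e r).
  apply/funext => r; rewrite (@hybridE k k) ?leqnn// rest_inr rest_inl.
  by rewrite update_neq// update_eq.
have close e : `|h1 (update (inl k) y e) +
    (1 - soft_step zeta u) * soft_mean zeta u (x e)| <= 280 * eta ^+ 3 * (1 + K).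
  rewrite h1E.
  have := multiplier_taylor3 (z_std k) zeta u (xeta e) eta0.
  have := soft_step_taylor3 zeta u eta0 (xeta e).
  set A := \int[Pr]_w _; set B := soft_step _ (fun s => u s + x e s).
  set g := soft_step zeta u; set m1 := soft_mean zeta u (x e).
  set m2 := soft_mean zeta u _ => hB hA.
  have -> : A - B + (1 - g) * m1 = (A - g - (1 - g) * (m2 / 2 - m1 ^+ 2)) -
    (B - g - (1 - g) * (m1 + m2 / 2 - m1 ^+ 2)) by ring.
  have -> : 280 * eta ^+ 3 * (1 + K) = 280 * eta ^+ 3 * K + 280 * eta ^+ 3 by ring.
  apply: le_trans (ler_normB _ _) _; exact: lerD.
have mlin : measurable_fun setT lin.
  apply: measurable_funM; first exact: measurable_cst.
  apply: (@measurable_soft_mean _ _ _ _ zeta (fun _ => u) (fun w => x (Y (inl k) w))) => r.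
    exact: measurable_cst.
  by apply: (measurableT_comp (mx r)).
have linb w : `|lin w| <= eta.
  rewrite normrM -[leRHS]mul1r ler_pM//.
    by rewrite ger0_norm ?subr_ge0 ?soft_step_le1// lerBlDr lerDl soft_step_ge0.
  by apply: soft_mean_norm => // r; exact: xeta.
have lin0 : \int[Pr]_w lin w = 0.
  rewrite RintegralZl//; last first.
    apply: (@bounded_integrable _ _ _ _ _ eta).
      apply: (@measurable_soft_mean _ _ _ _ zeta (fun _ => u) (fun w => x (Y (inl k) w))) => r.
        exact: measurable_cst.
      by apply: (measurableT_comp (mx r)).
    by move=> w; apply: soft_mean_norm => // r; exact: xeta.
  rewrite Rintegral_soft_mean// /soft_mean big1 ?mulr0// => r _.
  by rewrite x_mean mulr0.
have mh1u : measurable_fun setT (fun w => h1 (update (inl k) y (Y (inl k) w))).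
  exact: (measurableT_comp mh1 (measurable_update_sample Y _ _)).
rewrite -[X in `|X|]addr0 -lin0 -RintegralD//; last 2 first.
- exact: bounded_integrable mh1u (fun w => h1b _).
- exact: bounded_integrable mlin linb.
apply: Rintegral_norm_le => [|w]; first exact: measurable_funD.
exact: close.
Qed.

Lemma lindeberg zeta n :
  `|\int[Pr]_w soft_step zeta (hybrid n n (sample_path Y w)) -
    \int[Pr]_w soft_step zeta (hybrid 0 n (sample_path Y w))|
  <= n%:R * (280 * eta ^+ 3 * (1 + K)).
Proof.
suff H k : (k <= n)%N ->
  `|\int[Pr]_w soft_step zeta (hybrid k n (sample_path Y w)) -
    \int[Pr]_w soft_step zeta (hybrid 0 n (sample_path Y w))|
  <= k%:R * (280 * eta ^+ 3 * (1 + K)) by exact: H.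
elim: k => [_|k IH kn]; first by rewrite subrr normr0 mul0r.
apply: le_trans (ler_distD (\int[Pr]_w soft_step zeta (hybrid k n (sample_path Y w))) _ _) _.
have -> (c : R) : k.+1%:R * c = c + k%:R * c by rewrite -natr1 mulrDl mul1r addrC.
by apply: lerD; [exact: lindeberg_step|exact: IH (ltnW kn)].
Qed.

(** Expanding soft_mean(S; x_k) around the sum without x_k, the first order part
    is centred and the second order part is
    soft_mean(x_k^2) - soft_mean(x_k)^2 >= (1 - g) soft_mean(x_k^2),
    by Cauchy-Schwarz, whose expectation is at least v2 g (1 - g). *)
Lemma anticoncentration_step zeta k n v2 : (k < n)%N -> 0 <= v2 <= eta ^+ 2 ->
  (forall i r, v2 <= \int[Pr]_w (x (Y (inl i) w) r ^+ 2)) ->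
  v2 * \int[Pr]_w (soft_step zeta (hybrid 0 n (sample_path Y w)) *
                   (1 - soft_step zeta (hybrid 0 n (sample_path Y w)))) - 436 * eta ^+ 3
  <= \int[Pr]_w soft_mean zeta (hybrid 0 n (sample_path Y w)) (x (Y (inl k) w)).
Proof.
move=> kn /andP[v0 ve] x_var.
have ms := measurable_sample_path Y.
have mH r : measurable_fun setT (fun y => hybrid 0 n y r) by exact: measurable_hybrid.
pose g y := soft_step zeta (hybrid 0 n y).
pose m y := soft_mean zeta (hybrid 0 n y) (x (y (inl k))).
have mg : measurable_fun setT g by exact: measurable_soft_step.
have mg1 : measurable_fun setT (fun y => g y * (1 - g y)).
  by apply: measurable_funM => //; apply: measurable_funB => //; exact: measurable_cst.
have mm : measurable_fun setT m.
  by apply: (@measurable_soft_mean _ _ _ _ zeta _ (fun y => x (y (inl k)))) => // r; exact: measurable_data.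
have g01 y : 0 <= g y <= 1 by rewrite soft_step_ge0 soft_step_le1.
have g1b y : 0 <= g y * (1 - g y) <= 1 by have := g01 y; move=> /andP[? ?]; apply/andP; split; nra.
have mb y : `|m y| <= eta by apply: soft_mean_norm => // r; exact: xeta.
pose h y := v2 * (g y * (1 - g y)) - m y.
have mh : measurable_fun setT h.
  by apply: measurable_funB => //; apply: measurable_funM => //; exact: measurable_cst.
have hb y : `|h y| <= v2 + eta.
  apply: le_trans (ler_normB _ _) (lerD _ (mb y)).
  have /andP[? ?] := g1b y.
  by rewrite normrM !ger0_norm// ler_piMr.
have ig : Pr.-integrable setT (EFin \o (fun w => g (sample_path Y w) * (1 - g (sample_path Y w)))).
  apply: (@bounded_integrable _ _ _ _ _ 1) => [|w]; first exact: (measurableT_comp mg1 ms).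
  by have /andP[? ?] := g1b (sample_path Y w); rewrite ger0_norm.
have im : Pr.-integrable setT (EFin \o (fun w => m (sample_path Y w))).
  apply: (@bounded_integrable _ _ _ _ _ eta) => [|w]; first exact: (measurableT_comp mm ms).
  exact: mb.
have ivg : Pr.-integrable setT (EFin \o (fun w =>
    v2 * (g (sample_path Y w) * (1 - g (sample_path Y w))))).
  exact: (integrableZl measurableT _ ig).
rewrite lerBlDr -lerBlDl -RintegralZl//.
rewrite [X in _ - X](_ : _ = \int[Pr]_w m (sample_path Y w)); last first.
  by apply: eq_Rintegral.
rewrite -RintegralB//.
apply: (resample_le indep (k := inl k) mh hb) => y.
set u := rest 0 k n y.
set gu := soft_step zeta u.
have HE e : hybrid 0 n (update (inl k) y e) = (fun r => u r + x e r).
  by apply/funext => r; rewrite (@hybridE 0 k) ?kn// rest_inl update_eq.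
(* second order upper approximation of h in the k-th datum *)
pose q e := v2 * (gu * (1 - gu)) - soft_mean zeta u (x e)
   - (1 - gu) * soft_mean zeta u (fun r => x e r ^+ 2).
have gu0 : 0 <= gu by exact: soft_step_ge0.
have gu1 : gu <= 1 by exact: soft_step_le1.
have e3 : 0 <= eta ^+ 3 by exact: exprn_ge0.
have close e : h (update (inl k) y e) <= q e + 436 * eta ^+ 3.
  rewrite /h /g /m HE update_eq /q.
  have := soft_step_lipschitz zeta u eta0 (xeta e).
  have := soft_mean_taylor2 zeta u eta0 (xeta e) eta0 (xeta e).
  have -> : eta * eta ^+ 2 = eta ^+ 3 by rewrite exprS.
  have := soft_mean_sqr zeta u (x e).
  have -> : soft_mean zeta u (fun r => x e r * x e r) =
    soft_mean zeta u (fun r => x e r ^+ 2) by [].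
  have := soft_step_ge0 zeta (fun r => u r + x e r).
  have := soft_step_le1 zeta (fun r => u r + x e r).
  rewrite -/gu; set G := soft_step zeta (fun r => u r + x e r).
  set M := soft_mean zeta (fun r => u r + x e r) (x e).
  set m1 := soft_mean zeta u (x e); set m2 := soft_mean zeta u (fun r => x e r ^+ 2).
  move=> G1 G0 cs; rewrite !ler_norml => /andP[t1 t2] /andP[l1 l2].
  have : v2 * (G * (1 - G)) <= v2 * (gu * (1 - gu)) + 283 * eta ^+ 3.
    have : G * (1 - G) <= gu * (1 - gu) + 283 * eta.
      have -> : G * (1 - G) = gu * (1 - gu) + (G - gu) * (1 - G - gu) by ring.
      rewrite lerD2l; apply: (@le_trans _ _ (`|G - gu| * `|1 - G - gu|)).
        by rewrite -normrM ler_norm.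
      have n1 : `|G - gu| <= 283 * eta by rewrite ler_norml l1.
      have n2 : `|1 - G - gu| <= 1 by rewrite ler_norml; apply/andP; split; lra.
      by apply: le_trans (ler_pM _ _ n1 n2) _; rewrite ?mulr1.
    have ve3 : v2 * eta <= eta ^+ 3 by rewrite exprSr ler_wpM2r.
    move=> /(ler_wpM2l v0); lra.
  lra.
have iM (f : E -> R) M : (forall e, `|f e| <= M) -> measurable_fun setT f ->
    Pr.-integrable setT (EFin \o (fun w => f (Y (inl k) w))).
  move=> fM mf; apply: (@bounded_integrable _ _ _ _ _ M) => //.
  by apply: (measurableT_comp mf).
have x2b e r : `|x e r ^+ 2| <= eta ^+ 2.
  by rewrite normrX lerXn2r ?nnegrE.
have mx2 r : measurable_fun setT (fun e => x e r ^+ 2) by exact: measurable_funX.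
have mcu (r : J) : measurable_fun setT (fun _ : E => u r) by exact: measurable_cst.
have i1 : Pr.-integrable setT (EFin \o (fun w => soft_mean zeta u (x (Y (inl k) w)))).
  apply: (iM (fun e => soft_mean zeta u (x e)) eta).
    by move=> e; apply: soft_mean_norm => // r; exact: xeta.
  exact: (@measurable_soft_mean _ _ _ _ zeta (fun _ => u) x).
have i2 : Pr.-integrable setT (EFin \o (fun w =>
    soft_mean zeta u (fun r => x (Y (inl k) w) r ^+ 2))).
  apply: (iM (fun e => soft_mean zeta u (fun r => x e r ^+ 2)) (eta ^+ 2)).
    by move=> e; apply: soft_mean_norm; [move=> r; exact: x2b|exact: sqr_ge0].
  exact: (@measurable_soft_mean _ _ _ _ zeta (fun _ => u) (fun e r => x e r ^+ 2)).
have i2' : Pr.-integrable setT (EFin \o (fun w =>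
    (1 - gu) * soft_mean zeta u (fun r => x (Y (inl k) w) r ^+ 2))).
  exact: (integrableZl measurableT _ i2).
have ic1 : Pr.-integrable setT (EFin \o (fun w =>
    v2 * (gu * (1 - gu)) - soft_mean zeta u (x (Y (inl k) w)))).
  exact: (integrableB measurableT (icst _) i1).
have iq : Pr.-integrable setT (EFin \o (fun w => q (Y (inl k) w))).
  exact: (integrableB measurableT ic1 i2').
apply: (@le_trans _ _ (\int[Pr]_w (q (Y (inl k) w) + 436 * eta ^+ 3))).
  apply: le_Rintegral => //.
  - apply: (@bounded_integrable _ _ _ _ _ (v2 + eta)) => [|w]; last exact: hb.
    exact: (measurableT_comp mh (measurable_update_sample Y _ _)).
  - exact: (integrableD measurableT iq (icst _)).
rewrite RintegralD// Rintegral_probability_cst /q RintegralB// RintegralB//.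
rewrite Rintegral_probability_cst RintegralZl// !Rintegral_soft_mean//; last first.
  by move=> r; apply: (iM (fun e => x e r ^+ 2) (eta ^+ 2)) => // e.
have -> : soft_mean zeta u (fun r => \int[Pr]_w x (Y (inl k) w) r) = 0.
  by rewrite /soft_mean big1// => r _; rewrite x_mean mulr0.
have : gu * v2 <= soft_mean zeta u (fun r => \int[Pr]_w (x (Y (inl k) w) r ^+ 2)).
  by rewrite -soft_mean_cst; apply: soft_mean_le => r; exact: x_var.
have gu1' : 0 <= 1 - gu by rewrite subr_ge0.
move=> /(ler_wpM2l gu1'); lra.
Qed.

(** Summing over k turns the right-hand sides into E soft_mean(S; S), which is at
    most E sup |S|.  Variance lower bounds thus limit the time that S spends in
    the transition zone of the soft step. *)
Lemma anticoncentration zeta n v2 : 0 <= v2 <= eta ^+ 2 ->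
  (forall i r, v2 <= \int[Pr]_w (x (Y (inl i) w) r ^+ 2)) ->
  n%:R * v2 * \int[Pr]_w (soft_step zeta (hybrid 0 n (sample_path Y w)) *
                   (1 - soft_step zeta (hybrid 0 n (sample_path Y w))))
  <= \int[Pr]_w soft_mean zeta (hybrid 0 n (sample_path Y w)) (hybrid 0 n (sample_path Y w))
     + n%:R * (436 * eta ^+ 3).
Proof.
move=> v2b x_var; rewrite -lerBlDr.
have ms := measurable_sample_path Y.
have mHs r : measurable_fun setT (fun w => hybrid 0 n (sample_path Y w) r).
  exact: (measurableT_comp (measurable_hybrid 0 n r) ms).
have -> : \int[Pr]_w soft_mean zeta (hybrid 0 n (sample_path Y w)) (hybrid 0 n (sample_path Y w)) =
    \sum_(k < n) \int[Pr]_w soft_mean zeta (hybrid 0 n (sample_path Y w)) (x (Y (inl (k : nat)) w)).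
  rewrite -Rintegral_sum => [|k].
    apply: eq_Rintegral => w _; rewrite /soft_mean exchange_big/=; apply: eq_bigr => r _.
    rewrite -mulr_sumr; congr (_ * _); apply: eq_bigr => i _.
    by rewrite ltn0 mul1r.
  apply: (@bounded_integrable _ _ _ _ _ eta) => [|w].
    apply: (@measurable_soft_mean _ _ _ _ zeta
      (fun w => hybrid 0 n (sample_path Y w)) (fun w => x (Y (inl (k : nat)) w))) => // r.
    by apply: (measurableT_comp (mx r)).
  by apply: soft_mean_norm => // r; exact: xeta.
apply: le_trans (ler_sum _ (fun (k : 'I_n) _ =>
  anticoncentration_step zeta (ltn_ord k) v2b x_var)).
have -> (a b : R) : n%:R * v2 * a - n%:R * b = (v2 * a - b) *+ n.
  by rewrite -[RHS]mulr_natl mulrBr mulrA.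
by rewrite sumr_const card_ord.
Qed.

(** The multiplier sum with data read on y and multipliers on y', so that the
    multipliers can be integrated out at fixed data. *)
Definition weighted n y y' (r : J) : R :=
  \sum_(i < n) z (y' (inr (i : nat))) * x (y (inl (i : nat))) r.

Lemma hybrid_weighted n y : hybrid n n y = weighted n y y.
Proof. by apply/funext => r; apply: eq_bigr => i _; rewrite ltn_ord. Qed.

(** The conditional expectation of the soft step of the multiplier sum given the
    data. *)
Definition conditional_step zeta n y : R :=
  \int[Pr]_w soft_step zeta (weighted n y (sample_path Y w)).

Let measurable_weighted n r y :
  measurable_fun setT (fun y' => weighted n y y' r).
Proof.
apply: measurable_sum => i; apply: measurable_funM; first exact: measurable_weight.
exact: measurable_cst.
Qed.

Lemma measurable_conditional_step zeta n : measurable_fun setT (conditional_step zeta n).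
Proof.
apply: (@measurable_Rintegral_param _ _ _ Pr _ _
  (fun p => soft_step zeta (weighted n p.1 (sample_path Y p.2))) 1); last first.
  by move=> p; exact: soft_step_norm.
apply: (@measurable_soft_step _ _ _ _ zeta
  (fun p => weighted n p.1 (sample_path Y p.2))) => r.
apply: measurable_sum => i; apply: measurable_funM.
  exact: (measurableT_comp (measurable_weight i)
    (measurableT_comp (measurable_sample_path Y) measurable_snd)).
exact: (measurableT_comp (measurable_data i r) measurable_fst).
Qed.

Lemma conditional_step_norm zeta n y : `|conditional_step zeta n y| <= 1.
Proof.
apply: Rintegral_norm_le => [|w]; last exact: soft_step_norm.
apply: (@measurable_soft_step _ _ _ _ zeta (fun w => weighted n y (sample_path Y w))) => r.
exact: (measurableT_comp (measurable_weighted n r y) (measurable_sample_path Y)).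
Qed.

(** Removing the k-th summand costs only eta^2, because its multiplier is centred
    and independent of the rest. *)
Lemma conditional_step_diff zeta n k y y' : (k < n)%N ->
  (forall i, i != inl k -> y i = y' i) ->
  `|conditional_step zeta n y - conditional_step zeta n y'| <= 564 * eta ^+ 2.
Proof.
move=> kn yy'.
pose base y y'' (r : J) : R :=
  \sum_(i < n | i != k :> nat) z (y'' (inr (i : nat))) * x (y (inl (i : nat))) r.
have ms := measurable_sample_path Y.
have mbase y0 r : measurable_fun setT (fun y'' => base y0 y'' r).
  rewrite [X in measurable_fun _ X](_ : _ = (fun y'' => \sum_(i < n) if i != k :> nat then
    z (y'' (inr (i : nat))) * x (y0 (inl (i : nat))) r else 0)).
    apply: measurable_sum => i; destruct (i != k :> nat); last exact: measurable_cst.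
    by apply: measurable_funM; [exact: measurable_weight|exact: measurable_cst].
  by apply/funext => y''; rewrite /base big_mkcond.
have near_base y0 : `|conditional_step zeta n y0 -
    \int[Pr]_w soft_step zeta (base y0 (sample_path Y w))| <= 282 * eta ^+ 2.
  pose h y'' := soft_step zeta (weighted n y0 y'') - soft_step zeta (base y0 y'').
  have m1 : measurable_fun setT (fun y'' => soft_step zeta (weighted n y0 y'')).
    exact: measurable_soft_step.
  have m2 : measurable_fun setT (fun y'' => soft_step zeta (base y0 y'')).
    exact: measurable_soft_step.
  have mh : measurable_fun setT h by exact: measurable_funB.
  have hb y'' : `|h y''| <= 2.
    rewrite (le_trans (ler_normB _ _))//.
    by have := lerD (soft_step_norm zeta (weighted n y0 y''))
                    (soft_step_norm zeta (base y0 y'')).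
  rewrite /conditional_step -RintegralB//; last 2 first.
  - apply: (@bounded_integrable _ _ _ _ _ 1) => [|w]; last exact: soft_step_norm.
    exact: (measurableT_comp m1 ms).
  - apply: (@bounded_integrable _ _ _ _ _ 1) => [|w]; last exact: soft_step_norm.
    exact: (measurableT_comp m2 ms).
  apply: (resample_norm indep (k := inr k) mh hb) => y''.
  have baseE e : base y0 (update (inr k) y'' e) = base y0 y''.
    by apply/funext => r; apply: eq_bigr => i ik; rewrite update_neq.
  have wE e : weighted n y0 (update (inr k) y'' e) =
      (fun r => base y0 y'' r + z e * x (y0 (inl k)) r).
    apply/funext => r; rewrite /weighted (bigD1 (Ordinal kn))//= update_eq addrC.
    congr (_ + _); apply: eq_bigr => i ik; rewrite update_neq//.
  have := multiplier_taylor2 (z_std k) zeta (base y0 y'') (xeta (y0 (inl k))) eta0.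
  congr (`|_| <= _); rewrite Rintegral_sub_cst.
  - by apply: eq_Rintegral => w _; rewrite /h baseE wE.
  - apply: (@bounded_integrable _ _ _ _ _ 1) => [|w]; last exact: soft_step_norm.
    apply: (@measurable_soft_step _ _ _ _ zeta
      (fun w r => base y0 y'' r + z (Y (inr k) w) * x (y0 (inl k)) r)) => r.
    apply: measurable_funD; first exact: measurable_cst.
    by apply: measurable_funM; [apply: (measurableT_comp mz)|exact: measurable_cst].
have bE : base y = base y'.
  apply/funext => y''; apply/funext => r; apply: eq_bigr => i ik.
  by rewrite yy'.
have := near_base y; have := near_base y'; rewrite bE.
move: (\int[Pr]_w soft_step zeta (base y' (sample_path Y w))) => b.
move: (conditional_step zeta n y) (conditional_step zeta n y') => A B h1 h2.
have -> : 564 * eta ^+ 2 = 282 * eta ^+ 2 + 282 * eta ^+ 2 by ring.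
by apply: le_trans (ler_distD b A B) (lerD h2 _); rewrite distrC.
Qed.

(** L^1 deviation from the standard deviation bound, in the form
    |p - m| <= ((p - m)^2 + theta^2) / (2 theta). *)
Lemma conditional_step_deviation zeta n theta : 0 < theta ->
  n%:R * (564 * eta ^+ 2) ^+ 2 <= theta ^+ 2 ->
  \int[Pr]_w `|conditional_step zeta n (sample_path Y w) -
     \int[Pr]_w' conditional_step zeta n (sample_path Y w')| <= theta.
Proof.
move=> th0 hth; set psi := conditional_step zeta n.
set m := \int[Pr]_w' psi (sample_path Y w').
have ms := measurable_sample_path Y.
have mpsi : measurable_fun setT psi := measurable_conditional_step zeta n.
have psib := conditional_step_norm zeta n.
have mps : measurable_fun setT (fun w => psi (sample_path Y w)).
  exact: (measurableT_comp mpsi ms).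
have V := @bounded_difference_variance _ _ _ _ _ _ _ _ indep
  [seq inl i | i <- iota 0 n] psi 1 (564 * eta ^+ 2) mpsi psib.
have {V} V : \int[Pr]_w (psi (sample_path Y w) ^+ 2) <= m ^+ 2 + theta ^+ 2.
  apply: le_trans (V _ _) _.
  - move=> y y' yy'; apply: eq_Rintegral => w _; congr soft_step; apply/funext => r.
    apply: eq_bigr => i _; rewrite yy'//; apply/mapP; exists (i : nat) => //.
    by rewrite mem_iota add0n ltn_ord.
  - move=> j y y' /mapP[k]; rewrite mem_iota add0n => /andP[_ kn] -> yy'.
    exact: (conditional_step_diff _ kn).
  - by rewrite size_map size_iota; apply: lerD.
have i1 : Pr.-integrable setT (EFin \o (fun w => psi (sample_path Y w))).
  by apply: bounded_integrable mps _.
have i2 : Pr.-integrable setT (EFin \o (fun w => psi (sample_path Y w) ^+ 2)).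
  apply: (@bounded_integrable _ _ _ _ _ 1) => [|w]; first exact: measurable_funX.
  by rewrite normrX exprn_ile1.
have i1' (c : R) : Pr.-integrable setT (EFin \o (fun w => c * psi (sample_path Y w))).
  exact: (integrableZl measurableT _ i1).
have i21 : Pr.-integrable setT (EFin \o (fun w =>
    psi (sample_path Y w) ^+ 2 - 2 * m * psi (sample_path Y w))).
  exact: (integrableB measurableT i2 (i1' _)).
have i22 : Pr.-integrable setT (EFin \o (fun w =>
    psi (sample_path Y w) ^+ 2 - 2 * m * psi (sample_path Y w) + m ^+ 2 + theta ^+ 2)).
  exact: (integrableD measurableT (integrableD measurableT i21 (icst _)) (icst _)).
have i22' : Pr.-integrable setT (EFin \o (fun w =>
    psi (sample_path Y w) ^+ 2 - 2 * m * psi (sample_path Y w) + m ^+ 2)).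
  exact: (integrableD measurableT i21 (icst _)).
have i23 : Pr.-integrable setT (EFin \o (fun w => (2 * theta)^-1 *
    (psi (sample_path Y w) ^+ 2 - 2 * m * psi (sample_path Y w) + m ^+ 2 + theta ^+ 2))).
  exact: (integrableZl measurableT _ i22).
apply: (@le_trans _ _ (\int[Pr]_w ((2 * theta)^-1 *
    (psi (sample_path Y w) ^+ 2 - 2 * m * psi (sample_path Y w) + m ^+ 2 + theta ^+ 2)))).
  apply: le_Rintegral => //.
    have := integrableB measurableT i1 (icst m).
    exact: integrable_norm.
  move=> w _; set p := psi _; rewrite mulrC ler_pdivlMr ?mulr_gt0//.
  have -> : p ^+ 2 - 2 * m * p + m ^+ 2 = `|p - m| ^+ 2.
    by rewrite real_normK ?num_real//; ring.
  have := sqr_ge0 (`|p - m| - theta); nra.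
rewrite RintegralZl// RintegralD// RintegralD// RintegralB// RintegralZl// -/m.
rewrite !Rintegral_probability_cst mulrC ler_pdivrMr ?mulr_gt0//; nra.
Qed.
End multiplier_comparison.

(** * Soft step and thresholds *)
Section soft_step_threshold.
Context {R : realType} {J : finType}.
Implicit Types (w : J -> R) (z d : R).

Lemma soft_step_anti z z' w : z <= z' -> soft_step z' w <= soft_step z w.
Proof.
move=> zz'; have S0 : 0 <= \sum_s expR (w s).
  by rewrite sumr_ge0// => s _; exact: expR_ge0.
by rewrite !soft_stepE ler_wpM2l// lef_pV2 ?posrE ?soft_den_gt0// lerD2r ler_expR.
Qed.

(** The derivative of the soft step in its threshold is - g (1 - g). *)
Lemma soft_step_shift_le z d w : 0 <= d ->
  soft_step z w - soft_step (z + d) w <=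
  (expR d - 1) * (soft_step z w * (1 - soft_step z w)).
Proof.
move=> d0; rewrite soft_stepC !soft_stepE expRD.
have := soft_den_gt0 z w; have := soft_den_gt0 (z + d) w; rewrite expRD.
have : 0 <= \sum_s expR (w s) by rewrite sumr_ge0// => s _; exact: expR_ge0.
have : 1 <= expR d by rewrite -expR0 ler_expR.
have := expR_gt0 z; move: (\sum_s _) (expR z) (expR d) => A e f e0 f1 A0 D' D.
have -> : A / (e + A) - A / (e * f + A) =
    (f - 1) * (A / (e + A) * (e / (e + A))) * ((e + A) / (e * f + A)).
  by field; rewrite !gt_eqF.
have f0 : 0 <= f - 1 by rewrite subr_ge0.
have q0 : 0 <= A / (e + A) * (e / (e + A)) by rewrite mulr_ge0// divr_ge0// ltW.
apply: ler_piMr; first exact: mulr_ge0.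
by rewrite ler_pdivrMr// mul1r lerD2r ler_peMr// ltW.
Qed.

(** The number of indices is absorbed by an exponential margin d, which only
    needs to be of the order of its logarithm. *)
Lemma soft_step_small z d w : (forall r, w r <= z - d) ->
  soft_step z w <= #|J|%:R * expR (- d).
Proof.
move=> wz; rewrite soft_stepE.
have D0 := soft_den_gt0 z w.
have S0 : 0 <= \sum_s expR (w s) by rewrite sumr_ge0// => s _; exact: expR_ge0.
apply: (@le_trans _ _ ((\sum_s expR (w s)) / expR z)).
  by rewrite ler_wpM2l// lef_pV2 ?posrE ?expR_gt0// lerDl.
rewrite mulr_suml mulr_natl -[X in _ *+ X]sum1_card -sumrMnr.
by apply: ler_sum => r _; rewrite -expRB mulr1n ler_expR lerBlDr addrC.
Qed.

Lemma soft_step_large z d w r : z + d <= w r -> 1 - soft_step z w <= expR (- d).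
Proof.
move=> zw; rewrite soft_stepC ler_pdivrMr ?soft_den_gt0//.
apply: (@le_trans _ _ (expR (- d) * expR (w r))).
  by rewrite -expRD ler_expR; lra.
rewrite ler_wpM2l ?expR_ge0// (bigD1 r)//= addrCA lerDl addr_ge0 ?expR_ge0//.
by rewrite sumr_ge0// => s _; exact: expR_ge0.
Qed.
End soft_step_threshold.

(** * Lipschitz paths and grids *)
Section landscapes.
Context {R : realType} {T : R}.
Implicit Types (p : R * R) (D : seq (R * R)) (s t : R).

Lemma maxr_dist (a b a' b' e : R) : `|a - a'| <= e -> `|b - b'| <= e ->
  `|Num.max a b - Num.max a' b'| <= e.
Proof.
rewrite !ler_norml => /andP[? ?] /andP[? ?].
by case: (leP a b) => ?; case: (leP a' b') => ?; apply/andP; split; lra.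
Qed.

Lemma minr_dist (a b a' b' e : R) : `|a - a'| <= e -> `|b - b'| <= e ->
  `|Num.min a b - Num.min a' b'| <= e.
Proof.
rewrite !ler_norml => /andP[? ?] /andP[? ?].
by case: (leP a b) => ?; case: (leP a' b') => ?; apply/andP; split; lra.
Qed.

Lemma landscape_of_lipschitz D s t : `|landscape_of D s - landscape_of D t| <= `|s - t|.
Proof.
rewrite /landscape_of; elim: D => [|p D IH]; first by rewrite !big_nil subrr normr0.
rewrite !big_cons; apply: maxr_dist => //; apply: maxr_dist; first by rewrite subrr normr0.
apply: minr_dist.
  by have -> : s - p.1 - (t - p.1) = s - t by ring.
have -> : p.2 - s - (p.2 - t) = - (s - t) by ring.
by rewrite normrN.
Qed.

Lemma landscape_of_ge0 D t : 0 <= landscape_of D t.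
Proof.
rewrite /landscape_of; elim: D => [|p D IH]; first by rewrite big_nil.
by rewrite big_cons le_max IH orbT.
Qed.

Lemma landscape_of_le D t : 0 <= T -> persistence_diagram T D -> landscape_of D t <= T.
Proof.
move=> T0; rewrite /landscape_of; elim: D => [|p D IH] DT; first by rewrite big_nil.
rewrite big_cons ge_max IH ?andbT => [|q qD]; last by apply: DT; rewrite inE qD orbT.
have [|p1 [p12 p2]] := DT p; first by rewrite inE eqxx.
by rewrite /tent ge_max T0/= ge_min; case: (leP (t - p.1) T) => //= ?; lra.
Qed.

Lemma landscape_lipschitz (l : landscape T) s t : `|l s - l t| <= `|s - t|.
Proof. by have [D _ ->] := landscapeP l; exact: landscape_of_lipschitz. Qed.

Lemma landscape_bounds (l : landscape T) t : 0 <= T -> 0 <= l t <= T.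
Proof.
move=> T0; have [D DT ->] := landscapeP l.
by rewrite landscape_of_ge0 landscape_of_le.
Qed.
End landscapes.

Section grid.
Context {R : realType}.
Implicit Types (lo hi t : R) (n j : nat).

Definition grid lo hi n j : R := lo + (hi - lo) * (j%:R / n%:R).

Lemma grid0 lo hi n : grid lo hi n 0%N = lo.
Proof. by rewrite /grid mul0r mulr0 addr0. Qed.

Lemma gridn lo hi n : (0 < n)%N -> grid lo hi n n = hi.
Proof. by move=> n0; rewrite /grid divff ?pnatr_eq0 -?lt0n// mulr1 addrC subrK. Qed.

Lemma grid_step lo hi n j : grid lo hi n j.+1 - grid lo hi n j = (hi - lo) / n%:R.
Proof. by rewrite /grid -natr1; ring. Qed.

Lemma grid_bounds lo hi n j : lo <= hi -> (j <= n)%N -> lo <= grid lo hi n j <= hi.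
Proof.
move=> lh jn; have d0 : 0 <= hi - lo by rewrite subr_ge0.
have q0 : 0 <= j%:R / n%:R :> R by rewrite divr_ge0.
have q1 : j%:R / n%:R <= 1 :> R.
  case: n jn {q0} => [|n] jn; first by rewrite invr0 mulr0.
  by rewrite ler_pdivrMr// mul1r ler_nat.
by rewrite /grid; apply/andP; split; nra.
Qed.

Lemma grid_near lo hi n t : (0 < n)%N -> lo <= t <= hi ->
  exists j : 'I_n.+1, `|t - grid lo hi n j| <= (hi - lo) / n%:R.
Proof.
move=> n0 /andP[lt th].
have [|k tk kmin] := @ex_minnP (fun j => t <= grid lo hi n j).
  by exists n; rewrite gridn.
have kn : (k < n.+1)%N by rewrite ltnS kmin// gridn.
have d0 : 0 <= (hi - lo) / n%:R by rewrite divr_ge0// subr_ge0 (le_trans lt).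
exists (Ordinal kn) => /=; case: k tk kmin kn => [|k] tk kmin kn.
  by move: tk; rewrite grid0 => tlo; rewrite (@le_anti _ _ t lo) ?tlo ?lt// subrr normr0.
have tk' : grid lo hi n k < t.
  by rewrite ltNge; apply/negP => /kmin; rewrite ltnn.
have := grid_step lo hi n k; rewrite ler_norml => H; apply/andP; split; lra.
Qed.

Lemma sqr_sum_le n (a : 'I_n -> R) : (\sum_i a i) ^+ 2 <= n%:R * \sum_i a i ^+ 2.
Proof.
case: n a => [|n] a; first by rewrite !big_ord0 mulr0 expr0n.
set s := \sum_i a i; set q := \sum_i a i ^+ 2.
have : 0 <= \sum_i (n.+1%:R * a i - s) ^+ 2 by rewrite sumr_ge0// => i _; exact: sqr_ge0.
have -> : \sum_i (n.+1%:R * a i - s) ^+ 2 = n.+1%:R * (n.+1%:R * q - s ^+ 2).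
  have -> : \sum_i (n.+1%:R * a i - s) ^+ 2 =
      \sum_i (n.+1%:R ^+ 2 * a i ^+ 2 - 2 * n.+1%:R * s * a i + s ^+ 2).
    by apply: eq_bigr => i _; ring.
  rewrite big_split sumrB/= -!mulr_sumr -/q -/s sumr_const card_ord -[_ *+ _]mulr_natl.
  ring.
by rewrite pmulr_rge0 ?ltr0n// subr_ge0.
Qed.

(** A supremum over the grid is controlled by a quadratic expression in the first
    value and the increments, whose expectation is explicit.  For Lipschitz
    processes the increments are of order 1/n and nothing is lost, not even a
    logarithm. *)
Lemma chain_sqr_le n (F : nat -> R) j : (j <= n)%N ->
  F j ^+ 2 <= 2 * F 0%N ^+ 2 + 2 * n%:R * \sum_(k < n) (F k.+1 - F k) ^+ 2.
Proof.
move=> jn.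
have H : (F j - F 0%N) ^+ 2 <= n%:R * \sum_(k < n) (F k.+1 - F k) ^+ 2.
  rewrite -(telescope_sumr F (leq0n j)) big_mkord.
  apply: le_trans (sqr_sum_le _) _; apply: ler_pM.
  - by [].
  - by rewrite sumr_ge0// => k _; exact: sqr_ge0.
  - by rewrite ler_nat.
  rewrite (big_ord_widen n (fun k => (F k.+1 - F k) ^+ 2) jn) big_mkcond/=.
  by apply: ler_sum => k _; case: ifP => // _; exact: sqr_ge0.
have := sqr_ge0 (F j - 2 * F 0%N); rewrite -[2 * n%:R * _]mulrA; nra.
Qed.
End grid.

Section measurable_supremum.
Context d (Omega : measurableType d) (R : realType).

Lemma measurable_gt0 (f : Omega -> R) : measurable_fun setT f ->
  measurable [set w | 0 < f w].
Proof.
move=> mf; rewrite [X in measurable X](_ : _ = f @^-1` `]0, +oo[%classic).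
  by rewrite -[X in measurable X]setTI; apply: mf.
by apply/seteqP; split => w /=; rewrite in_itv/= andbT.
Qed.

(** By the Lipschitz property, a process that is positive somewhere is positive
    at a point of a fine enough grid, so the event is a countable union. *)
Lemma measurable_exists_itv (lo hi : R) (f : R -> Omega -> R) (L : Omega -> R) :
  lo <= hi -> (forall t, lo <= t <= hi -> measurable_fun setT (f t)) ->
  (forall w s t, lo <= s <= hi -> lo <= t <= hi -> f s w - f t w <= L w * `|s - t|) ->
  measurable [set w | exists2 t, lo <= t <= hi & 0 < f t w].
Proof.
move=> lh mf Lf.
rewrite [X in measurable X](_ : _ = \bigcup_n \bigcup_(j in `I_n.+2)
    [set w | 0 < f (grid lo hi n.+1 j) w]).
  apply: bigcup_measurable => n _; apply: bigcup_measurable => j /= jn.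
  by apply/measurable_gt0/mf/grid_bounds.
apply/seteqP; split => w /=; last first.
  by move=> [n _ [j /= jn fj]]; exists (grid lo hi n.+1 j) => //; exact: grid_bounds.
move=> [t tlh ft].
pose n := Num.truncn (`|L w| * (hi - lo) / f t w).
have d0 : 0 <= hi - lo by rewrite subr_ge0.
have Ln : `|L w| * (hi - lo) / f t w < n.+1%:R.
  by have /andP[] := @truncn_itv _ (`|L w| * (hi - lo) / f t w)
    (divr_ge0 (mulr_ge0 (normr_ge0 _) d0) (ltW ft)).
have [j tj] := @grid_near _ lo hi n.+1 t (ltn0Sn n) tlh.
exists n => //; exists j => //=.
have jn : (j <= n.+1)%N by rewrite -ltnS ltn_ord.
have := Lf w _ _ tlh (grid_bounds lh jn).
move: Ln; rewrite ltr_pdivrMr// => Ln H.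
have h1 : L w * `|t - grid lo hi n.+1 j| <= `|L w| * ((hi - lo) / n.+1%:R).
  apply: le_trans (ler_norm _) _.
  by rewrite normrM normr_id ler_wpM2l.
have h2 : `|L w| * ((hi - lo) / n.+1%:R) < f t w.
  by rewrite mulrA ltr_pdivrMr ?ltr0n// [ltRHS]mulrC.
by have := le_lt_trans (le_trans H h1) h2; rewrite ltrBlDr ltrDl.
Qed.
End measurable_supremum.

(** * Conditional tails and quantiles *)
Section preimage_families.
Context d (Omega : measurableType d) dE (E : measurableType dE).
Variable X : nat -> {mfun Omega >-> E}.

Lemma preimage_family_measurable J : preimage_family X J `<=` measurable.
Proof.
by move=> _ [i _ [B mB <-]]; rewrite setTI -[X in measurable X]setTI; exact: measurable_funP.
Qed.

Lemma preimage_familyS J A :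
  <<s preimage_family X J >> A -> <<s preimage_family X setT >> A.
Proof. by apply: sub_sigma_algebra2 => B [i _ iB]; exists i. Qed.

Lemma measurable_preimage_family J i : J i ->
  measurable_fun [set: g_sigma_algebraType (preimage_family X J)] (X i : Omega -> E).
Proof. by move=> Ji _ B mB; apply: sub_sigma_algebra; exists i => //; exists B. Qed.
End preimage_families.

Section upper_tails.
Context {R : realType}.
Variable m : {measure set (measurableTypeR R) -> \bar R}.
Hypothesis m1 : m setT = 1%E.
Let tail (z : R) : set (measurableTypeR R) := [set y | z < y].

Lemma measurable_tail z : measurable (tail z).
Proof.
rewrite (_ : tail z = `]z, +oo[%classic); first exact: measurable_itv.
by apply/seteqP; split => y /=; rewrite in_itv/= andbT.
Qed.

Lemma tail_small (alpha : R) : 0 < alpha -> exists z, (m (tail z) <= alpha%:E)%E.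
Proof.
move=> a0; pose F (k : nat) := tail k%:R.
have cap0 : \bigcap_k F k = set0.
  apply/seteqP; split => // y /= /(_ (Num.truncn y).+1 I).
  by rewrite /F /tail /= ltNge ltW// truncnS_gt.
have := @nonincreasing_cvg_mu _ _ _ m F; rewrite cap0 measure0 => H.
have {}H : (m \o F) x @[x --> \oo] --> 0%E.
  apply: H => //.
  - apply: le_lt_trans (ltry (1 : R)); rewrite -m1; apply: le_measure => //.
      by rewrite inE; exact: measurable_tail.
    by rewrite inE.
  - by move=> k; exact: measurable_tail.
  - move=> j k jk; apply/subsetPset => y; apply: le_lt_trans.
    by rewrite ler_nat.
have : \forall k \near \oo, ((m \o F) k < alpha%:E)%E.
  by apply: (H [set x | (x < alpha%:E)%E]); apply: open_nbhs_nbhs; split;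
    [exact: open_ereal_lt_ereal|rewrite /= lte_fin].
by move=> [k _ /(_ k (leqnn k))/ltW h]; exists k%:R.
Qed.

Lemma tail_large (alpha : R) : alpha < 1 -> exists z, (alpha%:E < m (tail z))%E.
Proof.
move=> a1; pose F (k : nat) := tail (- k%:R).
have cupT : \bigcup_k F k = setT.
  apply/seteqP; split => // y _; exists (Num.truncn (- y)).+1 => //.
  by rewrite /F /tail /= ltrNl truncnS_gt.
have := @nondecreasing_cvg_mu _ _ _ m F; rewrite cupT m1 => H.
have {}H : (m \o F) x @[x --> \oo] --> 1%E.
  apply: H => //; first by move=> k; exact: measurable_tail.
  move=> j k jk; apply/subsetPset => y; apply: le_lt_trans.
  by rewrite lerN2 ler_nat.
have : \forall k \near \oo, (alpha%:E < (m \o F) k)%E.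
  by apply: (H [set x | (alpha%:E < x)%E]); apply: open_nbhs_nbhs; split;
    [exact: open_ereal_gt_ereal|rewrite /= lte_fin].
by move=> [k _ /(_ k (leqnn k)) h]; exists (- k%:R).
Qed.

Lemma tail_anti x y : x <= y -> (m (tail y) <= m (tail x))%E.
Proof.
move=> xy; apply: le_measure; rewrite ?inE; try exact: measurable_tail.
by move=> z /=; apply: le_lt_trans.
Qed.

Lemma upper_quantile_ub (alpha : R) z : alpha < 1 -> (m (tail z) <= alpha%:E)%E ->
  upper_quantile alpha m <= z.
Proof.
move=> a1 mz; apply: ge_inf => //; have [z0 z0P] := tail_large a1.
exists z0 => x /= mx; rewrite leNgt; apply/negP => /ltW/tail_anti.
by move=> /(lt_le_trans z0P); rewrite ltNge mx.
Qed.

Lemma upper_quantile_lt (alpha : R) z : 0 < alpha -> upper_quantile alpha m < z ->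
  exists2 x, (m (tail x) <= alpha%:E)%E & x < z.
Proof. by move=> a0; apply: inf_lt; exact: tail_small. Qed.
End upper_tails.

Section conditional_quantile.
Context {R : realType} d (Omega : measurableType d) (Pr : probability Omega R).
Variables (F : set (set Omega)) (S : Omega -> R).
Variable kappa : R.-pker (g_sigma_algebraType F) ~> (measurableTypeR R).
Hypothesis F_measurable : F `<=` measurable.
Hypothesis S_measurable : forall z, measurable [set w | z < S w].
Hypothesis kappa_cond : cond_distribution Pr S kappa.
Variable alpha : R.
Hypothesis alpha_gt0 : 0 < alpha.
Hypothesis alpha_lt1 : alpha < 1.
Implicit Types (z : R) (w : Omega).

(** The event that the conditional law puts at most mass alpha above z; the
    quantile is at least z outside it. *)
Definition small_tail z : set Omega := [set w | (kappa w [set y | (z < y)%R] <= alpha%:E)%E].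

Lemma small_tail_sigma z : <<s F >> (small_tail z).
Proof.
have := @measurable_kernel _ _ _ _ _ kappa _ (measurable_tail z).
move=> /(_ measurableT `]-oo, alpha%:E]%classic (emeasurable_itv _)).
by rewrite setTI.
Qed.

Lemma measurable_small_tail z : measurable (small_tail z).
Proof. exact: sub_g_sigma_measurable (small_tail_sigma z). Qed.

Let Z w := upper_quantile alpha (kappa w).

Lemma quantile_ge w z : ~ small_tail z w -> z <= Z w.
Proof.
move=> Az; rewrite leNgt; apply/negP => zw.
have [x xa xz] := upper_quantile_lt (prob_kernel (s := kappa) w) alpha_gt0 zw.
by apply: Az; apply: le_trans xa; apply: tail_anti; exact: ltW.
Qed.

Lemma quantile_gt w z : z < Z w -> ~ small_tail z w.
Proof.
by move=> zZ zw; have := upper_quantile_ub (prob_kernel (s := kappa) w) alpha_lt1 zw; rewrite leNgt zZ.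
Qed.

Lemma measurable_quantile : measurable_fun setT Z.
Proof.
move=> mT; apply: (measurability _ (RGenInftyO.measurableE R)) => //.
move=> _ [_ [z ->] <-]; rewrite setTI.
rewrite [X in measurable X](_ : _ = \bigcup_k small_tail (z - k.+1%:R^-1)).
  by apply: bigcup_measurable => k _; exact: measurable_small_tail.
apply/seteqP; split => w /=; rewrite in_itv/=.
  move=> zw; have [x xa xz] := upper_quantile_lt (prob_kernel (s := kappa) w) alpha_gt0 zw.
  have zx : 0 < z - x by rewrite subr_gt0.
  exists (Num.truncn (z - x)^-1) => //; apply: le_trans xa; apply: tail_anti.
  have := truncnS_gt (z - x)^-1; rewrite -ltf_pV2 ?posrE ?invr_gt0// invrK.
  by move: (_.+1%:R^-1) => e; lra.
move=> [k _ zw]; apply: le_lt_trans (upper_quantile_ub (prob_kernel (s := kappa) w) alpha_lt1 zw) _.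
by rewrite ltrBlDr ltrDl invr_gt0.
Qed.

Let measurable_kappa z : measurable_fun setT (fun w => kappa w [set y | (z < y)%R]).
Proof.
apply: (measurableT_comp (measurable_kernel kappa _ (measurable_tail z))).
exact: id_g_sigma_measurable.
Qed.

(** The event small_tail z belongs to the conditioning sigma-algebra, so that the
    kernel can be integrated over it. *)
Lemma small_tail_le z :
  (Pr (small_tail z `&` [set w | (z < S w)%R]) <= alpha%:E * Pr (small_tail z))%E.
Proof.
have := kappa_cond (small_tail_sigma z) (measurable_tail z).
have -> : S @^-1` [set y | (z < y)%R] = [set w | (z < S w)%R] by [].
move=> <-; rewrite -integral_cst; last exact: measurable_small_tail.
apply: ge0_le_integral => //; first exact: measurable_small_tail.
by apply: measurable_funTS; exact: measurable_kappa.
Qed.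

Lemma large_tail_le z : (alpha%:E * Pr (~` small_tail z) <= Pr [set w | (z < S w)%R])%E.
Proof.
have mA := measurable_small_tail z.
have sA : <<s F >> (~` small_tail z).
  exact: (@measurableC _ (g_sigma_algebraType F)) (small_tail_sigma z).
have := kappa_cond sA (measurable_tail z).
have -> : S @^-1` [set y | (z < y)%R] = [set w | (z < S w)%R] by [].
move=> h; apply: (@le_trans _ _ (Pr (~` small_tail z `&` [set w | (z < S w)%R]))).
  rewrite -h -integral_cst; last exact: measurableC.
  apply: ge0_le_integral => //; first exact: measurableC.
  - by move=> w _; rewrite lee_fin ltW.
  - by apply: measurable_funTS; exact: measurable_kappa.
  - by move=> w /negP; rewrite -ltNge => /ltW.
by apply: le_measure; rewrite ?inE//; apply: measurableI => //; exact: measurableC.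
Qed.

(** If the quantile exceeds M then the conditional tail at M exceeds alpha, and
    Markov's inequality loses 1 / alpha; a quantile below -M is impossible up to
    a null event, as S is nonnegative. *)
Lemma quantile_tail (M eps : R) : (forall w, 0 <= S w) -> 0 < M ->
  (Pr [set w | (M < S w)%R] <= (alpha * eps)%:E)%E ->
  (Pr [set w | (M < `|Z w|)%R] <= eps%:E)%E.
Proof.
move=> S0 M0 SM; set B := [set w | _].
have mA z := measurable_small_tail z.
have mB : measurable B.
  rewrite (_ : B = [set w | 0 < `|Z w| - M]); last by apply/seteqP; split => w /=; rewrite subr_gt0.
  apply: measurable_gt0; apply: measurable_funB; last exact: measurable_cst.
  by apply: measurableT_comp => //; exact: measurable_quantile.
have low0 : Pr (small_tail (- M)) = 0%E.
  have := small_tail_le (- M).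
  have -> : small_tail (- M) `&` [set w | - M < S w] = small_tail (- M).
    by apply/setIidPl => w _ /=; apply: lt_le_trans (S0 w); rewrite oppr_lt0.
  rewrite -(fineK (fin_num_measure Pr _ (mA (- M)))) -EFinM lee_fin => h.
  congr EFin; apply/eqP; rewrite eq_le fine_ge0// andbT.
  have : 0 <= fine (Pr (small_tail (- M))) by rewrite fine_ge0.
  move: h; move: (fine _) => p; move: alpha_lt1; nra.
apply: (@le_trans _ _ (Pr (~` small_tail M `|` small_tail (- M)))).
  have mU : measurable (~` small_tail M `|` small_tail (- M)).
    by apply: measurableU => //; exact: measurableC.
  apply: le_measure; rewrite ?inE// => w; rewrite /B /= ltr_normr => /orP[/quantile_gt|Zw]; first by left.
  right; apply: contrapT => /quantile_ge; rewrite leNgt; apply/negP; rewrite negbK.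
  by rewrite ltrNr.
have U2 : (Pr (~` small_tail M `|` small_tail (- M)) <=
    Pr (~` small_tail M) + Pr (small_tail (- M)))%E.
  by apply: measureU2 => //; exact: measurableC.
apply: le_trans U2 _; rewrite low0 adde0.
have := le_trans (large_tail_le M) SM.
rewrite -(fineK (fin_num_measure Pr _ (measurableC (mA M)))) -EFinM !lee_fin.
by rewrite ler_pM2l.
Qed.
End conditional_quantile.

(** * The sample as one independent family *)
Section joint_family.
Context (R : realType) d (Omega : measurableType d) (Pr : probability Omega R).
Context dE (E : measurableType dE).
Variables (lambda : nat -> {mfun Omega >-> E})
          (xi : nat -> {mfun Omega >-> measurableTypeR R}).

(** Landscapes and multipliers must share one state space to form a single family;
    the component that is not relevant is filled with a constant. *)
Definition joint_fun (i : nat + nat) (w : Omega) : (E * measurableTypeR R)%type :=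
  match i with inl i => (lambda i w, 0) | inr i => (point, xi i w) end.

Lemma measurable_joint_fun i : measurable_fun setT (joint_fun i).
Proof.
case: i => i; apply: measurable_fun_pair => //; exact: measurable_cst.
Qed.

Definition joint (i : nat + nat) : {mfun Omega >-> (E * measurableTypeR R)%type} :=
  HB.pack (joint_fun i) (isMeasurableFun.Build _ _ _ _ (joint_fun i) (measurable_joint_fun i)).

Hypothesis lambda_indep : independent_seq Pr lambda.
Hypothesis xi_indep : independent_seq Pr xi.
Hypothesis lambda_xi_indep : independent_of Pr lambda xi.

Let get1 (s : nat + nat) : option nat := if s is inl i then Some i else None.
Let get2 (s : nat + nat) : option nat := if s is inr i then Some i else None.

Let split_perm (s : seq (nat + nat)) : uniq s ->
  perm_eq s (map inl (pmap get1 s) ++ map inr (pmap get2 s)).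
Proof.
elim: s => //= -[i|i] s IH /andP[_ us] /=.
  by rewrite perm_cons IH.
by rewrite -(cat1s (inr i) (map _ _)) perm_sym perm_catCA/= perm_cons perm_sym IH.
Qed.

Lemma joint_independent : mutually_independent Pr joint.
Proof.
move=> J A mA.
pose J1 := seq_fset tt (pmap get1 J); pose J2 := seq_fset tt (pmap get2 J).
have J1E i : (i \in J1) = (inl i \in J).
  rewrite seq_fsetE mem_pmap; apply/mapP/idP => [[[j|j] //= jJ [->]]|iJ] //.
  by exists (inl i).
have J2E i : (i \in J2) = (inr i \in J).
  rewrite seq_fsetE mem_pmap; apply/mapP/idP => [[[j|j] //= jJ [->]]|iJ] //.
  by exists (inr i).
pose A1 i := [set l : E | A (inl i) (l, 0)].
pose A2 i := [set x : measurableTypeR R | A (inr i) (point, x)].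
have mA1 i : i \in J1 -> measurable (A1 i).
  rewrite J1E => /mA mAi.
  have mp : measurable_fun setT (fun l : E => (l, 0 : measurableTypeR R)).
    by apply: measurable_fun_pair => //; exact: measurable_cst.
  by rewrite -[X in measurable X]setTI; exact: mp.
have mA2 i : i \in J2 -> measurable (A2 i).
  rewrite J2E => /mA mAi.
  have mp : measurable_fun setT (fun x : measurableTypeR R => (point : E, x)).
    by apply: measurable_fun_pair => //; exact: measurable_cst.
  by rewrite -[X in measurable X]setTI; exact: mp.
have E1 : \bigcap_(i in [set` J]) (joint i @^-1` A i) =
    \bigcap_(i in [set` J1]) (lambda i @^-1` A1 i) `&`
    \bigcap_(i in [set` J2]) (xi i @^-1` A2 i).
  apply/seteqP; split=> [w h|w [h1 h2] [i|i] /= iJ].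
  - split=> i /=; rewrite ?J1E ?J2E => iJ.
      exact: (h (inl i)).
    exact: (h (inr i)).
  - by apply: h1; rewrite /= J1E.
  - by apply: h2; rewrite /= J2E.
have s1 : <<s preimage_family lambda setT >> (\bigcap_(i in [set` J1]) (lambda i @^-1` A1 i)).
  apply: (@fin_bigcap_measurable _ (g_sigma_algebraType (preimage_family lambda setT))) => // i iJ.
  by apply: sub_sigma_algebra; exists i => //; exists (A1 i); [exact: mA1|rewrite setTI].
have s2 : <<s preimage_family xi setT >> (\bigcap_(i in [set` J2]) (xi i @^-1` A2 i)).
  apply: (@fin_bigcap_measurable _ (g_sigma_algebraType (preimage_family xi setT))) => // i iJ.
  by apply: sub_sigma_algebra; exists i => //; exists (A2 i); [exact: mA2|rewrite setTI].
rewrite E1 lambda_xi_indep// lambda_indep// xi_indep//.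
have uJ : uniq (enum_fset J) by exact: fset_uniq.
rewrite [RHS](perm_big _ (split_perm uJ)) big_cat/= !big_map.
have u1 : uniq (pmap get1 J) by apply: (pmap_uniq (g := inl)) => // -[i|i].
have u2 : uniq (pmap get2 J) by apply: (pmap_uniq (g := inr)) => // -[i|i].
congr (_ * _)%E; rewrite (perm_big _ (seq_fset_perm tt _)) undup_id//.
Qed.
End joint_family.

(** * Second moments of the empirical and bootstrap processes *)
Section landscape_sample.
Context (R : realType) (T : R) (G : set (set (landscape T))).
Context (d : measure_display) (Omega : measurableType d) (Pr : probability Omega R).
Variable lambda : nat -> {mfun Omega >-> g_sigma_algebraType G}.
Variable xi : nat -> {mfun Omega >-> measurableTypeR R}.
Hypothesis T_gt0 : 0 < T.
Hypothesis G_eval : forall t, 0 <= t <= T ->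
  measurable_fun [set: g_sigma_algebraType G]
    (fun f : landscape T => f t : measurableTypeR R).
Hypothesis same_law : forall i A, measurable A ->
  distribution Pr (lambda i) A = distribution Pr (lambda 0%N) A.
Hypothesis xi_law : forall i A, measurable A ->
  distribution Pr (xi i) A = normal_prob (0 : R) 1 A.
Hypothesis lambda_indep : independent_seq Pr lambda.
Hypothesis xi_indep : independent_seq Pr xi.
Hypothesis lambda_xi_indep : independent_of Pr lambda xi.

Let L := g_sigma_algebraType G.
Let E := (L * measurableTypeR R)%type.
Let Y : nat + nat -> {mfun Omega >-> E} := joint lambda xi.
Let mu := mean_fun Pr (lambda 0%N).
Implicit Types (s t : R) (i n : nat) (w : Omega) (y : path E (nat + nat)%type).

Definition deviation (e : E) (t : R) : R := (e.1 : landscape T) t - mu t.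

Definition multiplier (e : E) : R := e.2.

Let T0 : 0 <= T. Proof. exact: ltW. Qed.

Lemma measurable_eval t : 0 <= t <= T ->
  measurable_fun setT (fun f : L => (f : landscape T) t).
Proof. by move=> t0T mT A mA; apply: (G_eval t0T). Qed.

Lemma measurable_landscape i t : 0 <= t <= T ->
  measurable_fun setT (fun w => (lambda i w : landscape T) t).
Proof. by move=> /measurable_eval mt; apply: (measurableT_comp mt). Qed.

Let landscape_norm (l : landscape T) t : `|l t| <= T.
Proof. by have /andP[l0 lT] := landscape_bounds l t T0; rewrite ger0_norm. Qed.

Lemma integrable_landscape i t : 0 <= t <= T ->
  Pr.-integrable setT (EFin \o (fun w => (lambda i w : landscape T) t)).
Proof. by move=> t0T; apply: bounded_integrable (measurable_landscape i t0T) _ => w. Qed.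

Lemma mean_funE t : mu t = \int[Pr]_w (lambda 0%N w : landscape T) t.
Proof. by rewrite /mu /mean_fun unlock. Qed.

Lemma mean_fun_bounds t : 0 <= t <= T -> 0 <= mu t <= T.
Proof.
move=> t0T; rewrite mean_funE.
have b w := landscape_bounds (lambda 0%N w) t T0.
apply/andP; split.
  by apply: (Rintegral_ge_cst Pr (measurable_landscape 0%N t0T)) => w //; have /andP[] := b w.
by apply: (Rintegral_le_cst Pr (measurable_landscape 0%N t0T)) => w //; have /andP[] := b w.
Qed.

Lemma mean_fun_lipschitz s t : 0 <= s <= T -> 0 <= t <= T -> `|mu s - mu t| <= `|s - t|.
Proof.
move=> s0T t0T; rewrite !mean_funE -RintegralB//; try exact: integrable_landscape.
apply: Rintegral_norm_le => [|w]; last exact: landscape_lipschitz.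
by apply: measurable_funB; exact: measurable_landscape.
Qed.

Lemma same_expectation i (f : L -> R) M : measurable_fun setT f -> (forall l, `|f l| <= M) ->
  \int[Pr]_w f (lambda i w) = \int[Pr]_w f (lambda 0%N w).
Proof.
move=> mf fM.
have fi j : Pr.-integrable setT ((fun l => (f l)%:E) \o lambda j).
  by apply: (@bounded_integrable _ _ _ _ _ M) => //; apply: (measurableT_comp mf).
rewrite /Rintegral.
rewrite -(@integral_distribution _ _ _ _ _ Pr (lambda i) (fun l => (f l)%:E))//; last first.
  exact/measurable_EFinP.
rewrite -(@integral_distribution _ _ _ _ _ Pr (lambda 0%N) (fun l => (f l)%:E))//; last first.
  exact/measurable_EFinP.
by congr fine; apply: eq_measure_integral => A mA _; exact: same_law.
Qed.

Lemma measurable_deviation t : 0 <= t <= T -> measurable_fun setT (deviation^~ t).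
Proof.
move=> t0T; apply: measurable_funB; last exact: measurable_cst.
exact: (measurableT_comp (measurable_eval t0T) measurable_fst).
Qed.

Lemma deviation_norm e t : 0 <= t <= T -> `|deviation e t| <= T.
Proof.
move=> t0T; have /andP[? ?] := landscape_bounds (e.1 : landscape T) t T0.
have /andP[? ?] := mean_fun_bounds t0T.
by rewrite ler_norml /deviation; apply/andP; split; lra.
Qed.

Lemma deviation_lipschitz e s t : 0 <= s <= T -> 0 <= t <= T ->
  `|deviation e s - deviation e t| <= 2 * `|s - t|.
Proof.
move=> s0T t0T.
have -> : deviation e s - deviation e t =
    ((e.1 : landscape T) s - (e.1 : landscape T) t) - (mu s - mu t).
  by rewrite /deviation; ring.
apply: le_trans (ler_normB _ _) _; rewrite mulr2n mulrDl mul1r lerD//.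
  exact: landscape_lipschitz.
exact: mean_fun_lipschitz.
Qed.

Lemma deviation_mean0 i t : 0 <= t <= T -> \int[Pr]_w deviation (Y (inl i) w) t = 0.
Proof.
move=> t0T.
rewrite -Rintegral_sub_cst; last exact: integrable_landscape.
rewrite (same_expectation i (measurable_eval t0T) (landscape_norm^~ t)).
by rewrite -mean_funE subrr.
Qed.

Lemma deviation_variance i t : 0 <= t <= T ->
  \int[Pr]_w (deviation (Y (inl i) w) t ^+ 2) = fine ('V_Pr[fun w => lambda 0%N w t])%E.
Proof.
move=> t0T.
have mf : measurable_fun setT (fun l : L => ((l : landscape T) t - mu t) ^+ 2).
  apply: measurable_funX; apply: measurable_funB; last exact: measurable_cst.
  exact: measurable_eval.
have bf (l : L) : `|((l : landscape T) t - mu t) ^+ 2| <= T ^+ 2.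
  rewrite normrX lerXn2r ?nnegrE//.
  exact: (deviation_norm (l, 0 : measurableTypeR R)).
rewrite [LHS](same_expectation i mf bf) /variance unlock.
congr fine; rewrite [in RHS]unlock; apply: eq_integral => w _.
by rewrite expr2 /mu /mean_fun unlock.
Qed.

Lemma xi_standard i : standard_multiplier Pr (fun w => multiplier (Y (inr i) w))
  (\int[normal_prob (0 : R) 1]_x (`|x| ^+ 3)).
Proof.
have Xl := xi_law i; split.
- exact: normal_integrable1.
- exact: normal_integrable2.
- exact: normal_integrable3.
- by split; [exact: normal_mean0|exact: normal_variance1].
- by have := normal_moment3 Xl => ->.
Qed.

Lemma nonneg_integrable (f : Omega -> R) B : measurable_fun setT f -> (forall w, 0 <= f w) ->
  (\int[Pr]_w (f w)%:E <= B%:E)%E ->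
  Pr.-integrable setT (EFin \o f) /\ \int[Pr]_w f w <= B.
Proof.
move=> mf f0 fB.
have fi : Pr.-integrable setT (EFin \o f).
  apply/integrableP; split; first exact/measurable_EFinP.
  under eq_integral => w _ do rewrite /= ger0_norm//.
  by rewrite (le_lt_trans fB)// ltry.
split => //; rewrite -lee_fin; apply: le_trans fB.
by rewrite /Rintegral fineK//; exact: integrable_fin_num fi.
Qed.

Let indep : mutually_independent Pr Y.
Proof. exact: joint_independent. Qed.

Lemma measurable_multiplier_fun : measurable_fun setT multiplier.
Proof. by move=> _ A mA; apply: (@measurable_snd _ _ L (measurableTypeR R)). Qed.

Lemma data_sum_sqr (phi : E -> R) B n : measurable_fun setT phi -> (forall e, `|phi e| <= B) ->
  (forall i, \int[Pr]_w phi (Y (inl i) w) = 0) ->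
  (\int[Pr]_w ((\sum_(i < n) phi (Y (inl (i : nat)) w)) ^+ 2)%:E <= (n%:R * B ^+ 2)%:E)%E.
Proof.
move=> mphi phiB phi0.
have -> : n%:R * B ^+ 2 = \sum_(i < n) B ^+ 2 by rewrite sumr_const card_ord mulr_natl.
have mY i : measurable_fun setT (fun w => phi (Y (inl i) w)) by apply: (measurableT_comp mphi).
apply: (orthogonal_sum indep (f := fun i y => phi (y (inl i))) (k := inl) (B := fun=> B)).
- by move=> i _; exact: (measurableT_comp mphi (measurable_coordinate _)).
- move=> i j y e /andP[ji _]; rewrite update_neq//.
  by apply/eqP => -[ij]; rewrite ij ltnn in ji.
- move=> i y _ /=; have -> : (fun w => phi (update (inl i) y (Y (inl i) w) (inl i))) =
    (fun w => phi (Y (inl i) w)) by apply/funext => w; rewrite update_eq.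
  have sqB e : `|phi e ^+ 2| <= B ^+ 2.
    by rewrite normrX lerXn2r ?nnegrE// (le_trans (normr_ge0 _) (phiB e)).
  split.
  + exact: bounded_integrable (mY i) _.
  + under eq_fun do rewrite update_eq.
    apply: (@bounded_integrable _ _ _ _ _ (B ^+ 2)) => [|w]; last exact: sqB.
    by apply: measurable_funX; exact: (mY i).
  + exact: phi0.
  + under eq_Rintegral do rewrite update_eq.
    apply: (@Rintegral_le_cst _ _ _ _ _ (B ^+ 2)) => [|w|w].
      by apply: measurable_funX; exact: (mY i).
      exact: sqB.
    exact: le_trans (ler_norm _) (sqB _).
Qed.

(** The coefficients may depend on all landscapes: only independence of each
    multiplier from the rest is at work, so the empirical centring is allowed. *)
Lemma weight_sum_sqr (u : nat -> path E (nat + nat)%type -> R) B n :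
  (forall i, (i < n)%N -> measurable_fun setT (u i)) ->
  (forall i k y e, u i (update (inr k) y e) = u i y) ->
  (forall i y, (i < n)%N -> `|u i y| <= B) ->
  (\int[Pr]_w ((\sum_(i < n) xi i w * u i (sample_path Y w)) ^+ 2)%:E <=
   (n%:R * B ^+ 2)%:E)%E.
Proof.
move=> mu_ uE uB.
have -> : n%:R * B ^+ 2 = \sum_(i < n) B ^+ 2 by rewrite sumr_const card_ord mulr_natl.
apply: (orthogonal_sum indep (f := fun i y => multiplier (y (inr i)) * u i y)
  (k := inr) (B := fun=> B)).
- move=> i ni; apply: measurable_funM; last exact: mu_.
  exact: (measurableT_comp measurable_multiplier_fun (measurable_coordinate _)).
- move=> i j y e /andP[ji _]; rewrite uE update_neq//.
  by apply/eqP => -[ij]; rewrite ij ltnn in ji.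
- move=> i y ni /=.
  have -> : (fun w => multiplier (update (inr i) y (Y (inr i) w) (inr i)) *
      u i (update (inr i) y (Y (inr i) w))) = (fun w => u i y * multiplier (Y (inr i) w)).
    by apply/funext => w; rewrite update_eq uE mulrC.
  have -> : (fun w => (multiplier (update (inr i) y (Y (inr i) w) (inr i)) *
      u i (update (inr i) y (Y (inr i) w))) ^+ 2) =
      (fun w => u i y ^+ 2 * multiplier (Y (inr i) w) ^+ 2).
    by apply/funext => w; rewrite update_eq uE mulrC exprMn.
  have [i1 i2 _ [e1 e2] _] := xi_standard i.
  split.
  + exact: (integrableZl measurableT _ i1).
  + exact: (integrableZl measurableT _ i2).
  + by rewrite RintegralZl// e1 mulr0.
  + rewrite RintegralZl// e2 mulr1 -[leLHS]real_normK ?num_real//.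
    by rewrite lerXn2r ?nnegrE ?uB// (le_trans (normr_ge0 _) (uB i y ni)).
Qed.

(** The quadratic bound of chain_sqr_le: it dominates F j ^ 2 for all j <= n. *)
Definition energy n (F : nat -> R) : R :=
  2 * F 0%N ^+ 2 + 2 * n%:R * \sum_(k < n) (F k.+1 - F k) ^+ 2.

Lemma energy_ge0 n F : 0 <= energy n F.
Proof.
have S0 : 0 <= \sum_(k < n) (F k.+1 - F k) ^+ 2.
  by rewrite sumr_ge0// => k _; exact: sqr_ge0.
have := mulr_ge0 (ler0n R n) S0; have := sqr_ge0 (F 0%N).
by rewrite /energy -[2 * n%:R * _]mulrA; lra.
Qed.

Lemma energy_integral n (F : nat -> Omega -> R) A B :
  (forall k, (k <= n)%N -> measurable_fun setT (F k)) ->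
  (\int[Pr]_w ((F 0%N w) ^+ 2)%:E <= A%:E)%E ->
  (forall k, (k < n)%N -> (\int[Pr]_w ((F k.+1 w - F k w) ^+ 2)%:E <= B%:E)%E) ->
  Pr.-integrable setT (EFin \o (fun w => energy n (F^~ w))) /\
  \int[Pr]_w energy n (F^~ w) <= 2 * A + 2 * n%:R ^+ 2 * B.
Proof.
move=> mF FA FB.
have [i0 e0] : Pr.-integrable setT (EFin \o (fun w => F 0%N w ^+ 2)) /\
    \int[Pr]_w (F 0%N w ^+ 2) <= A.
  apply: nonneg_integrable => // [|w]; last exact: sqr_ge0.
  by apply: measurable_funX; exact: mF.
have H (k : 'I_n) : Pr.-integrable setT (EFin \o (fun w => (F k.+1 w - F k w) ^+ 2)) /\
    \int[Pr]_w ((F k.+1 w - F k w) ^+ 2) <= B.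
  apply: nonneg_integrable => [|w|]; [|exact: sqr_ge0|exact: FB].
  by apply: measurable_funX; apply: measurable_funB; apply: mF => //; exact: ltnW.
have iS : Pr.-integrable setT (EFin \o (fun w => \sum_(k < n) (F k.+1 w - F k w) ^+ 2)).
  by apply: integrable_sum_EFin => k; have [] := H k.
have i1 : Pr.-integrable setT (EFin \o (fun w => 2 * F 0%N w ^+ 2)).
  exact: (integrableZl measurableT _ i0).
have i2 : Pr.-integrable setT (EFin \o (fun w =>
    2 * n%:R * \sum_(k < n) (F k.+1 w - F k w) ^+ 2)).
  exact: (integrableZl measurableT _ iS).
split; first exact: (integrableD measurableT i1 i2).
rewrite /energy RintegralD// !RintegralZl// Rintegral_sum => [|k]; last by have [] := H k.
have e1 : \sum_(k < n) \int[Pr]_w ((F k.+1 w - F k w) ^+ 2) <= n%:R * B.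
  have -> : n%:R * B = \sum_(k < n) B by rewrite sumr_const card_ord mulr_natl.
  by apply: ler_sum => k _; have [] := H k.
apply: lerD; first by rewrite ler_wpM2l.
by rewrite expr2 -!mulrA ler_wpM2l// ler_wpM2l.
Qed.

Lemma emp_mean_lipschitz (l : nat -> landscape T) n s t : (0 < n)%N ->
  `|emp_mean l n s - emp_mean l n t| <= `|s - t|.
Proof.
move=> n0; rewrite /emp_mean -mulrBr -sumrB normrM ger0_norm ?invr_ge0//.
rewrite mulrC ler_pdivrMr ?ltr0n//.
apply: le_trans (ler_norm_sum _ _ _) _.
have -> : `|s - t| * n%:R = \sum_(i < n) `|s - t| by rewrite sumr_const card_ord mulr_natr.
by apply: ler_sum => i _; exact: landscape_lipschitz.
Qed.

Lemma emp_mean_bounds (l : nat -> landscape T) n t : (0 < n)%N -> 0 <= emp_mean l n t <= T.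
Proof.
move=> n0; rewrite /emp_mean; apply/andP; split.
  rewrite mulr_ge0 ?invr_ge0// sumr_ge0// => i _.
  by have /andP[] := landscape_bounds (l i) t T0.
rewrite mulrC ler_pdivrMr ?ltr0n//.
have -> : T * n%:R = \sum_(i < n) T by rewrite sumr_const card_ord mulr_natr.
by apply: ler_sum => i _; have /andP[] := landscape_bounds (l i) t T0.
Qed.

Lemma centered_lipschitz (l : nat -> landscape T) n i s t : (0 < n)%N ->
  `|(l i s - emp_mean l n s) - (l i t - emp_mean l n t)| <= 2 * `|s - t|.
Proof.
move=> n0.
have -> : (l i s - emp_mean l n s) - (l i t - emp_mean l n t) =
  (l i s - l i t) - (emp_mean l n s - emp_mean l n t) by ring.
apply: le_trans (ler_normB _ _) _; rewrite mulr2n mulrDl mul1r lerD ?emp_mean_lipschitz//.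
exact: landscape_lipschitz.
Qed.

Section on_grid.
Variables (lo hi : R).
Hypothesis lo0 : 0 <= lo.
Hypothesis lohi : lo <= hi.
Hypothesis hiT : hi <= T.

Lemma grid_in n j : (j <= n)%N -> 0 <= grid lo hi n j <= T.
Proof.
move=> jn; have /andP[a b] := grid_bounds lohi jn.
by rewrite (le_trans lo0 a) (le_trans b hiT).
Qed.

Lemma grid_dist n k : (0 < n)%N ->
  2 * `|grid lo hi n k.+1 - grid lo hi n k| <= 2 * T / n%:R.
Proof.
move=> n0; have h : hi - lo <= T by rewrite lerBlDr (le_trans hiT)// lerDl.
rewrite grid_step -mulrA ler_wpM2l// ger0_norm ?divr_ge0 ?subr_ge0//.
by rewrite ler_wpM2r// invr_ge0.
Qed.

Definition deviation_sum n w t : R := \sum_(i < n) deviation (Y (inl (i : nat)) w) t.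

(** The increments along the grid are sums of n centred terms of size O(T/n), so
    n times the sum of their second moments is O(T^2 n), as for the first
    value. *)
Lemma deviation_energy n : (0 < n)%N ->
  Pr.-integrable setT (EFin \o (fun w => energy n (fun j => deviation_sum n w (grid lo hi n j)))) /\
  \int[Pr]_w energy n (fun j => deviation_sum n w (grid lo hi n j)) <= 10 * n%:R * T ^+ 2.
Proof.
move=> n0; have nR : n%:R != 0 :> R by rewrite pnatr_eq0 -lt0n.
have -> : 10 * n%:R * T ^+ 2 =
    2 * (n%:R * T ^+ 2) + 2 * n%:R ^+ 2 * (n%:R * (2 * T / n%:R) ^+ 2) by field.
have mY k : (k <= n)%N -> forall i, measurable_fun setT
    (fun w => deviation (Y (inl i) w) (grid lo hi n k)).
  by move=> kn i; apply: (measurableT_comp (measurable_deviation (grid_in kn))).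
apply: (energy_integral (F := fun j w => deviation_sum n w (grid lo hi n j))).
- by move=> k kn; apply: measurable_sum => i; exact: mY.
- apply: (@data_sum_sqr (fun e => deviation e (grid lo hi n 0%N)) T n) => [|e|i].
  + by apply: measurable_deviation; apply: grid_in.
  + by apply: deviation_norm; apply: grid_in.
  + by apply: deviation_mean0; apply: grid_in.
- move=> k kn; under eq_integral do rewrite /deviation_sum -sumrB.
  have g1 := grid_in kn; have g0 := grid_in (ltnW kn).
  apply: (@data_sum_sqr (fun e => deviation e (grid lo hi n k.+1) - deviation e (grid lo hi n k))
    (2 * T / n%:R) n) => [|e|i].
  + by apply: measurable_funB; exact: measurable_deviation.
  + exact: le_trans (deviation_lipschitz _ g1 g0) (grid_dist _ n0).
  + have iY t : 0 <= t <= T -> Pr.-integrable setT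
        (EFin \o (fun w => deviation (Y (inl i) w) t)).
      move=> t0T; apply: (@bounded_integrable _ _ _ _ _ T) => [|w].
        by apply: (measurableT_comp (measurable_deviation t0T)).
      exact: deviation_norm.
    by rewrite RintegralB ?iY// !deviation_mean0 ?subrr.
Qed.

Let centered n i t y : R := ((y (inl i)).1 : landscape T) t -
  emp_mean (fun k => (y (inl k)).1 : landscape T) n t.

Definition bootstrap_sum n w t : R := \sum_(i < n) xi i w *
  (lambda i w t - emp_mean (fun k => lambda k w : landscape T) n t).

Let measurable_centered n i t : 0 <= t <= T -> measurable_fun setT (centered n i t).
Proof.
move=> t0T.
have m1 k : measurable_fun setT (fun y : path E (nat + nat)%type => ((y (inl k)).1 : landscape T) t).
  apply: (measurableT_comp (measurable_eval t0T)).
  exact: (measurableT_comp measurable_fst (measurable_coordinate _)).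
apply: measurable_funB; first exact: m1.
apply: measurable_funM; first exact: measurable_cst.
by apply: measurable_sum => k; exact: m1.
Qed.

Lemma bootstrap_energy n : (0 < n)%N ->
  Pr.-integrable setT (EFin \o (fun w => energy n (fun j => bootstrap_sum n w (grid lo hi n j)))) /\
  \int[Pr]_w energy n (fun j => bootstrap_sum n w (grid lo hi n j)) <= 10 * n%:R * T ^+ 2.
Proof.
move=> n0; have nR : n%:R != 0 :> R by rewrite pnatr_eq0 -lt0n.
have -> : 10 * n%:R * T ^+ 2 =
    2 * (n%:R * T ^+ 2) + 2 * n%:R ^+ 2 * (n%:R * (2 * T / n%:R) ^+ 2) by field.
have mxi i : measurable_fun setT (xi i : Omega -> R) by exact: (@measurable_funP _ _ _ _ _ (xi i)).
apply: (energy_integral (F := fun j w => bootstrap_sum n w (grid lo hi n j))).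
- move=> k kn; apply: measurable_sum => i; apply: measurable_funM => //.
  exact: (measurableT_comp (measurable_centered n i (grid_in kn)) (measurable_sample_path Y)).
- apply: (@weight_sum_sqr (fun i y => centered n i (grid lo hi n 0%N) y) T n) => [i _|//|i y _].
  + by apply: measurable_centered; apply: grid_in.
  + have /andP[? ?] := emp_mean_bounds (fun k => (y (inl k)).1 : landscape T) (grid lo hi n 0%N) n0.
    have /andP[? ?] := landscape_bounds ((y (inl i)).1 : landscape T) (grid lo hi n 0%N) T0.
    by rewrite ler_norml /centered; apply/andP; split; lra.
- move=> k kn.
  have -> : (fun w => ((bootstrap_sum n w (grid lo hi n k.+1) -
      bootstrap_sum n w (grid lo hi n k)) ^+ 2)%:E) =
    (fun w => ((\sum_(i < n) xi i w * (centered n i (grid lo hi n k.+1) (sample_path Y w) -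
       centered n i (grid lo hi n k) (sample_path Y w))) ^+ 2)%:E).
    apply/funext => w; rewrite /bootstrap_sum -sumrB; congr ((_ ^+ 2)%:E).
    by apply: eq_bigr => i _; rewrite [RHS]mulrBr.
  have g1 := grid_in kn; have g0 := grid_in (ltnW kn).
  apply: (@weight_sum_sqr (fun i y => centered n i (grid lo hi n k.+1) y -
     centered n i (grid lo hi n k) y) (2 * T / n%:R) n) => [i _|//|i y _].
  + by apply: measurable_funB; exact: measurable_centered.
  + apply: le_trans (grid_dist k n0).
    exact: (centered_lipschitz (fun k => (y (inl k)).1 : landscape T)).
Qed.
End on_grid.

Lemma xi_sum_sqr n : (\int[Pr]_w ((\sum_(i < n) xi i w) ^+ 2)%:E <= n%:R%:E)%E.
Proof.
have := @weight_sum_sqr (fun _ _ => 1) 1 n.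
rewrite expr1n mulr1; under eq_integral do under eq_bigr do rewrite mulr1.
by apply => // *; rewrite ?normr1//; exact: measurable_cst.
Qed.

Section bootstrap_supremum.
Variable n : nat.
Hypothesis n0 : (0 < n)%N.

Let rn : R := Num.sqrt n%:R.

Let rn_gt0 : 0 < rn. Proof. by rewrite sqrtr_gt0 ltr0n. Qed.

Let rn2 : rn ^+ 2 = n%:R. Proof. by rewrite sqr_sqrtr. Qed.

Let l w : nat -> landscape T := fun i => lambda i w.

Let x w : nat -> R := fun i => xi i w.

Let N1 w : R := \sum_(i < n) `|xi i w|.

Let sup_w w := bootstrap_sup (l w) (x w) n.

Let mxi i : measurable_fun setT (xi i : Omega -> R).
Proof. exact: (@measurable_funP _ _ _ _ _ (xi i)). Qed.

Lemma measurable_bootstrap_sum t : 0 <= t <= T ->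
  measurable_fun setT (fun w => bootstrap_sum n w t).
Proof.
move=> t0T; apply: measurable_sum => i; apply: measurable_funM => //.
apply: measurable_funB; first exact: measurable_landscape.
apply: measurable_funM; first exact: measurable_cst.
by apply: measurable_sum => k; exact: measurable_landscape.
Qed.

Let processE w t : bootstrap_process (l w) (x w) n t = rn^-1 * bootstrap_sum n w t.
Proof. by []. Qed.

Let sum_norm_le w (a : nat -> R) M : 0 <= M -> (forall i, `|a i| <= M) ->
  `|rn^-1 * \sum_(i < n) xi i w * a i| <= rn^-1 * (N1 w * M).
Proof.
move=> M0 aM; rewrite normrM ger0_norm ?invr_ge0 ?(ltW rn_gt0)//.
apply: ler_wpM2l; first by rewrite invr_ge0 ltW.
apply: le_trans (ler_norm_sum _ _ _) _; rewrite mulr_suml.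
by apply: ler_sum => i _; rewrite normrM ler_wpM2l.
Qed.

Lemma bootstrap_process_lipschitz w s t :
  `|bootstrap_process (l w) (x w) n s - bootstrap_process (l w) (x w) n t| <=
  rn^-1 * (N1 w * (2 * `|s - t|)).
Proof.
rewrite !processE -mulrBr /bootstrap_sum -sumrB; under eq_bigr do rewrite -mulrBr.
apply: (@sum_norm_le w (fun i => (l w i s - emp_mean (l w) n s) -
  (l w i t - emp_mean (l w) n t))) => [|i]; first exact: mulr_ge0.
exact: centered_lipschitz.
Qed.

Let process_bound w t : `|bootstrap_process (l w) (x w) n t| <= rn^-1 * (N1 w * T).
Proof.
apply: (@sum_norm_le w (fun i => l w i t - emp_mean (l w) n t)) => // i.
have /andP[? ?] := emp_mean_bounds (l w) t n0.
have /andP[? ?] := landscape_bounds (l w i) t T0.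
by rewrite ler_norml; apply/andP; split; lra.
Qed.

Lemma bootstrap_sup_ge w t : 0 <= t <= T -> `|bootstrap_process (l w) (x w) n t| <= sup_w w.
Proof.
move=> t0T; apply: ub_le_sup; last by exists t => //=; rewrite in_itv.
by exists (rn^-1 * (N1 w * T)) => _ [s _ <-]; exact: process_bound.
Qed.

Lemma bootstrap_sup_ge0 w : 0 <= sup_w w.
Proof. by apply: le_trans (normr_ge0 _) (bootstrap_sup_ge w (t := 0) _); rewrite lexx. Qed.

Lemma bootstrap_sup_gt w z :
  z < sup_w w <-> exists2 t, 0 <= t <= T & 0 < `|bootstrap_process (l w) (x w) n t| - z.
Proof.
split=> [zs|[t t0T]]; last first.
  by rewrite subr_gt0 => zt; exact: lt_le_trans zt (bootstrap_sup_ge w t0T).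
have [|_ [t /= t0T <-] zt] := sup_gt _ zs.
  by exists `|bootstrap_process (l w) (x w) n 0|; exists 0 => //=; rewrite in_itv/= lexx.
by exists t; rewrite ?subr_gt0//; move: t0T; rewrite in_itv.
Qed.

Lemma measurable_bootstrap_sup z : measurable [set w | z < sup_w w].
Proof.
rewrite (_ : [set w | _] =
    [set w | exists2 t, 0 <= t <= T & 0 < `|bootstrap_process (l w) (x w) n t| - z]).
  apply: (@measurable_exists_itv _ _ _ _ _ (fun t w => `|bootstrap_process (l w) (x w) n t| - z)
    (fun w => rn^-1 * (N1 w * 2))) => // [t t0T|w s t _ _].
    apply: measurable_funB; last exact: measurable_cst.
    apply: measurableT_comp => //; apply: measurable_funM; first exact: measurable_cst.
    exact: measurable_bootstrap_sum.
  rewrite opprB addrA subrK -!mulrA; apply: le_trans (bootstrap_process_lipschitz w s t).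
  exact: lerB_dist.
by apply/seteqP; split => w /bootstrap_sup_gt.
Qed.

Let H w : R := 2 / n%:R * energy n (fun j => bootstrap_sum n w (grid 0 T n j)) +
  8 * T ^+ 2 / n%:R ^+ 2 * \sum_(i < n) xi i w ^+ 2.

Let sup_sqr_le w : sup_w w ^+ 2 <= H w.
Proof.
have nR : 0 < n%:R :> R by rewrite ltr0n.
rewrite /H; set Q := energy _ _; set S2 := \sum_(i < n) xi i w ^+ 2.
(* oscillation of the process between neighbouring grid points *)
pose eps := rn^-1 * (N1 w * (2 * (T / n%:R))).
have jQ (j : 'I_n.+1) : bootstrap_process (l w) (x w) n (grid 0 T n j) ^+ 2 <= Q / n%:R.
  rewrite processE exprMn exprVn rn2 mulrC ler_wpM2r ?invr_ge0//.
  by apply: (@chain_sqr_le _ n (fun j => bootstrap_sum n w (grid 0 T n j))); rewrite -ltnS.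
have e2 : eps ^+ 2 <= 4 * T ^+ 2 / n%:R ^+ 2 * S2.
  have -> : eps ^+ 2 = 4 * T ^+ 2 / n%:R ^+ 3 * N1 w ^+ 2.
    by rewrite /eps !exprMn exprVn rn2; field; rewrite gt_eqF.
  have -> : 4 * T ^+ 2 / n%:R ^+ 2 * S2 = 4 * T ^+ 2 / n%:R ^+ 3 * (n%:R * S2).
    by field; rewrite gt_eqF.
  apply: ler_wpM2l; first by rewrite divr_ge0 ?mulr_ge0 ?exprn_ge0.
  have := sqr_sum_le (fun i : 'I_n => `|xi i w|); rewrite /S2.
  by under [X in _ <= _ * X -> _]eq_bigr do rewrite real_normK ?num_real//.
have -> : 2 / n%:R * Q + 8 * T ^+ 2 / n%:R ^+ 2 * S2 =
    2 * (Q / n%:R) + 2 * (4 * T ^+ 2 / n%:R ^+ 2 * S2).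
  by field; rewrite gt_eqF.
have Q0 : 0 <= Q / n%:R by apply: le_trans (jQ ord0); exact: sqr_ge0.
have S20 : 0 <= 4 * T ^+ 2 / n%:R ^+ 2 * S2 by apply: le_trans e2; exact: sqr_ge0.
have sH0 : 0 <= 2 * (Q / n%:R) + 2 * (4 * T ^+ 2 / n%:R ^+ 2 * S2).
  by rewrite addr_ge0// mulr_ge0.
rewrite -(@sqr_sqrtr _ (2 * (Q / n%:R) + _))// lerXn2r ?nnegrE ?sqrtr_ge0//.
  exact: bootstrap_sup_ge0.
apply: ge_sup; first by exists `|bootstrap_process (l w) (x w) n 0|; exists 0 => //=; rewrite in_itv/= lexx.
move=> _ [t /= t0T <-]; move: t0T; rewrite in_itv/= => t0T.
have [j tj] := grid_near n0 t0T.
rewrite -[leLHS]sqrtr_sqr; apply: ler_wsqrtr.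
have := bootstrap_process_lipschitz w t (grid 0 T n j).
have := jQ j; move: (bootstrap_process _ _ _ t) (bootstrap_process _ _ _ _) => a b bQ ab.
have {}ab : `|a - b| <= eps.
  apply: le_trans ab _; apply: ler_wpM2l; first by rewrite invr_ge0 ltW.
  apply: ler_wpM2l; first exact: sumr_ge0.
  by apply: ler_wpM2l => //; rewrite subr0 in tj.
have : (a - b) ^+ 2 <= eps ^+ 2.
  by rewrite -real_normK ?num_real// lerXn2r ?nnegrE// (le_trans _ ab).
move: bQ e2 => + + h; move: (Q / _) (_ * S2) => q s.
by have := sqr_ge0 (a - 2 * b); nra.
Qed.

Let H_integral : Pr.-integrable setT (EFin \o H) /\ \int[Pr]_w H w <= 28 * T ^+ 2.
Proof.
have nR : 0 < n%:R :> R by rewrite ltr0n.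
have [iQ eQ] := bootstrap_energy (lexx 0) T0 (lexx T) n0.
have iX i : Pr.-integrable setT (EFin \o (fun w => xi i w ^+ 2)).
  by have [_ h _ _ _] := xi_standard i; exact: h.
have iS : Pr.-integrable setT (EFin \o (fun w => \sum_(i < n) xi i w ^+ 2)).
  by apply: (@integrable_sum_EFin _ _ _ Pr _ _ (fun (i : 'I_n) w => xi i w ^+ 2)) => i; exact: iX.
have eS : \int[Pr]_w (\sum_(i < n) xi i w ^+ 2) = n%:R.
  rewrite (@Rintegral_sum _ _ _ Pr _ _ (fun (i : 'I_n) w => xi i w ^+ 2)); last by move=> i; exact: iX.
  rewrite -[n in RHS]card_ord -sumr_const; apply: eq_bigr => i _.
  by have [_ _ _ [_ h] _] := xi_standard i; exact: h.
pose a : R := 2 / n%:R; pose b : R := 8 * T ^+ 2 / n%:R ^+ 2.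
have iaQ := integrableZl measurableT a iQ; have ibS := integrableZl measurableT b iS.
split; first exact: (integrableD measurableT iaQ ibS).
rewrite /H RintegralD// RintegralZl// RintegralZl// eS.
have -> : 28 * T ^+ 2 = a * (10 * n%:R * T ^+ 2) + 8 * T ^+ 2.
  by rewrite /a; field; rewrite gt_eqF.
apply: lerD; first by apply: ler_wpM2l => //; rewrite divr_ge0// ltW.
have -> : 8 * T ^+ 2 / n%:R ^+ 2 * n%:R = 8 * T ^+ 2 * n%:R^-1 by field; rewrite gt_eqF.
apply: ler_piMr; first by rewrite mulr_ge0// sqr_ge0.
by rewrite invf_le1// ler1n.
Qed.

(** Chebyshev with the grid bound; between grid points the process moves by at
    most its random Lipschitz constant over n, whose second moment is O(1/n)
    after scaling. *)
Lemma bootstrap_sup_tail M : 0 < M ->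
  (Pr [set w | (M < sup_w w)%R] <= (28 * T ^+ 2 / M ^+ 2)%:E)%E.
Proof.
move=> M0; have [iH eH] := H_integral; set D := [set w | _].
have mD : measurable D by exact: measurable_bootstrap_sup.
have H0 w : 0 <= H w by apply: le_trans (sup_sqr_le w); exact: sqr_ge0.
have M2 : 0 < M ^+ 2 by exact: exprn_gt0.
rewrite -(fineK (fin_num_measure Pr D mD)) lee_fin ler_pdivlMr// mulrC.
apply: le_trans eH; rewrite -lee_fin fineK; last exact: integrable_fin_num iH.
rewrite EFinM fineK; last exact: fin_num_measure.
rewrite -(integral_cst Pr mD).
have mH : measurable_fun setT (fun w => (H w)%:E) by exact: measurable_int iH.
apply: (@le_trans _ _ (\int[Pr]_(w in D) (H w)%:E)%E).
  apply: ge0_le_integral => //.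
  - by move=> w _; rewrite lee_fin ltW.
  - by apply: measurable_funTS.
  move=> w /= Dw; rewrite lee_fin; apply: le_trans (sup_sqr_le w).
  by rewrite lerXn2r ?nnegrE ?(ltW M0) ?bootstrap_sup_ge0// ltW.
by apply: ge0_subset_integral => // w _; rewrite lee_fin.
Qed.
End bootstrap_supremum.

(** * Coverage of the band *)
Section coverage.
Variables (lo hi c : R).
Hypothesis lo0 : 0 <= lo.
Hypothesis lohi : lo <= hi.
Hypothesis hiT : hi <= T.
Hypothesis c_gt0 : 0 < c.
Hypothesis c_variance : forall t, lo <= t <= hi ->
  c ^+ 2 <= fine ('V_Pr[fun w => lambda 0%N w t])%E.

Let index n := ('I_n.+1 * bool)%type.

(** One summand of the smoothed process: the sign r.2 turns the maximum over r
    into a maximum of absolute values, and theta = beta / sqrt n. *)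
Definition feature n (theta : R) (e : E) (r : index n) : R :=
  theta * ((-1) ^+ r.2 * deviation e (grid lo hi n r.1)).

Let in_range n (r : index n) : lo <= grid lo hi n r.1 <= hi.
Proof. by apply: grid_bounds => //; rewrite -ltnS. Qed.

Let in_domain n (r : index n) : 0 <= grid lo hi n r.1 <= T.
Proof. by apply: grid_in => //; rewrite -ltnS. Qed.

Lemma measurable_feature n theta (r : index n) : measurable_fun setT (feature theta ^~ r).
Proof.
apply: measurable_funM; first exact: measurable_cst.
by apply: measurable_funM; [exact: measurable_cst|exact: measurable_deviation].
Qed.

Lemma feature_norm n theta e (r : index n) : 0 <= theta -> `|feature theta e r| <= theta * T.
Proof.
move=> th0; rewrite normrM ger0_norm// ler_wpM2l// normrM normrX normrN1 expr1n mul1r.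
exact: deviation_norm.
Qed.

Let integrable_deviation i t : 0 <= t <= T ->
  Pr.-integrable setT (EFin \o (fun w => deviation (Y (inl i) w) t)).
Proof.
move=> t0T; apply: (@bounded_integrable _ _ _ _ _ T) => [|w]; last exact: deviation_norm.
by apply: (measurableT_comp (measurable_deviation t0T)).
Qed.

Lemma feature_mean0 n theta i (r : index n) : \int[Pr]_w feature theta (Y (inl i) w) r = 0.
Proof.
under eq_Rintegral do rewrite /feature mulrA.
rewrite RintegralZl//; last exact: integrable_deviation.
by rewrite deviation_mean0// mulr0.
Qed.

Lemma feature_variance n theta i (r : index n) :
  (theta * c) ^+ 2 <= \int[Pr]_w (feature theta (Y (inl i) w) r ^+ 2).
Proof.
have -> : (fun w => feature theta (Y (inl i) w) r ^+ 2) =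
    (fun w => theta ^+ 2 * deviation (Y (inl i) w) (grid lo hi n r.1) ^+ 2).
  apply/funext => w; rewrite /feature !exprMn -exprM mulnC exprM sqrrN expr1n expr1n.
  by rewrite mul1r.
rewrite RintegralZl//; last first.
  apply: (@bounded_integrable _ _ _ _ _ (T ^+ 2)) => [|w].
    by apply: measurable_funX; apply: (measurableT_comp (measurable_deviation (in_domain r))).
  by rewrite normrX lerXn2r ?nnegrE// deviation_norm.
by rewrite deviation_variance// exprMn ler_wpM2l ?sqr_ge0// c_variance.
Qed.

Let S n theta w : index n -> R := hybrid (@feature n theta) multiplier 0 n (sample_path Y w).

Let V n theta w : index n -> R := hybrid (@feature n theta) multiplier n n (sample_path Y w).

Lemma hybrid0_deviation n theta w (r : index n) :
  S theta w r = theta * ((-1) ^+ r.2 * deviation_sum n w (grid lo hi n r.1)).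
Proof.
rewrite /S /hybrid /deviation_sum !mulr_sumr; apply: eq_bigr => i _.
by rewrite ltn0 mul1r.
Qed.

Lemma measurable_sample_hybrid n theta k (r : index n) : measurable_fun setT
  (fun w => hybrid (@feature n theta) multiplier k n (sample_path Y w) r).
Proof.
exact: (measurableT_comp (measurable_hybrid (measurable_feature theta)
  measurable_multiplier_fun k n r) (measurable_sample_path Y)).
Qed.

Section scale.
Variables (n : nat) (beta : R).
Hypothesis n0 : (0 < n)%N.
Hypothesis beta1 : 1 <= beta.

Let rn : R := Num.sqrt n%:R.
Let theta : R := beta / rn.

Let rn2 : rn ^+ 2 = n%:R. Proof. by rewrite sqr_sqrtr. Qed.

Let rn_gt0 : 0 < rn. Proof. by rewrite sqrtr_gt0 ltr0n. Qed.

Let beta0 : 0 < beta. Proof. exact: lt_le_trans beta1. Qed.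

Let theta0 : 0 < theta. Proof. exact: divr_gt0. Qed.

Let Sn w : index n -> R := S theta w.

Let Q w := energy n (fun j => deviation_sum n w (grid lo hi n j)).

Let deviation_Q w (r : index n) : deviation_sum n w (grid lo hi n r.1) ^+ 2 <= Q w.
Proof.
apply: (@chain_sqr_le _ n (fun j => deviation_sum n w (grid lo hi n j))).
by rewrite -ltnS.
Qed.

Let S_bound w (r : index n) : `|Sn w r| <= theta * ((Q w / rn + rn) / 2).
Proof.
rewrite /Sn hybrid0_deviation normrM ger0_norm ?(ltW theta0)// ler_wpM2l ?(ltW theta0)//.
rewrite normrM normrX normrN1 expr1n mul1r.
have := deviation_Q w r; rewrite -real_normK ?num_real//.
move: (normr_ge0 (deviation_sum n w (grid lo hi n r.1))); move: `|_| => D D0 DQ.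
rewrite ler_pdivlMr// -(ler_pM2r rn_gt0) mulrDl divfK ?gt_eqF//.
by have := sqr_ge0 (D - rn); nra.
Qed.

Definition anti_const : R := ((10 * T ^+ 2 + 1) / 2 + 436 * T ^+ 3) / c ^+ 2.

(** The anticoncentration inequality has beta^2 c^2 on the left and, on the
    right, E soft_mean(S; S) <= beta (1 + E (sup |S|)^2) / 2 and an error
    beta^3 / sqrt n, which is O(beta) as long as beta^2 <= sqrt n. *)
Lemma anticoncentration_rate zeta : beta ^+ 2 <= rn ->
  \int[Pr]_w (soft_step zeta (Sn w) * (1 - soft_step zeta (Sn w))) <= anti_const / beta.
Proof.
move=> br.
have [iQ eQ] := deviation_energy lo0 lohi hiT n0.
have c2 : 0 < c ^+ 2 by rewrite exprn_gt0.
have tT0 : 0 <= theta * T by rewrite mulr_ge0// ltW.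
have fb e (r : index n) : `|feature theta e r| <= theta * T by exact: feature_norm (ltW _).
have varb : 0 <= (theta * c) ^+ 2 <= (theta * T) ^+ 2.
  rewrite sqr_ge0/=; apply: le_trans (feature_variance theta 0%N (ord0, true)) _.
  apply: (@Rintegral_le_cst _ _ _ _ _ ((theta * T) ^+ 2)) => [|w|w].
  - apply: measurable_funX; apply: (measurableT_comp (measurable_feature _ _)) => //.
  - by rewrite normrX lerXn2r ?nnegrE.
  - by rewrite -[leLHS]real_normK ?num_real// lerXn2r ?nnegrE.
have := anticoncentration indep (measurable_feature theta) measurable_multiplier_fun
  tT0 fb
  (feature_mean0 theta) zeta n varb (feature_variance theta).
rewrite -/Sn; set k := \int[Pr]_w (_ * _); set m := \int[Pr]_w soft_mean _ _ _ => H.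
have m_le : m <= beta * ((10 * T ^+ 2 + 1) / 2).
  have iQ' : Pr.-integrable setT (EFin \o (fun w => theta / 2 / rn * Q w)).
    exact: (integrableZl measurableT _ iQ).
  have icst' : Pr.-integrable setT (EFin \o (fun _ : Omega => theta / 2 * rn)).
    exact: integrable_constant.
  apply: (@le_trans _ _ (\int[Pr]_w (theta / 2 / rn * Q w + theta / 2 * rn))).
    apply: le_Rintegral => //.
    - apply: (@bounded_integrable _ _ _ _ _ (n%:R * (theta * T))) => [|w].
        apply: (@measurable_soft_mean _ _ _ _ zeta (Sn) (Sn)) => r;
          exact: measurable_sample_hybrid.
      apply: soft_mean_norm => [r|]; last exact: mulr_ge0.
      apply: le_trans (ler_norm_sum _ _ _) _.
      have -> : n%:R * (theta * T) = \sum_(i < n) (theta * T) by rewrite sumr_const card_ord mulr_natl.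
      by apply: ler_sum => i _; rewrite ltn0 mul1r.
    - exact: (integrableD measurableT iQ' icst').
    - move=> w _; apply: le_trans (ler_norm _) _.
      have -> : theta / 2 / rn * Q w + theta / 2 * rn = theta * ((Q w / rn + rn) / 2).
        by field; rewrite gt_eqF.
      apply: soft_mean_norm => [r|]; first exact: S_bound.
      by rewrite mulr_ge0 ?divr_ge0 ?addr_ge0 ?divr_ge0 ?energy_ge0 ?ltW.
  rewrite RintegralD// RintegralZl// Rintegral_probability_cst.
  have -> : beta * ((10 * T ^+ 2 + 1) / 2) =
      theta / 2 / rn * (10 * n%:R * T ^+ 2) + theta / 2 * rn.
    by rewrite /theta -rn2; field; rewrite gt_eqF.
  by rewrite lerD2r ler_wpM2l// !divr_ge0// ltW.
have b3 : n%:R * (436 * (theta * T) ^+ 3) <= beta * (436 * T ^+ 3).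
  have -> : n%:R * (436 * (theta * T) ^+ 3) = beta * (436 * T ^+ 3) * (beta ^+ 2 / rn).
    by rewrite /theta -rn2; field; rewrite gt_eqF.
  apply: ler_piMr; last by rewrite ler_pdivrMr// mul1r.
  by apply: mulr_ge0; [exact: ltW|apply: mulr_ge0; [exact: ler0n|exact: exprn_ge0]].
have e2 : n%:R * (theta * c) ^+ 2 = beta ^+ 2 * c ^+ 2.
  by rewrite /theta -rn2; field; rewrite gt_eqF.
rewrite e2 in H.
rewrite /anti_const ler_pdivlMr// ler_pdivlMr//.
rewrite -(ler_pM2l beta0).
have -> : beta * (k * beta * c ^+ 2) = beta ^+ 2 * c ^+ 2 * k by ring.
apply: le_trans H _; rewrite mulrDr; exact: lerD.
Qed.

Let mean_step zeta : R := \int[Pr]_w soft_step zeta (Sn w).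

Let measurable_step (F : Omega -> index n -> R) zeta :
  (forall r, measurable_fun setT (F ^~ r)) -> measurable_fun setT (fun w => soft_step zeta (F w)).
Proof. exact: (@measurable_soft_step _ _ _ _ zeta F). Qed.

Let integrable_step (F : Omega -> index n -> R) zeta :
  (forall r, measurable_fun setT (F ^~ r)) ->
  Pr.-integrable setT (EFin \o (fun w => soft_step zeta (F w))).
Proof.
by move=> mF; apply: bounded_integrable (measurable_step zeta mF) _ => w; exact: soft_step_norm.
Qed.

Let measurable_Sn r : measurable_fun setT (Sn ^~ r).
Proof. exact: measurable_sample_hybrid. Qed.

(** One unit of zeta costs (e - 1) E[g (1 - g)], with e - 1 <= 3. *)
Lemma mean_step_shift m zeta : beta ^+ 2 <= rn ->
  mean_step zeta - mean_step (zeta + m%:R) <= m%:R * (3 * anti_const / beta).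
Proof.
move=> br; elim: m zeta => [|m IH] zeta; first by rewrite addr0 subrr mul0r.
have mS : m.+1%:R = m%:R + 1 :> R by rewrite natr1.
have -> : zeta + m.+1%:R = zeta + 1 + m%:R by rewrite mS addrAC addrA.
have -> : mean_step zeta - mean_step (zeta + 1 + m%:R) =
    (mean_step zeta - mean_step (zeta + 1)) + (mean_step (zeta + 1) - mean_step (zeta + 1 + m%:R)).
  by rewrite subrKA.
rewrite mS mulrDl mul1r [leRHS]addrC; apply: lerD; last exact: IH.
have i1 := integrable_step zeta measurable_Sn.
have i2 := integrable_step (zeta + 1) measurable_Sn.
have i3 : Pr.-integrable setT (EFin \o (fun w =>
    soft_step zeta (Sn w) * (1 - soft_step zeta (Sn w)))).
  apply: (@bounded_integrable _ _ _ _ _ 1) => [|w].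
    have m1 := measurable_step zeta measurable_Sn.
    by apply: measurable_funM => //; apply: measurable_funB => //; exact: measurable_cst.
  have := soft_step_ge0 zeta (Sn w); have := soft_step_le1 zeta (Sn w) => a b.
  by rewrite ger0_norm ?mulr_ge0 ?subr_ge0//; nra.
rewrite /mean_step -RintegralB//.
apply: (@le_trans _ _ (3 * \int[Pr]_w (soft_step zeta (Sn w) * (1 - soft_step zeta (Sn w))))).
  rewrite -RintegralZl//; apply: le_Rintegral => //.
  - exact: (integrableB measurableT i1 i2).
  - exact: (integrableZl measurableT _ i3).
  move=> w _; apply: le_trans (soft_step_shift_le zeta (Sn w) ler01) _.
  apply: ler_wpM2r; first by rewrite mulr_ge0 ?subr_ge0 ?soft_step_ge0 ?soft_step_le1.
  by have := @expR_le4 R 1; rewrite normr1 => /(_ (lexx _)); lra.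
by rewrite -mulrA ler_wpM2l// anticoncentration_rate.
Qed.

Lemma mean_step_anti zeta zeta' : zeta <= zeta' -> mean_step zeta' <= mean_step zeta.
Proof.
move=> zz; apply: le_Rintegral => //; try exact: integrable_step.
by move=> w _; exact: soft_step_anti.
Qed.

(** Thanks to the two signs, max_r S_r >= 0. *)
Lemma mean_step_low q : 1 - mean_step (- q) <= expR (- q).
Proof.
have : 1 - expR (- q) <= mean_step (- q).
  apply: (@Rintegral_ge_cst _ _ _ Pr _ 1) => [|w|w]; first exact: measurable_step.
    exact: soft_step_norm.
  rewrite lerBlDr -lerBlDl.
  have [D0|D0] := leP 0 (deviation_sum n w (grid lo hi n 0%N)).
    apply: (@soft_step_large _ _ _ _ _ (ord0, false)).
    by rewrite addNr /Sn hybrid0_deviation expr0 mul1r mulr_ge0// ltW.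
  apply: (@soft_step_large _ _ _ _ _ (ord0, true)).
  by rewrite addNr /Sn hybrid0_deviation expr1 mulN1r mulr_ge0 ?oppr_ge0// ltW.
by rewrite lerBlDr addrC -lerBlDr; lra.
Qed.

Lemma mean_step_high q : mean_step (n%:R * (theta * T) + q) <= #|{: index n}|%:R * expR (- q).
Proof.
apply: (@Rintegral_le_cst _ _ _ Pr _ 1) => [|w|w]; first exact: measurable_step.
  exact: soft_step_norm.
apply: soft_step_small => r; rewrite addrK; apply: le_trans (ler_norm _) _.
apply: le_trans (ler_norm_sum _ _ _) _.
have -> : n%:R * (theta * T) = \sum_(i < n) (theta * T) by rewrite sumr_const card_ord mulr_natl.
by apply: ler_sum => i _; rewrite ltn0 mul1r feature_norm// ltW.
Qed.

(** The function zeta |-> E soft_step zeta (S) goes from 1 to 0; among steps of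
    length 1 the last one above e overshoots e by at most the variation over one
    step. *)
Lemma mean_step_level e : beta ^+ 2 <= rn -> 0 < e < 1 ->
  exists zeta, e < mean_step zeta /\ mean_step zeta <= e + 3 * anti_const / beta.
Proof.
move=> br /andP[e0 e1].
pose q : R := - ln ((1 - e) / 2).
have q1 : e < mean_step (- q).
  have := mean_step_low q; rewrite /q opprK lnK ?posrE; last by rewrite divr_gt0 ?subr_gt0.
  by move=> h; lra.
pose N : R := #|{: index n}|%:R.
have N0 : 0 < N.
  by rewrite /N ltr0n; apply/card_gt0P; exists (ord0, true).
pose D : R := n%:R * (theta * T) - ln (e / N).
have D1 : mean_step D <= e.
  apply: le_trans (mean_step_high (- ln (e / N))) _.
  by rewrite opprK lnK ?posrE ?divr_gt0// mulrC divfK ?gt_eqF.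
have [|k kP kmin] := @ex_minnP (fun k => mean_step (- q + k%:R) <= e).
  exists (Num.truncn (D + q)).+1; apply: le_trans D1; apply: mean_step_anti.
  have := truncnS_gt (D + q); lra.
case: k kP kmin => [|k] kP kmin.
  by move: kP; rewrite addr0 => /(lt_le_trans q1); rewrite ltxx.
exists (- q + k%:R); split.
  by rewrite ltNge; apply/negP => /kmin; rewrite ltnn.
have := mean_step_shift 1 (- q + k%:R) br; rewrite mul1r.
have -> : - q + k%:R + 1 = - q + k.+1%:R by rewrite -natr1 addrA.
rewrite lerBlDr => h; apply: le_trans h _.
by rewrite [leRHS]addrC lerD2l.
Qed.

Let K := \int[normal_prob (0 : R) 1]_x (`|x| ^+ 3).

Let Vn w : index n -> R := V theta w.

Let measurable_Vn r : measurable_fun setT (Vn ^~ r).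
Proof. exact: measurable_sample_hybrid. Qed.

Let tT0 : 0 <= theta * T. Proof. by rewrite mulr_ge0// ltW. Qed.

Let feature_b e (r : index n) : `|feature theta e r| <= theta * T.
Proof. exact: feature_norm (ltW _). Qed.

Definition lindeberg_const : R := 280 * T ^+ 3 * (1 + K).

(** There are n replacements, each of cost theta^3 = (beta / sqrt n)^3. *)
Lemma lindeberg_rate zeta :
  mean_step zeta - lindeberg_const * (beta ^+ 3 / rn) <= \int[Pr]_w soft_step zeta (Vn w).
Proof.
have := lindeberg indep (measurable_feature theta) measurable_multiplier_fun
  tT0 feature_b (feature_mean0 theta) xi_standard zeta n.
rewrite -/(mean_step _) -/K.
have -> : n%:R * (280 * (theta * T) ^+ 3 * (1 + K)) = lindeberg_const * (beta ^+ 3 / rn).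
  by rewrite /theta /lindeberg_const -rn2; field; rewrite gt_eqF.
rewrite ler_norml => /andP[h _]; lra.
Qed.

(** The scaled bootstrap process on the signed grid. *)
Definition Wn w (r : index n) : R :=
  theta * ((-1) ^+ r.2 * bootstrap_sum n w (grid lo hi n r.1)).

Let mxi i : measurable_fun setT (xi i : Omega -> R).
Proof. exact: (@measurable_funP _ _ _ _ _ (xi i)). Qed.

Let measurable_Wn r : measurable_fun setT (Wn ^~ r).
Proof.
apply: measurable_funM; first exact: measurable_cst.
by apply: measurable_funM; [exact: measurable_cst|exact: measurable_bootstrap_sum].
Qed.

Let Xi w := \sum_(i < n) xi i w.

Lemma centering_error w r :
  Wn w r - Vn w r = - (theta * ((-1) ^+ r.2 * (Xi w * deviation_sum n w (grid lo hi n r.1) / n%:R))).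
Proof.
have nR : n%:R != 0 :> R by rewrite pnatr_eq0 -lt0n.
set t := grid lo hi n r.1.
have -> : Vn w r = theta * ((-1) ^+ r.2 * \sum_(i < n) xi i w * deviation (Y (inl (i : nat)) w) t).
  rewrite /Vn /V /hybrid !mulr_sumr; apply: eq_bigr => i _; rewrite ltn_ord /feature.
  by rewrite mulrCA (mulrCA (xi i w)).
have eD : emp_mean (fun k => lambda k w : landscape T) n t - mu t = deviation_sum n w t / n%:R.
  rewrite /deviation_sum /emp_mean /deviation sumrB/= sumr_const card_ord -[_ *+ n]mulr_natl.
  by field.
rewrite /Wn -/t -mulrBr -mulrBr -mulrN -mulrN; congr (_ * (_ * _)).
rewrite /bootstrap_sum -sumrB -mulrA -eD /Xi mulr_suml -sumrN; apply: eq_bigr => i _.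
by rewrite /deviation /=; ring.
Qed.

(** The centring error is a product of two sums of size sqrt n, divided by n. *)
Lemma centering_norm w r : `|Wn w r - Vn w r| <= theta / (2 * n%:R) * (Xi w ^+ 2 + Q w).
Proof.
have nR : 0 < n%:R :> R by rewrite ltr0n.
have -> : theta / (2 * n%:R) * (Xi w ^+ 2 + Q w) = theta * ((Xi w ^+ 2 + Q w) / 2 / n%:R).
  by rewrite invfM; ring.
rewrite centering_error normrN normrM ger0_norm ?(ltW theta0)// ler_wpM2l ?(ltW theta0)//.
rewrite normrM normrX normrN1 expr1n mul1r normrM normfV (ger0_norm (ler0n _ n)).
rewrite ler_wpM2r ?invr_ge0 ?(ltW nR)// ler_pdivlMr// normrM.
have := deviation_Q w r.
rewrite -(real_normK (num_real (Xi w))) -(real_normK (num_real (deviation_sum _ _ _))).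
move: `|deviation_sum _ _ _| `|Xi w| => D X DQ.
by have := sqr_ge0 (D - X); nra.
Qed.

Definition centering_const : R := 283 * (1 + 10 * T ^+ 2) / 2.

Lemma centering_rate zeta :
  \int[Pr]_w `|soft_step zeta (Wn w) - soft_step zeta (Vn w)| <= centering_const * theta.
Proof.
have nR : 0 < n%:R :> R by rewrite ltr0n.
have [iQ eQ] := deviation_energy lo0 lohi hiT n0.
have [iX eX] : Pr.-integrable setT (EFin \o (fun w => Xi w ^+ 2)) /\
    \int[Pr]_w (Xi w ^+ 2) <= n%:R.
  apply: nonneg_integrable => [|w|]; [|exact: sqr_ge0|exact: xi_sum_sqr].
  by apply: measurable_funX; apply: measurable_sum.
have iW := integrable_step zeta measurable_Wn.
have iV := integrable_step zeta measurable_Vn.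
pose C := 283 * (theta / (2 * n%:R)).
have C0 : 0 <= C.
  by apply: mulr_ge0; [exact: ler0n|apply: divr_ge0; [exact: ltW|exact: mulr_ge0]].
have iXQ : Pr.-integrable setT (EFin \o (fun w => Xi w ^+ 2 + Q w)).
  exact: (integrableD measurableT iX iQ).
apply: (@le_trans _ _ (\int[Pr]_w (C * (Xi w ^+ 2 + Q w)))).
  apply: le_Rintegral => //.
  - by apply: integrable_norm; exact: (integrableB measurableT iW iV).
  - exact: (integrableZl measurableT _ iXQ).
  move=> w _.
  have -> : Wn w = (fun r => Vn w r + (Wn w r - Vn w r)).
    by apply/funext => r; rewrite addrC subrK.
  rewrite /C -mulrA; apply: soft_step_lipschitz => [|r]; last exact: centering_norm.
  apply: mulr_ge0; first by rewrite divr_ge0// ltW.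
  exact: addr_ge0 (sqr_ge0 _) (energy_ge0 _ _).
rewrite RintegralZl// RintegralD//.
have -> : centering_const * theta = C * (n%:R + 10 * n%:R * T ^+ 2).
  by rewrite /C /centering_const; field; rewrite gt_eqF.
by rewrite ler_wpM2l// lerD.
Qed.

Lemma conditional_deviation zeta :
  \int[Pr]_w `|conditional_step Pr Y (@feature n theta) multiplier zeta n (sample_path Y w) -
     \int[Pr]_w' conditional_step Pr Y (@feature n theta) multiplier zeta n (sample_path Y w')|
  <= 564 * T ^+ 2 * (beta ^+ 2 / rn).
Proof.
apply: (conditional_step_deviation indep (measurable_feature theta) measurable_multiplier_fun
  tT0 feature_b xi_standard).
- apply: mulr_gt0; last by apply: divr_gt0 => //; exact: exprn_gt0.
  by apply: mulr_gt0; [rewrite ltr0n|exact: exprn_gt0].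
- rewrite le_eqVlt; apply/orP; left; apply/eqP.
  by rewrite /theta -rn2; field; rewrite gt_eqF.
Qed.

Let index_card : #|{: index n}|%:R = 2 * (n%:R + 1) :> R.
Proof. by rewrite card_prod card_ord card_bool natrM -natr1 mulrC. Qed.

Let lambda_family := preimage_family lambda setT.

Let xi_family := preimage_family xi setT.

Let sample_step zeta w := conditional_step Pr Y (@feature n theta) multiplier zeta n (sample_path Y w).

(** Multipliers are integrated out at fixed landscapes, in front of any weight
    that is a function of the landscapes. *)
Lemma data_decoupling zeta (a : Omega -> R) :
  measurable_fun [set: g_sigma_algebraType lambda_family] a -> (forall w, `|a w| <= 1) ->
  \int[Pr]_w (a w * soft_step zeta (Vn w)) = \int[Pr]_w (a w * sample_step zeta w).
Proof.
move=> ma a1.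
have m1 := id_g_sigma_measurable (@preimage_family_measurable _ _ _ _ lambda setT).
have m2 := id_g_sigma_measurable (@preimage_family_measurable _ _ _ _ xi setT).
pose X1 : {mfun Omega >-> g_sigma_algebraType lambda_family} :=
  HB.pack (idfun : Omega -> g_sigma_algebraType lambda_family)
    (isMeasurableFun.Build _ _ _ _ (idfun : Omega -> g_sigma_algebraType lambda_family) m1).
pose X2 : {mfun Omega >-> g_sigma_algebraType xi_family} :=
  HB.pack (idfun : Omega -> g_sigma_algebraType xi_family)
    (isMeasurableFun.Build _ _ _ _ (idfun : Omega -> g_sigma_algebraType xi_family) m2).
pose v (p : g_sigma_algebraType lambda_family * g_sigma_algebraType xi_family) :=
  weighted (@feature n theta) multiplier n (sample_path Y p.1) (sample_path Y p.2).
have mv r : measurable_fun setT (fun p => v p r).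
  apply: measurable_sum => i; apply: measurable_funM.
    exact: (measurableT_comp (@measurable_preimage_family _ _ _ _ xi setT i I)
      measurable_snd).
  apply: measurable_funM; first exact: measurable_cst.
  apply: measurable_funM; first exact: measurable_cst.
  apply: measurable_funB; last exact: measurable_cst.
  apply: (measurableT_comp (measurable_eval (in_domain r))).
  exact: (measurableT_comp (@measurable_preimage_family _ _ _ _ lambda setT i I)
    measurable_fst).
have mf : measurable_fun setT (fun p : g_sigma_algebraType lambda_family *
      g_sigma_algebraType xi_family => a p.1 * soft_step zeta (v p)).
  have ma1 : measurable_fun setT (fun p : g_sigma_algebraType lambda_family *
      g_sigma_algebraType xi_family => a p.1).
    apply: (measurableT_comp ma).
    exact: measurable_fst.
  have ms : measurable_fun setT (fun p => soft_step zeta (v p)).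
    by apply: (@measurable_soft_step _ _ _ _ zeta v mv).
  have X := measurable_funM ma1 ms.
  exact: X.
have fb p : `|a p.1 * soft_step zeta (v p)| <= 1.
  by rewrite normrM mulr_ile1// soft_step_norm.
have := bounded_decoupling (X1 := X1) (X2 := X2) _ mf fb.
have {1}-> : (fun w => a (X1 w, X2 w).1 * soft_step zeta (v (X1 w, X2 w))) =
    (fun w => a w * soft_step zeta (Vn w)).
  by apply/funext => w; rewrite /Vn /V hybrid_weighted.
move=> -> => [|A B mA mB]; last exact: lambda_xi_indep.
apply: eq_Rintegral => w _; rewrite /= RintegralZl//.
by apply: integrable_step => r; apply: (measurableT_comp (mv r)); apply: measurable_fun_pair.
Qed.

Section conditional_law.
Variable alpha : R.
Hypothesis alpha_gt0 : 0 < alpha.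
Hypothesis alpha_lt1 : alpha < 1.
Variable kappa : R.-pker (g_sigma_algebraType (preimage_family lambda `I_n)) ~>
  (measurableTypeR R).
Hypothesis kappa_cond : cond_distribution Pr
  (fun w => bootstrap_sup (fun i => lambda i w) (fun i => xi i w) n) kappa.

Let boot w := bootstrap_sup (fun i => lambda i w : landscape T) (fun i => xi i w) n.

Let family_measurable := @preimage_family_measurable _ _ _ _ lambda `I_n.

Let Z w := upper_quantile alpha (kappa w).

Let Wn_le w (r : index n) : Wn w r <= beta * boot w.
Proof.
have -> : Wn w r = beta * ((-1) ^+ r.2 * bootstrap_process (fun i => lambda i w : landscape T)
    (fun i => xi i w) n (grid lo hi n r.1)).
  by rewrite /Wn /bootstrap_process /bootstrap_sum /theta; ring.
apply: ler_wpM2l; first exact: ltW.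
apply: le_trans (ler_norm _) _; rewrite normrM normrX normrN1 expr1n mul1r.
exact: bootstrap_sup_ge.
Qed.

(** On the event A that the conditional tail at z is at most alpha, the conditional
    expectation of the soft step of W is at most alpha plus the mass of the soft
    step below its threshold; the same quantity is close to its mean in L^1.
    Integrating over A compares Pr A * mean with alpha * Pr A. *)
Lemma small_tail_probability zeta delta :
  fine (Pr (small_tail kappa alpha ((zeta - delta) / beta))) * (\int[Pr]_w soft_step zeta (Vn w) - alpha) <=
  2 * (n%:R + 1) * expR (- delta) + centering_const * theta + 564 * T ^+ 2 * (beta ^+ 2 / rn).
Proof.
set z := (zeta - delta) / beta; set A := small_tail kappa alpha z; set PA := fine _.
set D := [set w | z < boot w]; set m := \int[Pr]_w soft_step zeta (Vn w).
have mA : measurable A := measurable_small_tail kappa family_measurable alpha z.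
have mD : measurable D by exact: measurable_bootstrap_sup.
have mAD : measurable (A `&` D) by exact: measurableI.
pose a w : R := \1_A w.
have a0 w : 0 <= a w by [].
have a1 w : a w <= 1 by rewrite /a indicE; case: (w \in A).
have an w : `|a w| <= 1 by rewrite ger0_norm.
have ma : measurable_fun setT a by exact: measurable_indic.
have ia B : measurable B -> Pr.-integrable setT (EFin \o (fun w => \1_B w : R)).
  move=> mB; apply: (@bounded_integrable _ _ _ _ _ 1) => [|w]; first exact: measurable_indic.
  by rewrite indicE; case: (w \in B); rewrite ?normr1 ?normr0.
have int_indic B : measurable B -> \int[Pr]_w (\1_B w) = fine (Pr B).
  by move=> mB; rewrite /Rintegral integral_indic// setIT.
have ma1 : measurable_fun [set: g_sigma_algebraType lambda_family] a.
  by apply: measurable_indic; apply: (preimage_familyS (small_tail_sigma kappa alpha z)).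
have iaF (f : Omega -> R) : measurable_fun setT f -> (forall w, `|f w| <= 1) ->
    Pr.-integrable setT (EFin \o (fun w => a w * f w)).
  move=> mf f1; apply: (@bounded_integrable _ _ _ _ _ 1) => [|w]; first exact: measurable_funM.
  by rewrite normrM mulr_ile1.
have iW := iaF _ (measurable_step zeta measurable_Wn) (fun w => soft_step_norm zeta (Wn w)).
have iV := iaF _ (measurable_step zeta measurable_Vn) (fun w => soft_step_norm zeta (Vn w)).
have mS : measurable_fun setT (sample_step zeta).
  apply: (measurableT_comp _ (measurable_sample_path Y)).
  exact: measurable_conditional_step (measurable_feature theta) measurable_multiplier_fun _ _.
have Sb w : `|sample_step zeta w| <= 1.
  exact: conditional_step_norm measurable_multiplier_fun _ _ _.
have iS := iaF _ mS Sb.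
have mE : m = \int[Pr]_w sample_step zeta w.
  have := @data_decoupling zeta (fun=> 1) (measurable_cst _) (fun w => _).
  under eq_Rintegral do rewrite mul1r.
  by under [in RHS]eq_Rintegral do rewrite mul1r; apply => w; rewrite normr1.
clearbody m.
set N := 2 * (n%:R + 1) * expR (- delta).
have N0 : 0 <= N by rewrite mulr_ge0 ?expR_ge0// mulr_ge0// addr_ge0.
(* pointwise, 1_A soft_step(W) <= 1_(A and sup > z) + N *)
have h1 : \int[Pr]_w (a w * soft_step zeta (Wn w)) <= alpha * PA + N.
  apply: (@le_trans _ _ (\int[Pr]_w (\1_(A `&` D) w + N))).
    apply: (@Rintegral_bounded_le _ _ _ Pr _ _ 1 (1 + N)) => [|w||w|w].
    - exact/measurable_EFinP/(measurable_int _ iW).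
    - by rewrite normrM mulr_ile1// soft_step_norm.
    - by apply: measurable_funD; [exact: measurable_indic|exact: measurable_cst].
    - rewrite ger0_norm ?addr_ge0// lerD2r indicE; by case: (w \in _).
    rewrite indicE /a indicE in_setI.
    case: (boolP (w \in A)) => _; last by rewrite mul0r add0r.
    rewrite mul1r /=; case: (boolP (w \in D)) => wD.
      by apply: le_trans (soft_step_le1 _ _) _; rewrite lerDl.
    rewrite add0r /N -index_card; apply: soft_step_small => r.
    apply: le_trans (Wn_le w r) _; move: wD; rewrite notin_setE /D /= => /negP.
    by rewrite -leNgt /z ler_pdivlMr// mulrC.
  rewrite RintegralD//; last 2 first.
  - exact: ia.
  - exact: integrable_constant.
  rewrite Rintegral_probability_cst lerD2r int_indic//.
  have := small_tail_le family_measurable kappa_cond alpha z.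
  rewrite -/A -/D -(fineK (fin_num_measure Pr _ mA)) -(fineK (fin_num_measure Pr _ mAD)).
  by rewrite -EFinM lee_fin.
have h2 : \int[Pr]_w (a w * soft_step zeta (Vn w)) <=
    \int[Pr]_w (a w * soft_step zeta (Wn w)) + centering_const * theta.
  rewrite -lerBlDl -RintegralB//; apply: le_trans (centering_rate zeta).
  apply: le_Rintegral => //.
  - exact: (integrableB measurableT iV iW).
  - apply: integrable_norm; exact: (integrableB measurableT (integrable_step zeta measurable_Wn)
      (integrable_step zeta measurable_Vn)).
  move=> w _; rewrite -mulrBr distrC; apply: le_trans (ler_norm _) _.
  by rewrite normrM; apply: ler_piMl.
have h3 : PA * m - \int[Pr]_w (a w * sample_step zeta w) <= 564 * T ^+ 2 * (beta ^+ 2 / rn).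
  have -> : PA * m = \int[Pr]_w (m * a w).
    transitivity (m * \int[Pr]_w a w); first by rewrite (int_indic _ mA) mulrC.
    by rewrite RintegralZl//; exact: ia.
  rewrite -RintegralB//; last exact: (integrableZl measurableT _ (ia _ mA)).
  apply: le_trans (conditional_deviation zeta); rewrite -/(sample_step zeta) -mE.
  apply: le_Rintegral => //.
  - exact: (integrableB measurableT (integrableZl measurableT _ (ia _ mA)) iS).
  - apply: integrable_norm; apply: (@bounded_integrable _ _ _ _ _ (1 + `|m|)) => [|w].
      by apply: measurable_funB; [exact: mS|exact: measurable_cst].
    by apply: le_trans (ler_normB _ _) _; apply: lerD; [exact: Sb|exact: lexx].
  move=> w _; rewrite mulrC -mulrBr distrC; apply: le_trans (ler_norm _) _.
  by rewrite normrM; apply: ler_piMl.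
rewrite -(data_decoupling zeta ma1 an) in h3; rewrite mulrBr [PA * alpha]mulrC.
move: h1 h2 h3; move: (\int[Pr]_w (a w * soft_step zeta (Wn w)))
  (\int[Pr]_w (a w * soft_step zeta (Vn w))) => I1 I2.
move: (PA * m) (alpha * PA) (centering_const * theta) (564 * _ * _) => x1 x2 x3 x4; lra.
Qed.

Let emp w t := emp_mean (fun i => lambda i w : landscape T) n t.

(** The band fails to cover the mean function; the existential form, over a
    Lipschitz process, makes the event measurable. *)
Definition miss : set Omega :=
  [set w | exists2 t, lo <= t <= hi & 0 < `|emp w t - mu t| - Z w / rn].

Lemma measurable_miss : measurable miss.
Proof.
have inT t : lo <= t <= hi -> 0 <= t <= T.
  by move=> /andP[a b]; rewrite (le_trans lo0 a) (le_trans b hiT).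
apply: (@measurable_exists_itv _ _ _ _ _ (fun t w => `|emp w t - mu t| - Z w / rn) (fun=> 2)) => //.
  move=> t /inT t0T; apply: measurable_funB.
    apply: measurableT_comp => //; apply: measurable_funB; last exact: measurable_cst.
    apply: measurable_funM; first exact: measurable_cst.
    by apply: measurable_sum => i; exact: measurable_landscape.
  apply: measurable_funM; last exact: measurable_cst.
  by apply: measurable_quantile.
move=> w s t /inT s0T /inT t0T; rewrite opprB addrA subrK.
apply: le_trans (lerB_dist _ _) _.
have -> : emp w s - mu s - (emp w t - mu t) = (emp w s - emp w t) - (mu s - mu t) by ring.
apply: le_trans (ler_normB _ _) _; rewrite mulr2n mulrDl mul1r.
by apply: lerD; [exact: emp_mean_lipschitz|exact: mean_fun_lipschitz].
Qed.

Let deviation_sumE w t : deviation_sum n w t = n%:R * (emp w t - mu t).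
Proof.
rewrite /deviation_sum /emp /emp_mean /deviation sumrB/= sumr_const card_ord -[_ *+ n]mulr_natl.
by rewrite mulrBr mulrA divff ?mul1r// pnatr_eq0 -lt0n.
Qed.

Let theta_le1 : beta ^+ 2 <= rn -> theta <= 1.
Proof.
move=> br; rewrite ler_pdivrMr// mul1r; apply: le_trans br.
by rewrite expr2 ler_peMl// ltW.
Qed.

(** When the quantile is at least z, a miss at t gives a grid point where the
    deviation is at least z minus the oscillation over one cell, which costs at
    most 2 T after scaling, as theta <= 1; the two margins delta are those of the two sides of the soft step. *)
Lemma miss_soft_step w zeta delta : beta ^+ 2 <= rn -> miss w ->
  ~ small_tail kappa alpha ((zeta - delta) / beta) w ->
  1 - soft_step (zeta - (2 * delta + 2 * T)) (Sn w) <= expR (- delta).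
Proof.
move=> br [t tlh]; rewrite subr_gt0 => tZ /(quantile_ge alpha_gt0); rewrite -/(Z w) => zZ.
have [j tj] := grid_near n0 tlh.
have jlh : lo <= grid lo hi n j <= hi by apply: grid_bounds; rewrite // -ltnS.
have inT s : lo <= s <= hi -> 0 <= s <= T.
  by move=> /andP[a b]; rewrite (le_trans lo0 a) (le_trans b hiT).
have nR : 0 < n%:R :> R by rewrite ltr0n.
set s := grid lo hi n j in tj jlh *.
have st : `|(emp w t - mu t) - (emp w s - mu s)| <= 2 * T / n%:R.
  have -> : emp w t - mu t - (emp w s - mu s) = (emp w t - emp w s) - (mu t - mu s) by ring.
  apply: le_trans (ler_normB _ _) _.
  have ts : `|t - s| <= T / n%:R.
    apply: le_trans tj _; rewrite ler_wpM2r ?invr_ge0// lerBlDr (le_trans hiT)// lerDl//.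
  have -> : 2 * T / n%:R = T / n%:R + T / n%:R by field; rewrite gt_eqF.
  apply: lerD; apply: le_trans ts; first exact: emp_mean_lipschitz.
  by apply: mean_fun_lipschitz; exact: inT.
have big : zeta - delta - 2 * T <= theta * `|deviation_sum n w s|.
  rewrite deviation_sumE normrM ger0_norm//.
  have h : Z w / rn - 2 * T / n%:R <= `|emp w s - mu s|.
    have := lerB_dist (emp w t - mu t) (emp w s - mu s).
    move: tZ st; move: `|_ - _ - _| `|emp w t - _| `|emp w s - _| (Z w / rn) => a b e z; lra.
  have h1 : theta * (n%:R * (Z w / rn - 2 * T / n%:R)) = beta * Z w - theta * (2 * T).
    by rewrite /theta -rn2; field; rewrite gt_eqF.
  have h2 : zeta - delta <= beta * Z w by rewrite mulrC -ler_pdivrMr.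
  have h3 : theta * (2 * T) <= 2 * T.
    by rewrite ler_piMl ?theta_le1// mulr_ge0.
  apply: (@le_trans _ _ (theta * (n%:R * (Z w / rn - 2 * T / n%:R)))).
    by rewrite h1; lra.
  by rewrite ler_wpM2l ?(ltW theta0)// ler_wpM2l.
have [D0|D0] := leP 0 (deviation_sum n w s).
  apply: (@soft_step_large _ _ _ _ _ (j, false)).
  rewrite /Sn hybrid0_deviation expr0 mul1r/= -/s -(ger0_norm D0).
  by apply: le_trans big; lra.
apply: (@soft_step_large _ _ _ _ _ (j, true)).
rewrite /Sn hybrid0_deviation expr1 mulN1r/= -/s -(ltr0_norm D0).
by apply: le_trans big; lra.
Qed.

Definition tail_const : R := 1 + centering_const + 564 * T ^+ 2.

Let anti_ge0 : 0 <= anti_const.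
Proof.
rewrite /anti_const; apply: divr_ge0; last exact: sqr_ge0.
by have := exprn_ge0 2 T0; have := exprn_ge0 3 T0; lra.
Qed.

Let lindeberg_ge0 : 0 <= lindeberg_const.
Proof.
have K0 : 0 <= K by apply: Rintegral_ge0 => x _; exact: exprn_ge0.
rewrite /lindeberg_const; apply: mulr_ge0; last exact: addr_ge0.
by have := exprn_ge0 3 T0; lra.
Qed.

Let centering_ge0 : 0 <= centering_const.
Proof. by rewrite /centering_const; have := exprn_ge0 2 T0; lra. Qed.

Let rn_ge1 : 1 <= rn.
Proof. by rewrite -sqrtr1 ler_wsqrtr// ler1n. Qed.

(** The margin delta = ln (4 n^2) makes the tails of the soft step of order 1/n
    in spite of the 2 (n + 1) indices; k counts the unit steps of zeta that
    separate the level used for the quantile from the one used for S.  If the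
    level e is not below 1 there is nothing to prove. *)
Lemma miss_probability k : beta ^+ 2 <= rn -> 1 <= k%:R :> R ->
  2 * ln (4 * n%:R ^+ 2) + 2 * T <= k%:R ->
  fine (Pr miss) <= alpha + (lindeberg_const + tail_const + 1) * (beta ^+ 3 / rn) +
    (1 + 6 * anti_const) * (k%:R / beta).
Proof.
move=> br k1 kd.
have nR : 0 < n%:R :> R by rewrite ltr0n.
have nR1 : 1 <= n%:R :> R by rewrite ler1n.
set b3 := beta ^+ 3 / rn; have b30 : 0 <= b3 by rewrite divr_ge0 ?exprn_ge0 ?ltW.
have ib : 1 / beta <= k%:R / beta by rewrite ler_wpM2r ?invr_ge0 ?(ltW beta0).
have kb0 : 0 <= k%:R / beta by rewrite divr_ge0 ?(ltW beta0).
have b1 : 0 < 1 / beta by rewrite divr_gt0.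
have fin A : measurable A -> fine (Pr A) <= 1.
  move=> mA; rewrite -lee_fin fineK ?fin_num_measure//; exact: probability_le1.
pose e := alpha + lindeberg_const * b3 + 1 / beta.
have tc0 : 0 <= tail_const.
  by rewrite /tail_const; have := exprn_ge0 2 T0; have := centering_ge0; lra.
have [e1|e1] := leP 1 e.
  apply: le_trans (fin _ measurable_miss) _; apply: le_trans e1 _.
  apply: lerD; first apply: lerD => //.
    by apply: ler_wpM2r => //; move: tail_const tc0 => t t0; lra.
  by apply: le_trans ib _; apply: ler_peMl => //; have := anti_ge0; lra.
have e0 : 0 < e.
  have := mulr_ge0 lindeberg_ge0 b30; rewrite /e; move: (lindeberg_const * b3) => Lb.
  by move: alpha_gt0 b1; lra.
have [|zeta [ez ze]] := mean_step_level br (e := e); first by rewrite e0.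
pose delta : R := ln (4 * n%:R ^+ 2).
have expd : expR (- delta) = (4 * n%:R ^+ 2)^-1.
  by rewrite expRN lnK// posrE mulr_gt0 ?exprn_gt0.
have expd1 : expR (- delta) <= b3.
  rewrite expd; apply: (@le_trans _ _ rn^-1).
    rewrite lef_pV2 ?posrE ?mulr_gt0 ?exprn_gt0// -rn2.
    by have := rn_ge1; rewrite -exprM; move: rn => r r1; have := exprn_ege1 3 r1; nra.
  by rewrite /b3 -[leLHS]mul1r ler_wpM2r ?invr_ge0 ?(ltW rn_gt0)// exprn_ege1.
set z := (zeta - delta) / beta; set A := small_tail kappa alpha z.
have mA : measurable A := measurable_small_tail kappa family_measurable alpha z.
have PA0 : 0 <= fine (Pr A) by rewrite fine_ge0.
have PA : fine (Pr A) <= tail_const * b3.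
  have := small_tail_probability zeta delta; rewrite -/z -/A.
  have := lindeberg_rate zeta; rewrite -/b3; move: (\int[Pr]_w _) => m hm hA.
  have m_large : 1 / beta <= m - alpha by move: ez; rewrite /e; lra.
  have {}hA : fine (Pr A) * (1 / beta) <= 2 * (n%:R + 1) * expR (- delta) +
      centering_const * theta + 564 * T ^+ 2 * (beta ^+ 2 / rn).
    by apply: le_trans hA; rewrite ler_wpM2l.
  have t1 : 2 * (n%:R + 1) * expR (- delta) <= rn^-1.
    rewrite expd ler_pdivrMr ?mulr_gt0 ?exprn_gt0// ler_pdivlMl//.
    have := rn_ge1; rewrite -rn2; move: rn => r r1.
    have := exprn_ege1 3 r1; have := ler_peMr (y := r) (x := r); nra.
  have t2 : centering_const * theta <= centering_const * (beta ^+ 2 / rn).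
    rewrite ler_wpM2l// /theta ler_wpM2r ?invr_ge0 ?(ltW rn_gt0)//.
    by rewrite expr2 ler_peMl// ltW.
  have t3 : rn^-1 <= beta ^+ 2 / rn.
    by rewrite -[leLHS]mul1r ler_wpM2r ?invr_ge0 ?(ltW rn_gt0)// exprn_ege1.
  have -> : tail_const * b3 = (beta ^+ 2 / rn + centering_const * (beta ^+ 2 / rn) +
      564 * T ^+ 2 * (beta ^+ 2 / rn)) * beta.
    by rewrite /tail_const /b3; field; rewrite gt_eqF.
  rewrite -ler_pdivrMr//; rewrite mul1r in hA; apply: le_trans hA _.
  by apply: lerD => //; apply: lerD => //; exact: le_trans t1 t3.
pose z' := zeta - (2 * delta + 2 * T).
have mM := measurable_miss.
have missE : fine (Pr miss) <= fine (Pr A) + mean_step z' + expR (- delta).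
  pose ind (B : set Omega) w : R := \1_B w.
  have ia B : measurable B -> Pr.-integrable setT (EFin \o ind B).
    move=> mB; apply: (@bounded_integrable _ _ _ _ _ 1) => [|w]; first exact: measurable_indic.
    by rewrite /ind indicE; case: (w \in B); rewrite ?normr1 ?normr0.
  have int_indic B : measurable B -> fine (Pr B) = \int[Pr]_w ind B w.
    by move=> mB; rewrite /Rintegral integral_indic// setIT.
  have istep := integrable_step z' measurable_Sn.
  have icst : Pr.-integrable setT (EFin \o (fun _ : Omega => expR (- delta))).
    exact: integrable_constant.
  have i2 : Pr.-integrable setT (EFin \o (fun w => ind A w + soft_step z' (Sn w))).
    exact: (integrableD measurableT (ia _ mA) istep).
  rewrite !int_indic// /mean_step -RintegralD ?ia//.
  rewrite -[expR (- delta)](Rintegral_probability_cst Pr) -RintegralD//.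
  apply: le_Rintegral => //; first exact: ia.
    exact: (integrableD measurableT i2 icst).
  move=> w _; rewrite /ind !indicE.
  have s0 := soft_step_ge0 z' (Sn w); have x0 := expR_ge0 (- delta).
  case: (boolP (w \in miss)) => wM; last by rewrite !addr_ge0.
  case: (boolP (w \in A)) => wA; first by rewrite -addrA lerDl addr_ge0.
  have /= := @miss_soft_step w zeta delta br; rewrite -/z' -/z -/A.
  move=> /(_ (set_mem wM)); rewrite notin_setE in wA; move=> /(_ wA); lra.
have gz : mean_step z' <= mean_step zeta + k%:R * (3 * anti_const / beta).
  apply: (@le_trans _ _ (mean_step (zeta - k%:R))).
    by apply: mean_step_anti; rewrite /z' lerD2l lerN2.
  by rewrite [leRHS]addrC -lerBlDr; have := mean_step_shift k (zeta - k%:R) br; rewrite subrK.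
move: missE gz PA expd1 ze ib; rewrite /e; have := anti_ge0.
move: (fine _) (fine _) (mean_step _) (mean_step _) (expR _) => p1 p2 p3 p4 p5.
move: anti_const lindeberg_const tail_const => a b t.
have -> : k%:R * (3 * a / beta) = 3 * a * (k%:R / beta) by ring.
have -> : 3 * a / beta = 3 * a * (1 / beta) by ring.
move: (1 / beta) (k%:R / beta) => r q a0 h1 h2 h3 h4 h5 h6.
have h7 : a * r <= a * q by rewrite ler_wpM2l.
lra.
Qed.
End conditional_law.
End scale.
End coverage.
End landscape_sample.

(** * The rate and the theorem *)
Section rate.
Context {R : realType}.

Definition rate (n : nat) : R := (ln n%:R) `^ (7 / 8) / n%:R `^ (1 / 8).

(** With a = n^(1/8) and b = (ln n)^(1/8), beta = a b, sqrt n = a^4 and the rate is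
    b^7 / a = b^8 / beta, while beta^3 / sqrt n = b^3 / a. *)
Lemma smoothing_scale n : (0 < n)%N -> 1 <= ln n%:R :> R ->
  exists beta : R, [/\ 1 <= beta, beta ^+ 2 <= Num.sqrt n%:R,
    beta ^+ 3 / Num.sqrt n%:R <= rate n & ln n%:R / beta = rate n].
Proof.
move=> n0 L1; have nR : 0 < n%:R :> R by rewrite ltr0n.
have root8 (x : R) : 0 <= x -> (x `^ (1 / 8)) ^+ 8 = x.
  move=> x0; rewrite -powR_mulrn ?powR_ge0// -powRrM.
  have -> : 1 / 8 * 8%:R = 1 :> R by field.
  by rewrite powRr1.
set L := ln n%:R in L1 *; have L0 : 0 <= L by apply: le_trans L1.
have Ln : L <= n%:R.
  have := expR_ge1Dx L; rewrite lnK ?posrE//; lra.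
rewrite /rate -/L.
have -> : L `^ (7 / 8) = (L `^ (1 / 8)) ^+ 7.
  rewrite -powR_mulrn ?powR_ge0// -powRrM; congr (_ `^ _); lra.
have := root8 _ (ltW nR); have := root8 _ L0.
have : 1 <= L `^ (1 / 8).
  by rewrite -[leLHS](powRr0 L); apply: ler_powR => //; lra.
have : L `^ (1 / 8) <= n%:R `^ (1 / 8).
  by apply: ge0_ler_powR; rewrite ?nnegrE ?(ltW nR)//; lra.
move: (n%:R `^ _) (L `^ _) => a b ba b1 b8 a8.
have a1 : 1 <= a by exact: le_trans ba.
have a0 : 0 < a by exact: lt_le_trans a1.
have b0 : 0 < b by exact: lt_le_trans b1.
have sE : Num.sqrt n%:R = a ^+ 4.
  by rewrite -a8 -[8%N]/(4 * 2)%N exprM sqrtr_sqr ger0_norm// exprn_ge0// ltW.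
exists (a * b); rewrite sE; split.
- by rewrite -[leLHS]mulr1; apply: ler_pM.
- by rewrite exprMn -[4%N]/(2 + 2)%N exprD ler_wpM2l ?sqr_ge0// lerXn2r ?nnegrE// ltW.
- have -> : (a * b) ^+ 3 / a ^+ 4 = b ^+ 3 / a by field; rewrite gt_eqF.
  rewrite ler_wpM2r ?invr_ge0 ?(ltW a0)// -[7%N]/(3 + 4)%N exprD ler_peMr ?exprn_ge0 ?(ltW b0)//.
  exact: exprn_ege1.
- by rewrite -b8; field; rewrite !gt_eqF.
Qed.

Lemma ln_eventually_ge1 : \forall n \near \oo, (0 < n)%N /\ 1 <= ln (n%:R : R).
Proof.
have := @nbhs_infty_ger R (expR 1); apply: filterS => n en.
have nR : 0 < n%:R :> R by apply: lt_le_trans en; exact: expR_gt0.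
by split; [rewrite ltr0n in nR|rewrite -[leLHS]expRK ler_ln ?posrE ?expR_gt0].
Qed.

Lemma shift_count (T : R) n : 0 <= T -> (0 < n)%N -> 1 <= ln n%:R :> R ->
  exists k : nat, [/\ 1 <= k%:R :> R, 2 * ln (4 * n%:R ^+ 2) + 2 * T <= k%:R &
    k%:R <= (2 * ln 4 + 5 + 2 * T) * ln n%:R].
Proof.
move=> T0 n0 L1; have nR : 0 < n%:R :> R by rewrite ltr0n.
pose x : R := 2 * ln (4 * n%:R ^+ 2) + 2 * T.
have l4 : 0 <= ln 4 :> R by rewrite ln_ge0// ler1n.
have xE : x = 2 * (ln 4 + ln n%:R *+ 2) + 2 * T.
  by rewrite /x lnM ?posrE ?exprn_gt0// lnXn.
have x0 : 0 <= x by rewrite xE mulr2n; lra.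
exists (Num.truncn x).+1; have /andP[tx xt] := truncn_itv x0; split.
- by rewrite ler1n.
- exact: ltW.
- rewrite -natr1; apply: (@le_trans _ _ (x + 1)); first by rewrite lerD2r.
  by rewrite xE mulr2n; nra.
Qed.
End rate.

Theorem theorem3 (R : realType) (T alpha : R)
  (T_gt0 : 0 < T) (alpha_gt0 : 0 < alpha) (alpha_lt1 : alpha < 1)
  (* the sigma-algebra <<s G >> on landscapes makes all evaluations measurable *)
  (G : set (set (landscape T)))
  (G_eval : forall t, 0 <= t <= T ->
     measurable_fun [set: g_sigma_algebraType G]
       (fun f : landscape T => f t : measurableTypeR R))
  (P : probability (g_sigma_algebraType G) R)
  (d : measure_display) (Omega : measurableType d) (Pr : probability Omega R)
  (lambda : nat -> {mfun Omega >-> g_sigma_algebraType G})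
  (lambda_indep : independent_seq Pr lambda)
  (lambda_law : forall i A, measurable A -> distribution Pr (lambda i) A = P A)
  (xi : nat -> {mfun Omega >-> measurableTypeR R})
  (xi_indep : independent_seq Pr xi)
  (xi_law : forall i A, measurable A ->
     distribution Pr (xi i) A = normal_prob (0 : R) 1 A)
  (lambda_xi_indep : independent_of Pr lambda xi)
  (t_lo t_hi c : R) (t_lo_ge0 : 0 <= t_lo) (t_lo_hi : t_lo <= t_hi)
  (t_hi_leT : t_hi <= T) (c_gt0 : 0 < c)
  (sigma_gt : forall t, t_lo <= t <= t_hi -> c < std_fun Pr (lambda 0%N) t)
  (* the conditional law of the bootstrap supremum given the first n landscapes *)
  (kappa : forall n,
     R.-pker (g_sigma_algebraType (preimage_family lambda `I_n)) ~>
             (measurableTypeR R))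
  (kappa_cond : forall n,
     cond_distribution Pr
       (fun w => bootstrap_sup (fun i => lambda i w) (fun i => xi i w) n)
       (kappa n)) :
  let Z n w := upper_quantile alpha (kappa n w) in
  let ell n w := band_lower (fun i => lambda i w) n (Z n w) in
  let u n w := band_upper (fun i => lambda i w) n (Z n w) in
  let mu := mean_fun Pr (lambda 0%N) in
  (exists2 e : nat -> R,
     e =O_\oo (fun n : nat => (ln n%:R) `^ (7 / 8) / n%:R `^ (1 / 8)) &
     forall n, (0 < n)%N ->
       ((1 - alpha - e n)%:E <=
        Pr [set w | forall t, (t_lo <= t <= t_hi)%R ->
                      (ell n w t <= mu t <= u n w t)%R])%E) /\
  bigO_P Pr
    (fun n w => sup [set u n w t - ell n w t | t in `[0, T]])
    (fun n => Num.sqrt (n%:R^-1)).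
Proof.
move=> Z ell u mu.
have same_law i A : measurable A -> distribution Pr (lambda i) A = distribution Pr (lambda 0%N) A.
  by move=> mA; rewrite !lambda_law.
have variance t : t_lo <= t <= t_hi -> c ^+ 2 <= fine ('V_Pr[fun w => lambda 0%N w t])%E.
  move=> /sigma_gt; rewrite /std_fun => cs.
  have v0 : 0 <= fine ('V_Pr[fun w => lambda 0%N w t])%E.
    have := lt_trans c_gt0 cs; rewrite sqrtr_gt0; exact: ltW.
  by rewrite -[leRHS]sqr_sqrtr// lerXn2r ?nnegrE ?sqrtr_ge0 ?(ltW c_gt0)// ltW.
pose missed n := miss Pr t_lo t_hi alpha (kappa n).
have m_missed n : (0 < n)%N -> measurable (missed n).
  by move=> n0; exact: measurable_miss.
split.
  exists (fun n => Num.max 0 (fine (Pr (missed n)) - alpha)).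
    pose C : R := `|lindeberg_const T + tail_const T + 1| +
      `|1 + 6 * anti_const T c| * (2 * ln 4 + 5 + 2 * T).
    apply/eqO_exP; exists (1 + `|C|); first by rewrite ltr_wpDr.
    have := @ln_eventually_ge1 R; apply: filterS => n [n0 L1].
    have [beta [b1 b2 b3 bL]] := smoothing_scale n0 L1.
    have [k [k1 kT kL]] := shift_count (ltW T_gt0) n0 L1.
    have := miss_probability T_gt0 G_eval same_law xi_law lambda_indep xi_indep lambda_xi_indep
      t_lo_ge0 t_lo_hi t_hi_leT c_gt0 variance n0 b1 alpha_gt0 alpha_lt1 (kappa_cond n)
      b2 k1 kT.
    rewrite -/(missed n) => H; rewrite -/(rate n).
    have beta0 : 0 < beta by exact: lt_le_trans b1.
    have r0 : 0 <= rate n :> R by rewrite divr_ge0 ?powR_ge0.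
    have kr : k%:R / beta <= (2 * ln 4 + 5 + 2 * T) * rate n.
      by rewrite -bL mulrA ler_wpM2r ?invr_ge0 ?(ltW beta0).
    have kb0 : 0 <= k%:R / beta by rewrite divr_ge0 ?(ltW beta0).
    rewrite (ger0_norm r0) ger0_norm ?le_max ?lexx// ge_max.
    apply/andP; split; first by rewrite mulr_ge0// addr_ge0.
    apply: (@le_trans _ _ (C * rate n)); last first.
      by rewrite ler_wpM2r//; apply: le_trans (ler_norm _) _; rewrite lerDr.
    rewrite lerBlDl; apply: le_trans H _; rewrite -addrA lerD2l /C [leRHS]mulrDl; apply: lerD.
      apply: (@le_trans _ _ (`|lindeberg_const T + tail_const T + 1| * (beta ^+ 3 / Num.sqrt n%:R))).
        by rewrite ler_wpM2r ?ler_norm// divr_ge0 ?sqrtr_ge0 ?exprn_ge0 ?(ltW beta0).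
      by rewrite ler_wpM2l.
    rewrite -mulrA; apply: (@le_trans _ _ (`|1 + 6 * anti_const T c| * (k%:R / beta))).
      by rewrite ler_wpM2r// ler_norm.
    by rewrite ler_wpM2l.
  move=> n n0.
  have -> : [set w | forall t, (t_lo <= t <= t_hi)%R -> (ell n w t <= mu t <= u n w t)%R] =
      ~` missed n.
    apply/seteqP; split=> w /=.
      move=> cov [t tlh]; rewrite subr_gt0 ltNge => /negP; apply.
      have := cov t tlh; rewrite /ell /u /band_lower /band_upper -/(Z n w) => /andP[a b].
      by rewrite ler_norml -/mu; apply/andP; split; lra.
    move=> notmiss t tlh; have : ~ (0 < `|emp_mean (fun i => lambda i w : landscape T) n t - mu t| -
        Z n w / Num.sqrt n%:R) by move=> h; apply: notmiss; exists t.
    move/negP; rewrite -leNgt subr_le0 ler_norml => /andP[a b].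
    by rewrite /ell /u /band_lower /band_upper; apply/andP; split; lra.
  rewrite probability_setC; last exact: m_missed.
  rewrite -(fineK (fin_num_measure Pr _ (m_missed n n0))) -EFinB lee_fin.
  have : fine (Pr (missed n)) - alpha <= Num.max 0 (fine (Pr (missed n)) - alpha).
    by rewrite le_max lexx orbT.
  lra.
move=> eps eps0.
pose B : R := 28 * T ^+ 2; have B0 : 0 <= B.
  by apply: mulr_ge0; [exact: ler0n|exact: sqr_ge0].
have ae : 0 < alpha * eps by exact: mulr_gt0.
pose m : R := 1 + B / (alpha * eps).
have Be0 : 0 <= B / (alpha * eps) by rewrite divr_ge0// ltW.
have m1 : 1 <= m by rewrite lerDl.
have m0 : 0 < m by exact: lt_le_trans m1.
exists (2 * m); exists 1%N => // n /= n0.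
have rn0 : 0 < Num.sqrt n%:R :> R by rewrite sqrtr_gt0 ltr0n.
have -> : [set w | 2 * m * `|Num.sqrt n%:R^-1| < `|sup [set u n w t - ell n w t | t in `[0, T]]|] =
    [set w | m < `|Z n w|].
  have E w : (2 * m * `|Num.sqrt n%:R^-1| < `|sup [set u n w t - ell n w t | t in `[0, T]]|) =
      (m < `|Z n w|).
    have -> : [set u n w t - ell n w t | t in `[0, T]] = [set 2 * (Z n w / Num.sqrt n%:R)].
      apply/seteqP; split=> [_ [t _ <-]|_ ->] /=.
        by rewrite /u /ell /band_upper /band_lower; ring.
      exists 0; first by rewrite /= in_itv/= lexx ltW.
      by rewrite /u /ell /band_upper /band_lower; ring.
    rewrite sup1 sqrtrV// ger0_norm ?invr_ge0 ?(ltW rn0)//.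
    rewrite normrM normrM normfV (ger0_norm (ltW rn0)) ger0_norm// mulrA.
    by rewrite ltr_pM2r ?invr_gt0// ltr_pM2l.
  by apply/seteqP; split=> w /=; rewrite E.
have family_m := @preimage_family_measurable _ _ _ _ lambda `I_n.
apply: (@quantile_tail R _ Omega Pr _ (fun w => bootstrap_sup (fun i => lambda i w : landscape T)
  (fun i => xi i w) n) (kappa n) family_m _ (kappa_cond n) alpha) => //.
- by move=> z; exact: measurable_bootstrap_sup.
- by move=> w; exact: bootstrap_sup_ge0.
have := bootstrap_sup_tail T_gt0 G_eval xi_law lambda_indep xi_indep lambda_xi_indep n0 m0.
move=> /le_trans; apply; rewrite lee_fin -/B ler_pdivrMr ?exprn_gt0//.
have : B = alpha * eps * (m - 1) by rewrite /m; field; rewrite !gt_eqF.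
move=> ->; rewrite ler_pM2l//; nra.
Qed.
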